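(* Let $k$ be a field of characteristic $p>0$, and let $G$ be the free product of groups $H_n$, $n\in\mathbb{N}$, with each $H_n$ cyclic of order $p$. Then $\widetilde{\mathrm{Mod}}(kG)$ is not stratified by its spectrum of dualisable objects $\mathrm{Spc}(\widetilde{\mathrm{Mod}}(kG)^d)$.
   Context: For such $G$, $\mathscr{T}=\widetilde{\mathrm{Mod}}(kG)$ is the stable module category: the localisation of the category of all $kG$-modules at the homomorphisms whose restriction to every finite subgroup $F\le G$ is an isomorphism in the usual stable module category $\mathrm{StMod}(kF)$. Equivalently, objects are all $kG$-modules and morphisms are $\mathrm{colim}_n\,\underline{\mathrm{Hom}}_{kG}(\Omega^nM,\Omega^nN)$, where $\underline{\mathrm{Hom}}$ denotes homomorphisms modulo those factoring through projectives. It is a compactly generated, closed tensor-triangulated category with products and coproducts; the tensor product is $\otimes_k$ with diagonal $G$-action, the unit is $k$, the suspension is $\Omega^{-1}$, and short exact sequences give exact triangles. An object $X$ is dualisable if the natural map $\mathrm{hom}(X,k)\otimes Y\to \mathrm{hom}(X,Y)$ is an isomorphism for all $Y$. $\mathscr{T}^d$ is the full subcategory of dualisable objects. $\mathrm{Spc}(\mathscr{T}^d)$ is its Balmer spectrum: the set of prime thick tensor ideals $P$ of $\mathscr{T}^d$, with basis of open sets $\{P: X\in P\}$, $X\in\mathscr{T}^d$. For $x\in \mathscr{T}^d$ put $\mathrm{supp}(x)=\{P: x\notin P\}$. Stratification. A subset $Y\subseteq\mathrm{Spc}(\mathscr{T}^d)$ is Thomason if it is a union of closed subsets with quasi-compact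 complement. A localising $\mathscr{T}^d$-submodule is a localising subcategory (triangulated subcategory closed under coproducts) of $\mathscr{T}$ closed under tensoring with all objects of $\mathscr{T}^d$. For $Y$ Thomason there is an exact triangle $e_Y\to\mathbbm{1}\to f_Y\to\Sigma e_Y$, where $\mathbbm{1}$ is the unit, $e_Y$ lies in the localising $\mathscr{T}^d$-submodule generated by $\{x\in\mathscr{T}^d:\mathrm{supp}(x)\subseteq Y\}$, and $f_Y$ lies in the right orthogonal of that submodule. The spectrum is weakly noetherian if for every point $P$ there are Thomason subsets $Y_1,Y_2$ with $\{P\}=Y_1\cap(\mathrm{Spc}(\mathscr{T}^d)\setminus Y_2)$; this holds here. Then set $g_P=e_{Y_1}\otimes f_{Y_2}$. The Balmer-Favi support of $t\in\mathscr{T}$ is $\mathrm{Supp}(t)=\{P: g_P\otimes t\ne 0\}$. $\mathscr{T}$ is stratified by $\mathrm{Spc}(\mathscr{T}^d)$ if $\mathcal{L}\mapsto\bigcup_{t\in\mathcal{L}}\mathrm{Supp}(t)$ is a bijection from the localising $\mathscr{T}^d$-submodules of $\mathscr{T}$ to the subsets of $\mathrm{Spc}(\mathscr{T}^d)$. *)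

(* Defs.v *)
From HB Require Import structures.
From mathcomp Require Import all_boot all_order all_algebra all_fingroup.
From mathcomp Require Import all_solvable generic_quotient.
From mathcomp Require Import all_classical.
Set Implicit Arguments.
Unset Strict Implicit.
Unset Printing Implicit Defensive.

Import GRing.Theory.
Local Open Scope classical_set_scope.
Local Open Scope ring_scope.

(* Stated by the universal property; a multiplicative map between groups
   preserves 1. *)
Definition is_free_product (G : groupType) (H : nat -> groupType)
    (iota : forall n, {multiplicative H n -> G}) : Prop :=
  forall (K : groupType) (f : forall n, {multiplicative H n -> K}),
    exists h : {multiplicative G -> K},
      (forall n x, h (iota n x) = f n x) /\
      (forall h' : {multiplicative G -> K},
          (forall n x, h' (iota n x) = f n x) -> h' =1 h).

Section Subspaces.
Variables (k : fieldType) (V : lmodType k).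

Record subspace := Subspace {
  sub_mem :> V -> Prop;
  sub_mem0 : sub_mem 0;
  sub_memP : forall (a : k) x y, sub_mem x -> sub_mem y -> sub_mem (a *: x + y) }.

Definition in_subspace (W : subspace) : pred V := fun x => `[< W x >].

Lemma in_subspace_closed (W : subspace) : submod_closed (in_subspace W).
Proof.
split; first by apply/asboolP; exact: sub_mem0.
by move=> a x y /asboolP Wx /asboolP Wy; apply/asboolP; exact: sub_memP.
Qed.

HB.instance Definition _ (W : subspace) :=
  GRing.isSubmodClosed.Build k V (in_subspace W) (in_subspace_closed W).

Definition subspace_type (W : subspace) : Type := {x : V | x \in in_subspace W}.
HB.instance Definition _ (W : subspace) := SubChoice.on (subspace_type W).
HB.instance Definition _ (W : subspace) :=
  [SubChoice_isSubLmodule of subspace_type W by <:].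

Definition to_subspace (W : subspace) (x : V) (Wx : W x) : subspace_type W :=
  exist _ x (introT (asboolP _) Wx).

Lemma subspace_valP (W : subspace) (x : subspace_type W) : W (val x).
Proof. by case: x => x /= /asboolP. Qed.

End Subspaces.

Section LinearFacts.
Variables (k : fieldType) (U V : lmodType k) (f : U -> V).
Hypothesis hf : linear f.

Lemma lin0 : f 0 = 0.
Proof. by have := hf (-1) 0 0; rewrite !scaleN1r !addNr. Qed.
Lemma linZ a x : f (a *: x) = a *: f x.
Proof. by have := hf a x 0; rewrite lin0 !addr0. Qed.
Lemma linD x y : f (x + y) = f x + f y.
Proof. by have := hf 1 x y; rewrite !scale1r. Qed.
Lemma lin_sum I (r : seq I) (P : pred I) F :
  f (\sum_(i <- r | P i) F i) = \sum_(i <- r | P i) f (F i).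
Proof. exact: (big_morph f linD lin0). Qed.

End LinearFacts.

Section Tensor.
Variables (k : fieldType) (M N : lmodType k).
Local Open Scope quotient_scope.

Definition bilinear_map (Q : lmodType k) (b : M -> N -> Q) : Prop :=
  (forall y, linear (b^~ y)) /\ (forall x, linear (b x)).

Definition tens_eval (Q : lmodType k) (b : M -> N -> Q) (s : seq (M * N)) : Q :=
  \sum_(xy <- s) b xy.1 xy.2.

(* M (x)_k N as formal sums of pairs (pure tensors), two of them being
   identified when no bilinear map out of M x N separates them. *)
Definition tens_rel (s t : seq (M * N)) : bool :=
  `[< forall (Q : lmodType k) (b : M -> N -> Q), bilinear_map b ->
        tens_eval b s = tens_eval b t >].

Lemma tens_rel_refl : reflexive tens_rel.
Proof. by move=> s; apply/asboolP. Qed.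
Lemma tens_rel_sym : symmetric tens_rel.
Proof. by move=> s t; apply/asboolP/asboolP => h Q b hb; rewrite h. Qed.
Lemma tens_rel_trans : transitive tens_rel.
Proof.
move=> t s u /asboolP h1 /asboolP h2; apply/asboolP => Q b hb.
by rewrite h1 ?h2.
Qed.

Canonical tens_equiv := EquivRel tens_rel tens_rel_refl tens_rel_sym tens_rel_trans.

Definition tens : Type := {eq_quot tens_equiv}.
HB.instance Definition _ := Choice.on tens.

Definition tens_class (s : seq (M * N)) : tens := \pi_({eq_quot tens_equiv}) s.
Definition tens_repr (t : tens) : seq (M * N) := repr (t : {eq_quot tens_equiv}).
Definition pure (x : M) (y : N) : tens := tens_class [:: (x, y)].

Lemma tens_reprK (t : tens) : tens_class (tens_repr t) = t.
Proof. exact: reprK. Qed.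

Lemma tens_classP s t :
  (forall (Q : lmodType k) (b : M -> N -> Q), bilinear_map b ->
     tens_eval b s = tens_eval b t) <-> tens_class s = tens_class t.
Proof.
split=> [h|h]; first by apply/eqquotP; apply/asboolP.
by move/eqquotP: h => /asboolP.
Qed.

Lemma tens_repr_eval (Q : lmodType k) (b : M -> N -> Q) s : bilinear_map b ->
  tens_eval b (tens_repr (tens_class s)) = tens_eval b s.
Proof. by move=> hb; have /tens_classP := tens_reprK (tens_class s); apply. Qed.

Definition tens_scale_seq (a : k) (s : seq (M * N)) : seq (M * N) :=
  [seq (a *: xy.1, xy.2) | xy <- s].

Definition tens_add (s t : tens) : tens := tens_class (tens_repr s ++ tens_repr t).
Definition tens_scale (a : k) (s : tens) : tens :=
  tens_class (tens_scale_seq a (tens_repr s)).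
Definition tens_opp (s : tens) : tens := tens_scale (-1) s.
Definition tens_zero : tens := tens_class [::].

Lemma tens_eval_cat (Q : lmodType k) (b : M -> N -> Q) s t :
  tens_eval b (s ++ t) = tens_eval b s + tens_eval b t.
Proof. by rewrite /tens_eval big_cat. Qed.

Lemma tens_eval_scale (Q : lmodType k) (b : M -> N -> Q) a s : bilinear_map b ->
  tens_eval b (tens_scale_seq a s) = a *: tens_eval b s.
Proof.
move=> [hl _]; rewrite /tens_eval big_map scaler_sumr; apply: eq_bigr => xy _ /=.
exact: (linZ (hl xy.2)).
Qed.

Lemma tens_eq (s t : tens) :
  (forall (Q : lmodType k) (b : M -> N -> Q), bilinear_map b ->
     tens_eval b (tens_repr s) = tens_eval b (tens_repr t)) -> s = t.
Proof.
by move=> h; rewrite -[s]tens_reprK -[t]tens_reprK; apply/tens_classP.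
Qed.

Lemma tens_add_eval (Q : lmodType k) (b : M -> N -> Q) s t : bilinear_map b ->
  tens_eval b (tens_repr (tens_add s t)) =
  tens_eval b (tens_repr s) + tens_eval b (tens_repr t).
Proof. by move=> hb; rewrite tens_repr_eval // tens_eval_cat. Qed.

Lemma tens_scale_eval (Q : lmodType k) (b : M -> N -> Q) a s : bilinear_map b ->
  tens_eval b (tens_repr (tens_scale a s)) = a *: tens_eval b (tens_repr s).
Proof. by move=> hb; rewrite tens_repr_eval // tens_eval_scale. Qed.

Lemma tens_zero_eval (Q : lmodType k) (b : M -> N -> Q) : bilinear_map b ->
  tens_eval b (tens_repr tens_zero) = 0.
Proof. by move=> hb; rewrite tens_repr_eval // /tens_eval big_nil. Qed.

Lemma tens_addA : associative tens_add.
Proof. by move=> s t u; apply: tens_eq => Q b hb; rewrite !tens_add_eval // addrA. Qed.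
Lemma tens_addC : commutative tens_add.
Proof. by move=> s t; apply: tens_eq => Q b hb; rewrite !tens_add_eval // addrC. Qed.
Lemma tens_add0 : left_id tens_zero tens_add.
Proof.
by move=> s; apply: tens_eq => Q b hb; rewrite tens_add_eval // tens_zero_eval // add0r.
Qed.
Lemma tens_addN : left_inverse tens_zero tens_opp tens_add.
Proof.
move=> s; apply: tens_eq => Q b hb.
by rewrite tens_add_eval // tens_zero_eval // tens_scale_eval // scaleN1r addNr.
Qed.

HB.instance Definition _ :=
  GRing.isZmodule.Build tens tens_addA tens_addC tens_add0 tens_addN.

Lemma tens_scaleA (a b : k) (t : tens) :
  tens_scale a (tens_scale b t) = tens_scale (a * b) t.
Proof. by apply: tens_eq => Q c hc; rewrite !tens_scale_eval // scalerA. Qed.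
Lemma tens_scale1 : left_id 1 tens_scale.
Proof. by move=> t; apply: tens_eq => Q c hc; rewrite tens_scale_eval // scale1r. Qed.
Lemma tens_scaleDr : right_distributive tens_scale +%R.
Proof.
move=> a s t; apply: tens_eq => Q c hc.
by rewrite !(tens_scale_eval, tens_add_eval) // scalerDr.
Qed.
Lemma tens_scaleDl (t : tens) : {morph tens_scale^~ t : a b / a + b}.
Proof.
move=> a b; apply: tens_eq => Q c hc.
by rewrite !(tens_scale_eval, tens_add_eval) // scalerDl.
Qed.

HB.instance Definition _ := GRing.Zmodule_isLmodule.Build k tens
  tens_scaleA tens_scale1 tens_scaleDr tens_scaleDl.

Definition tens_lift (Q : lmodType k) (b : M -> N -> Q) (t : tens) : Q :=
  tens_eval b (tens_repr t).

Lemma tens_lift_linear (Q : lmodType k) (b : M -> N -> Q) :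
  bilinear_map b -> linear (tens_lift b).
Proof. by move=> hb a s t; rewrite /tens_lift tens_add_eval // tens_scale_eval. Qed.

Lemma tens_lift_pure (Q : lmodType k) (b : M -> N -> Q) x y :
  bilinear_map b -> tens_lift b (pure x y) = b x y.
Proof. by move=> hb; rewrite /tens_lift tens_repr_eval // /tens_eval big_seq1. Qed.

Lemma pure_bilinear : bilinear_map pure.
Proof.
split=> [y|x] a u v; apply: tens_eq => Q b hb.
  rewrite tens_add_eval // tens_scale_eval // !tens_repr_eval //.
  by rewrite /tens_eval !big_seq1 hb.1.
rewrite tens_add_eval // tens_scale_eval // !tens_repr_eval //.
by rewrite /tens_eval !big_seq1 hb.2.
Qed.

Lemma tens_ext (Q : lmodType k) (f g : tens -> Q) : linear f -> linear g ->
  (forall x y, f (pure x y) = g (pure x y)) -> f =1 g.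
Proof.
move=> hf hg h t; rewrite -[t]tens_reprK; elim: (tens_repr t) => [|xy s IH].
  rewrite -[tens_class _]/(0 : tens).
  by rewrite !lin0.
have -> : tens_class (xy :: s) = 1 *: pure xy.1 xy.2 + tens_class s.
  apply: tens_eq => Q' b hb.
  rewrite tens_add_eval // tens_scale_eval // !tens_repr_eval // scale1r.
  by rewrite /tens_eval big_seq1 big_cons.
by rewrite hf hg h IH.
Qed.

End Tensor.

Section Representations.
Variables (k : fieldType) (G : groupType).
#[local] Obligation Tactic := idtac.

(* A kG-module, as a k-vector space with a k-linear left action of G. *)
Record gmod := Gmod {
  carrier :> lmodType k;
  act : G -> carrier -> carrier;
  act_linear : forall g, linear (act g);
  act_one : forall x, act 1%g x = x;
  act_mul : forall g h x, act (g * h)%g x = act g (act h x) }.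

Record ghom (M N : gmod) := Ghom {
  ghom_fun :> M -> N;
  ghom_linear : linear ghom_fun;
  ghom_act : forall g x, ghom_fun (act g x) = act g (ghom_fun x) }.

Program Definition ghom_id (M : gmod) : ghom M M := @Ghom M M id _ _.
Next Obligation. by []. Qed.
Next Obligation. by []. Qed.

Program Definition ghom_comp (M N L : gmod) (g : ghom N L) (f : ghom M N) :
  ghom M L := @Ghom M L (g \o f) _ _.
Next Obligation. by move=> M N L g f a x y /=; rewrite !ghom_linear. Qed.
Next Obligation. by move=> M N L g f h x /=; rewrite !ghom_act. Qed.

Program Definition ghom_zero (M N : gmod) : ghom M N := @Ghom M N (fun=> 0) _ _.
Next Obligation. by move=> M N a x y; rewrite scaler0 addr0. Qed.
Next Obligation. by move=> M N g x; rewrite (lin0 (act_linear _)). Qed.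

Definition surj (M N : gmod) (f : ghom M N) : Prop := forall y, exists x, f x = y.

Definition projective (P : gmod) : Prop :=
  forall (A B : gmod) (q : ghom A B) (f : ghom P B), surj q ->
    exists g : ghom P A, forall x, q (g x) = f x.

(* f and g have the same class modulo the maps that factor through a
   projective. *)
Definition stably_eq (M N : gmod) (f g : ghom M N) : Prop :=
  exists (P : gmod) (a : ghom M P) (b : ghom P N),
    projective P /\ forall x, f x - g x = b (a x).

Program Definition gunit : gmod := @Gmod k^o (fun _ x => x) _ _ _.
Next Obligation. by []. Qed.
Next Obligation. by []. Qed.
Next Obligation. by []. Qed.

Program Definition sub_gmod (M : gmod) (W : subspace M)
    (hW : forall g x, W x -> W (act g x)) : gmod :=
  @Gmod (subspace_type W)
    (fun g x => to_subspace (hW g _ (subspace_valP x))) _ _ _.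
Next Obligation. by move=> M W hW g a x y; apply: val_inj => /=; rewrite act_linear. Qed.
Next Obligation. by move=> M W hW x; apply: val_inj => /=; rewrite act_one. Qed.
Next Obligation. by move=> M W hW g h x; apply: val_inj => /=; rewrite act_mul. Qed.

Program Definition sub_map (M N : gmod) (W : subspace M) (W' : subspace N)
    (hW : forall g x, W x -> W (act g x)) (hW' : forall g x, W' x -> W' (act g x))
    (f : ghom M N) (hf : forall x, W x -> W' (f x)) :
    ghom (sub_gmod hW) (sub_gmod hW') :=
  @Ghom (sub_gmod hW) (sub_gmod hW')
    (fun x => to_subspace (hf _ (subspace_valP x))) _ _.
Next Obligation.
by move=> M N W W' hW hW' f hf a x y; apply: val_inj; rewrite /= ghom_linear.
Qed.
Next Obligation.
by move=> M N W W' hW hW' f hf g x; apply: val_inj; rewrite /= ghom_act.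
Qed.

Program Definition ker_subspace (M N : gmod) (f : ghom M N) : subspace M :=
  @Subspace k M (fun x => f x = 0) _ _.
Next Obligation. by move=> M N f; exact: (lin0 (ghom_linear f)). Qed.
Next Obligation. by move=> M N f a x y /= fx fy; rewrite ghom_linear fx fy scaler0 addr0. Qed.

Lemma ker_stable (M N : gmod) (f : ghom M N) g x :
  ker_subspace f x -> ker_subspace f (act g x).
Proof. by rewrite /= ghom_act => ->; rewrite (lin0 (act_linear _)). Qed.

Definition ker (M N : gmod) (f : ghom M N) : gmod := sub_gmod (@ker_stable M N f).

Program Definition ker_incl (M N : gmod) (f : ghom M N) : ghom (ker f) M :=
  @Ghom (ker f) M val _ _.
Next Obligation. by []. Qed.
Next Obligation. by []. Qed.

(* The free module kG (x)_k M, where G acts through kG only, as the finitely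
    supported functions phi : G -> M (phi stands for the sum of the g (x) phi g),
    with its counit g (x) m |-> g m. *)

Definition fin_supp (M : gmod) (phi : G -> M) : Prop :=
  finite_set [set g | phi g <> 0].

Lemma fin_supp_subspace_proof1 (M : gmod) : fin_supp (0 : G -> M).
Proof.
rewrite /fin_supp (_ : [set _ | _] = set0); first exact: finite_set0.
by apply/seteqP; split=> g //=.
Qed.

Lemma fin_supp_subspace_proof2 (M : gmod) (a : k) (phi psi : G -> M) :
  fin_supp phi -> fin_supp psi -> fin_supp (a *: phi + psi).
Proof.
move=> h1 h2; apply: (@sub_finite_set _ _ ([set g | phi g <> 0] `|` [set g | psi g <> 0])).
  move=> g /= h; apply: contrapT => /not_orP[/contrapT e1 /contrapT e2].
  by apply: h; rewrite -[LHS]/(a *: phi g + psi g) e1 e2 scaler0 addr0.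
by rewrite finite_setU.
Qed.

Definition fin_supp_subspace (M : gmod) : subspace (G -> M : lmodType k) :=
  @Subspace k (G -> M : lmodType k) (@fin_supp M)
    (fin_supp_subspace_proof1 M) (@fin_supp_subspace_proof2 M).

Lemma free_act_supp (M : gmod) (phi : G -> M) (g : G) :
  fin_supp phi -> fin_supp (fun h => phi (g^-1 * h)%g).
Proof.
move=> h; apply: (@sub_finite_set _ _ ((fun x => g * x)%g @` [set x | phi x <> 0])).
  by move=> x /= hx; exists (g^-1 * x)%g => //; rewrite mulVKg.
exact: finite_image.
Qed.

Program Definition free (M : gmod) : gmod :=
  @Gmod (subspace_type (fin_supp_subspace M))
    (fun g phi => @to_subspace _ _ (fin_supp_subspace M) _
                    (free_act_supp g (subspace_valP phi))) _ _ _.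
Next Obligation. by move=> M g a x y; apply: val_inj. Qed.
Next Obligation. by move=> M x; apply: val_inj; apply/funext => h /=; rewrite invg1 mul1g. Qed.
Next Obligation. by move=> M g h x; apply: val_inj; apply/funext => z /=; rewrite invgM mulgA. Qed.

Definition counit_fun (M : gmod) (phi : free M) : M :=
  \sum_(h \in [set: G]) act h (val phi h).

Lemma counit_funE (M : gmod) (phi : free M) (r : seq G) : uniq r ->
  (forall h, h \notin r -> val phi h = 0) ->
  counit_fun phi = \sum_(h <- r) act h (val phi h).
Proof.
move=> ur hr; rewrite /counit_fun (@bigfs _ _ _ _ r predT) //.
  by apply: eq_fsbigl; apply/seteqP; split.
by move=> h _ /hr ->; rewrite (lin0 (act_linear _)).
Qed.

Lemma fin_suppP (M : gmod) (phi : free M) :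
  exists r : seq G, forall h, h \notin r -> val phi h = 0.
Proof.
have /finite_seqP[r er] := subspace_valP phi.
exists r => h hr; apply: contrapT => hn; move: hr; apply/negP/negPn.
by have : [set` r] h by rewrite -er.
Qed.

Program Definition counit (M : gmod) : ghom (free M) M :=
  @Ghom (free M) M (@counit_fun M) _ _.
Next Obligation.
move=> M a x y; have [r1 h1] := fin_suppP x; have [r2 h2] := fin_suppP y.
have ur := undup_uniq (r1 ++ r2).
have hx h : h \notin undup (r1 ++ r2) -> val x h = 0.
  by rewrite mem_undup mem_cat negb_or => /andP[/h1].
have hy h : h \notin undup (r1 ++ r2) -> val y h = 0.
  by rewrite mem_undup mem_cat negb_or => /andP[_ /h2].
have hxy h : h \notin undup (r1 ++ r2) -> val (a *: x + y) h = 0.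
  by move=> hh; rewrite -[LHS]/(a *: val x h + val y h) hx // hy // scaler0 addr0.
rewrite (counit_funE ur hx) (counit_funE ur hy) (counit_funE ur hxy).
rewrite scaler_sumr -big_split /=; apply: eq_bigr => h _.
by rewrite act_linear.
Qed.
Next Obligation.
move=> M g x; have [r hr] := fin_suppP x.
have hr' h : h \notin undup r -> val x h = 0 by rewrite mem_undup => /hr.
rewrite (counit_funE (undup_uniq r) hr').
have u2 : uniq [seq (g * h)%g | h <- undup r].
  by rewrite map_inj_uniq ?undup_uniq //; exact: mulgI.
rewrite (@counit_funE M (act g x) _ u2).
  rewrite (lin_sum (act_linear g)) big_map; apply: eq_bigr => h _ /=.
  by rewrite mulKg act_mul.
move=> h hh /=; apply: hr'; apply: contra hh => hh.
by rewrite -[h](mulVKg g); apply: map_f.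
Qed.

Lemma free_map_supp (M N : gmod) (f : ghom M N) (phi : G -> M) :
  fin_supp phi -> fin_supp (f \o phi).
Proof.
apply: sub_finite_set => g /= h e; apply: h.
by rewrite e (lin0 (ghom_linear f)).
Qed.

Program Definition free_map (M N : gmod) (f : ghom M N) : ghom (free M) (free N) :=
  @Ghom (free M) (free N)
    (fun phi => @to_subspace _ _ (fin_supp_subspace N) _
                  (free_map_supp f (subspace_valP phi))) _ _.
Next Obligation. by move=> M N f a x y; apply: val_inj; apply/funext => h /=; rewrite ghom_linear. Qed.
Next Obligation. by move=> M N f g x; apply: val_inj. Qed.

Lemma counit_natural (M N : gmod) (f : ghom M N) x :
  counit N (free_map f x) = f (counit M x).
Proof.
have [r hr] := fin_suppP x.
have hr' h : h \notin undup r -> val x h = 0 by rewrite mem_undup => /hr.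
rewrite /= (counit_funE (undup_uniq r) hr').
rewrite (@counit_funE N (free_map f x) _ (undup_uniq r)).
  rewrite (lin_sum (ghom_linear f)); apply: eq_bigr => h _ /=.
  by rewrite ghom_act.
by move=> h /hr' /= ->; rewrite (lin0 (ghom_linear f)).
Qed.

Definition Omega (M : gmod) : gmod := ker (counit M).

Lemma Omega_map_proof (M N : gmod) (f : ghom M N) x :
  ker_subspace (counit M) x -> ker_subspace (counit N) (free_map f x).
Proof.
move=> e; apply: etrans (counit_natural f x) _.
by rewrite [counit M x]e (lin0 (ghom_linear f)).
Qed.

Definition Omega_map (M N : gmod) (f : ghom M N) : ghom (Omega M) (Omega N) :=
  sub_map (@ker_stable _ _ (counit M)) (@ker_stable _ _ (counit N))
    (@Omega_map_proof M N f).

Definition tens_act_bil (M N : gmod) (g : G) (x : M) (y : N) : tens M N :=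
  pure (act g x) (act g y).

Lemma tens_act_bilP (M N : gmod) g : bilinear_map (@tens_act_bil M N g).
Proof.
by split=> [y|x] a u v; rewrite /tens_act_bil act_linear;
   [apply: (pure_bilinear M N).1 | apply: (pure_bilinear M N).2].
Qed.

Definition tens_act (M N : gmod) (g : G) : tens M N -> tens M N :=
  tens_lift (@tens_act_bil M N g).

Lemma tens_act_linear (M N : gmod) g : linear (@tens_act M N g).
Proof. by apply: tens_lift_linear; exact: tens_act_bilP. Qed.

Lemma tens_act_pure (M N : gmod) g (x : M) (y : N) :
  tens_act g (pure x y) = pure (act g x) (act g y).
Proof. by rewrite /tens_act tens_lift_pure //; exact: tens_act_bilP. Qed.

Program Definition gtens (M N : gmod) : gmod :=
  @Gmod (tens M N) (@tens_act M N) (@tens_act_linear M N) _ _.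
Next Obligation.
move=> M N; apply: tens_ext => //; first exact: tens_act_linear.
by move=> x y; rewrite tens_act_pure !act_one.
Qed.
Next Obligation.
move=> M N g h; apply: tens_ext; first exact: tens_act_linear.
  by move=> a x y; rewrite !tens_act_linear.
by move=> x y; rewrite !tens_act_pure !act_mul.
Qed.

Program Definition lin_subspace (M N : gmod) : subspace (M -> N : lmodType k) :=
  @Subspace k (M -> N : lmodType k) (fun f => linear f) _ _.
Next Obligation. by move=> M N a x y; rewrite scaler0 addr0. Qed.
Next Obligation.
move=> M N a f g hf hg b x y.
rewrite -[LHS]/(a *: f (b *: x + y) + g (b *: x + y)).
rewrite -[RHS]/(b *: (a *: f x + g x) + (a *: f y + g y)).
by rewrite hf hg !scalerDr !scalerA [a * b]mulrC addrACA.
Qed.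

Lemma hom_act_proof (M N : gmod) (g : G) (f : M -> N) :
  linear f -> linear (fun x => act g (f (act g^-1%g x))).
Proof. by move=> hf a x y; rewrite act_linear hf act_linear. Qed.

(* Hom_k(M,N) with the conjugation action; as - (x)_k M and Hom_k(M,-) preserve
   the maps that are stable isomorphisms on finite subgroups, it is also the
   internal hom of the stable module category. *)
Program Definition ghomk (M N : gmod) : gmod :=
  @Gmod (subspace_type (lin_subspace M N))
    (fun g f => @to_subspace _ _ (lin_subspace M N) _
                  (hom_act_proof g (subspace_valP f))) _ _ _.
Next Obligation.
move=> M N g a f h; apply: val_inj; apply/funext => x.
set z := act g^-1%g x.
rewrite -[LHS]/(act g (a *: val f z + val h z)).
by rewrite act_linear.
Qed.
Next Obligation.
move=> M N f; apply: val_inj; apply/funext => x /=.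
by rewrite invg1 !act_one.
Qed.
Next Obligation.
move=> M N g h f; apply: val_inj; apply/funext => x /=.
by rewrite invgM !act_mul.
Qed.

Lemma ghomk_valE (M N : gmod) (a : k) (f h : ghomk M N) x :
  val (a *: f + h) x = a *: val f x + val h x.
Proof. by []. Qed.

Lemma dual_tens_proof (X Y : gmod) (phi : ghomk X gunit) (y : Y) :
  linear (fun x : X => (val phi x : k) *: y).
Proof.
move=> a u v; rewrite (subspace_valP phi a u v).
by rewrite scalerDl -scalerA.
Qed.

Definition dual_tens_bil (X Y : gmod) (phi : ghomk X gunit) (y : Y) : ghomk X Y :=
  @to_subspace _ _ (lin_subspace X Y) _ (dual_tens_proof phi y).

Lemma dual_tens_bilE (X Y : gmod) (phi : ghomk X gunit) (y : Y) x :
  val (dual_tens_bil phi y) x = (val phi x : k) *: y.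
Proof. by []. Qed.

Lemma dual_tens_bilP (X Y : gmod) : bilinear_map (@dual_tens_bil X Y).
Proof.
split=> [y|phi] a u v; apply: val_inj; apply/funext => x.
  by rewrite ghomk_valE !dual_tens_bilE ghomk_valE scalerDl -scalerA.
by rewrite ghomk_valE !dual_tens_bilE scalerDr !scalerA mulrC.
Qed.

(* The natural map hom(X,k) (x) Y -> hom(X,Y), sending phi (x) y to
   x |-> phi x *: y. *)
Program Definition dual_tens_map (X Y : gmod) :
    ghom (gtens (ghomk X gunit) Y) (ghomk X Y) :=
  @Ghom (gtens (ghomk X gunit) Y) (ghomk X Y) (tens_lift (@dual_tens_bil X Y)) _ _.
Next Obligation. move=> X Y; exact: tens_lift_linear (@dual_tens_bilP X Y). Qed.
Next Obligation.
move=> X Y g.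
apply: (@tens_ext _ _ _ _ (fun t => tens_lift (@dual_tens_bil X Y) (tens_act g t))
          (fun t => act g (tens_lift (@dual_tens_bil X Y) t))).
- move=> a s t; rewrite -(tens_lift_linear (@dual_tens_bilP X Y)).
  by congr tens_lift; exact: tens_act_linear.
- by move=> a s t; rewrite (tens_lift_linear (@dual_tens_bilP X Y)) act_linear.
move=> phi y; rewrite tens_act_pure.
rewrite !tens_lift_pure; try exact: dual_tens_bilP.
apply: val_inj; apply/funext => x.
have -> : val (act g (dual_tens_bil phi y)) x =
          act g (val (dual_tens_bil phi y) (act g^-1%g x)) by [].
by rewrite !dual_tens_bilE (linZ (act_linear g)).
Qed.

(* Omega^(n+1) M is Omega^n (Omega M), so that shift below needs no cast. *)
Fixpoint OmegaN (n : nat) (M : gmod) : gmod :=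
  if n is n'.+1 then OmegaN n' (Omega M) else M.

Fixpoint shift (n : nat) : forall M N : gmod,
    ghom (OmegaN n M) (OmegaN n N) -> ghom (OmegaN n.+1 M) (OmegaN n.+1 N) :=
  if n is n'.+1 then fun M N f => @shift n' (Omega M) (Omega N) f
  else fun M N f => Omega_map f.

Fixpoint shiftN (a n : nat) (M N : gmod) (f : ghom (OmegaN n M) (OmegaN n N)) :
    ghom (OmegaN (a + n) M) (OmegaN (a + n) N) :=
  if a is a'.+1 then shift (shiftN a' f) else f.

Definition cast_level (m n : nat) (e : m = n) (M N : gmod)
    (f : ghom (OmegaN m M) (OmegaN m N)) : ghom (OmegaN n M) (OmegaN n N) :=
  eq_rect m (fun i => ghom (OmegaN i M) (OmegaN i N)) f n e.

(* A morphism M -> N is represented by some Omega^n M -> Omega^n N; teq is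
   equality in the colimit over n of the Hom sets modulo projectives. *)
Definition thom (M N : gmod) : Type := {n : nat & ghom (OmegaN n M) (OmegaN n N)}.

Definition teq (M N : gmod) (f g : thom M N) : Prop :=
  exists (a b : nat) (e : (a + projT1 f = b + projT1 g)%N),
    stably_eq (cast_level e (shiftN a (projT2 f))) (shiftN b (projT2 g)).

Definition thom_of (M N : gmod) (f : ghom M N) : thom M N := existT _ 0%N f.

Definition tid (M : gmod) : thom M M := thom_of (ghom_id M).
Definition tzero (M N : gmod) : thom M N := thom_of (ghom_zero M N).

Definition tcomp (M N L : gmod) (g : thom N L) (f : thom M N) : thom M L :=
  let n := projT1 f in let m := projT1 g in
  existT _ (m + n)%N
    (ghom_comp (cast_level (addnC n m) (shiftN n (projT2 g)))
               (shiftN m (projT2 f))).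

(* Omega^n (Omega M) is definitionally OmegaN n.+1 M. *)
Definition tOmega (M N : gmod) (f : thom M N) : thom (Omega M) (Omega N) :=
  existT (fun n => ghom (OmegaN n (Omega M)) (OmegaN n (Omega N)))
    (projT1 f) (shift (projT2 f)).

Definition tiso (M N : gmod) (f : thom M N) : Prop :=
  exists g : thom N M, teq (tcomp g f) (tid M) /\ teq (tcomp f g) (tid N).

Definition isomorphic (M N : gmod) : Prop := exists f : thom M N, tiso f.

Definition is_zero (M : gmod) : Prop := teq (tid M) (tzero M M).

Definition is_coproduct (I : Type) (X : I -> gmod) (C : gmod)
    (j : forall i, thom (X i) C) : Prop :=
  forall (N : gmod) (f : forall i, thom (X i) N),
    exists h : thom C N,
      (forall i, teq (tcomp h (j i)) (f i)) /\
      (forall h' : thom C N, (forall i, teq (tcomp h' (j i)) (f i)) -> teq h' h).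

Definition short_exact (A B C : gmod) (i : ghom A B) (p : ghom B C) : Prop :=
  [/\ injective i, surj p & forall b, p b = 0 <-> exists a, i a = b].

(* d is the map on kernels induced by a map of extensions from
   Omega C -> free C -> C to A -> B -> C over the identity of C. *)
Definition connecting (A B C : gmod) (i : ghom A B) (p : ghom B C)
    (d : ghom (Omega C) A) : Prop :=
  exists l : ghom (free C) B,
    (forall x, p (l x) = counit C x) /\
    (forall y : Omega C, i (d y) = l (ker_incl (counit C) y)).

(* As the suspension is Omega^-1, a triangle X -> Y -> Z -> Omega^-1 X is given
   by u, v and w : Omega Z -> X.  The exact triangles are those isomorphic to
   the triangle of a short exact sequence; the sign convention for w does not
   affect the closure conditions below. *)
Definition exact_triangle (X Y Z : gmod)
    (u : thom X Y) (v : thom Y Z) (w : thom (Omega Z) X) : Prop :=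
  exists (A B C : gmod) (i : ghom A B) (p : ghom B C) (d : ghom (Omega C) A)
         (a : thom X A) (b : thom Y B) (c : thom Z C),
    [/\ short_exact i p, connecting i p d, tiso a, tiso b & tiso c] /\
    [/\ teq (tcomp b u) (tcomp (thom_of i) a),
        teq (tcomp c v) (tcomp (thom_of p) b) &
        teq (tcomp a w) (tcomp (thom_of d) (tOmega c))].

Definition in_triangle (X Y Z : gmod) : Prop :=
  exists (u : thom X Y) (v : thom Y Z) (w : thom (Omega Z) X),
    exact_triangle u v w.

(* Classes of kG-modules and sets of points are written as
    predicates: gmod is too large for the universe of classical_sets.set. *)

Definition triangulated_sub (L : gmod -> Prop) : Prop :=
  [/\ forall X, is_zero X -> L X,
      forall X Y, isomorphic X Y -> L X -> L Y,
      (* L is stable under the suspension and its inverse *)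
      forall X, L (Omega X) <-> L X &
      forall X Y Z, in_triangle X Y Z ->
        [/\ L X -> L Y -> L Z, L Y -> L Z -> L X & L X -> L Z -> L Y]].

Definition closed_coproducts (L : gmod -> Prop) : Prop :=
  forall (I : Type) (X : I -> gmod) (C : gmod) (j : forall i, thom (X i) C),
    is_coproduct j -> (forall i, L (X i)) -> L C.

(* In a triangulated category the direct summands are the retracts. *)
Definition closed_summands (L : gmod -> Prop) : Prop :=
  forall (X Y : gmod) (i : thom X Y) (r : thom Y X),
    teq (tcomp r i) (tid X) -> L Y -> L X.

Definition dualisable (X : gmod) : Prop :=
  forall Y, tiso (thom_of (dual_tens_map X Y)).

Definition thick_ideal (P : gmod -> Prop) : Prop :=
  [/\ forall X, P X -> dualisable X, triangulated_sub P, closed_summands P &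
      forall X Y, P X -> dualisable Y -> P (gtens X Y)].

Definition prime_ideal (P : gmod -> Prop) : Prop :=
  [/\ thick_ideal P, exists2 X, dualisable X & ~ P X &
      forall X Y, dualisable X -> dualisable Y -> P (gtens X Y) -> P X \/ P Y].

Definition localising_submodule (L : gmod -> Prop) : Prop :=
  [/\ triangulated_sub L, closed_coproducts L &
      forall X Y, dualisable X -> L Y -> L (gtens X Y)].

Definition Spc : Type := {P : gmod -> Prop | prime_ideal P}.

Definition supp (x : gmod) (P : Spc) : Prop := ~ sval P x.

(* The sets {P | x \in P}, x dualisable, form a basis of open sets. *)
Definition spc_open (U : Spc -> Prop) : Prop :=
  forall P, U P -> exists x,
    [/\ dualisable x, sval P x & forall Q : Spc, sval Q x -> U Q].

Definition spc_closed (Z : Spc -> Prop) : Prop := spc_open (fun P => ~ Z P).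

Definition quasi_compact (U : Spc -> Prop) : Prop :=
  forall F : (Spc -> Prop) -> Prop, (forall V, F V -> spc_open V) ->
    (forall P, U P -> exists2 V, F V & V P) ->
    exists (n : nat) (V : 'I_n -> Spc -> Prop),
      (forall i, F (V i)) /\ (forall P, U P -> exists i, V i P).

Definition thomason (Y : Spc -> Prop) : Prop :=
  exists F : (Spc -> Prop) -> Prop,
    (forall Z, F Z -> spc_closed Z /\ quasi_compact (fun P => ~ Z P)) /\
    (forall P, Y P <-> exists2 Z, F Z & Z P).

Definition generated (S : gmod -> Prop) (t : gmod) : Prop :=
  forall L, localising_submodule L -> (forall x, S x -> L x) -> L t.

Definition right_orthogonal (L : gmod -> Prop) (t : gmod) : Prop :=
  forall x, L x -> forall h : thom x t, teq h (tzero x t).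

Definition supported_on (Y : Spc -> Prop) : gmod -> Prop :=
  generated (fun x => dualisable x /\ forall P, supp x P -> Y P).

(* e and f are models of e_Y and f_Y. *)
Definition is_eYfY (Y : Spc -> Prop) (e f : gmod) : Prop :=
  [/\ supported_on Y e, right_orthogonal (supported_on Y) f &
      in_triangle e gunit f].

(* g is a model of g_P; up to isomorphism it depends on P only. *)
Definition is_gP (P : Spc) (g : gmod) : Prop :=
  exists (Y1 Y2 : Spc -> Prop) (e1 f1 e2 f2 : gmod),
    [/\ thomason Y1, thomason Y2 & forall Q, Q = P <-> Y1 Q /\ ~ Y2 Q] /\
    [/\ is_eYfY Y1 e1 f1, is_eYfY Y2 e2 f2 & g = gtens e1 f2].

Definition Supp (t : gmod) (P : Spc) : Prop :=
  exists2 g, is_gP P g & ~ is_zero (gtens g t).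

Definition Supp_of (L : gmod -> Prop) (P : Spc) : Prop :=
  exists2 t, L t & Supp t P.

(* L |-> Supp_of L is a bijection from the localising submodules to the subsets
   of Spc. *)
Definition stratified : Prop :=
  (forall L L' : gmod -> Prop,
      localising_submodule L -> localising_submodule L' ->
      (forall P, Supp_of L P <-> Supp_of L' P) -> forall X, L X <-> L' X) /\
  (forall Y : Spc -> Prop, exists2 L : gmod -> Prop, localising_submodule L &
      forall P, Supp_of L P <-> Y P).

End Representations.

(* Main.v *)
From HB Require Import structures.
From mathcomp Require Import all_boot all_order all_algebra all_fingroup.
From mathcomp Require Import all_solvable.
From mathcomp Require Import all_classical.
Require Import Defs.
Set Implicit Arguments.
Unset Strict Implicit.
Unset Printing Implicit Defensive.

Import GRing.Theory.
Local Open Scope ring_scope.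

(** Identify H_n with its image in G, a module meaning a kG-module.  A linear
    map between modules is called null over H_n when it is of the form
    sum_h h psi h^-1, h in H_n; by Higman's criterion the null maps are the
    H_n-equivariant maps that factor through a projective kH_n-module.

    The stable category of kG is the product of the stable categories of the
    kH_n: a morphism X -> Y amounts to one H_n-equivariant map X -> Y modulo
    null maps for each n, and any family occurs ([teq_rep], [rep_teq],
    [rep_patch]).  This rests on the universal property of G.  An action of G on
    a vector space is a family of unrelated actions of the H_n
    ([glue_actions]), and a linear map that commutes with each H_n commutes with
    G ([equivariant_gen]).  Hence extensions of modules can be built with an
    independently prescribed splitting over each H_n ([twisted_extension]).

    Therefore X is zero in the stable category if and only if it is projective
    over every H_n ([is_zeroP]), and dualisable if and only if over every H_n
    its identity is of finite rank modulo null maps ([dualisableP]).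

    An ultrafilter U on the natural numbers gives a prime P_U, namely the
    dualisable X such that X is projective over H_n for U-almost all n
    ([ultra_prime_ideal]).  Primality comes from a fact about cyclic groups of
    order p: if X is not projective over H_n, then it has an equivariant
    endomorphism of finite rank and nonzero trace ([nonzero_trace]), so every Y
    is a retract over H_n of X (x) Y (x) X^* ([nonprojective_retract]).  Write
    P_n for the prime of the principal ultrafilter at n.

    Let U be nonprincipal.  Then P_U lies in the Balmer-Favi support of no
    object, so that no localising submodule has support {P_U}.  Indeed suppose
    that {P_U} = Y1 \ Y2 with Y1 and Y2 Thomason, and let e and f be the two
    factors of g = e_(Y1) (x) f_(Y2).  Since P_n differs from P_U, either P_n is
    not in Y1 or P_n is in Y2.  In the first case the generators of the
    submodule containing e are projective over H_n, hence so is e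
    ([locproj_localising]).  In the second case consider the object D that is k
    over H_n and zero over the other factors ([idempotent_module]).  Its support
    is {P_n} ([idempotent_support]), so there are no nonzero morphisms D -> f;
    this says that the Tate cohomology group of degree 0 of H_n with
    coefficients in f vanishes, and f is projective over H_n
    ([orthogonal_locproj]).  So g is projective over each H_n, and g = 0. *)

(** * Extending linear maps *)

Section LinearExtension.
Variables (k : fieldType) (U V : lmodType k).
Implicit Type R : U -> V -> Prop.

Definition linrel R : Prop :=
  R 0 0 /\ forall (a : k) x y x' y', R x y -> R x' y' -> R (a *: x + x') (a *: y + y').

Definition functional R : Prop := forall y, R 0 y -> y = 0.

(** By Zorn's lemma: if a maximal functional linear relation between D and R missed a
    vector x, it could be enlarged by some (x, y0) of R.  The case D = 0 gives sections
    of surjections, and the case where R is everything extends partial linear maps. *)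
Lemma linrel_extension R D :
  linrel R -> (forall x, exists y, R x y) ->
  linrel D -> functional D -> (forall x y, D x y -> R x y) ->
  exists2 f : U -> V, linear f & (forall x, R x (f x)) /\ (forall x y, D x y -> f x = y).
Proof.
move=> linR totR linD funD subD.
(* D is adjoined so that the union of the empty chain is a candidate too *)
pose rel_of (A : set (U * V)) x y := A (x, y) \/ D x y.
pose good (A : set (U * V)) :=
  [/\ linrel (rel_of A), functional (rel_of A) & forall x y, rel_of A x y -> R x y].
have [|A [[linA funA subA] maxA]] := @Zorn_bigcup _ good.
  move=> F subF totF.
  have rel_bigcup x y : rel_of (\bigcup_(X in F) X)%classic x y ->
      D x y \/ exists2 A, F A & rel_of A x y.
    by case=> [[A FA Axy]|]; [right; exists A => //; left | left].
  have bigcup_rel A x y : F A -> rel_of A x y -> rel_of (\bigcup_(X in F) X)%classic x y.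
    by move=> FA [Axy|]; [left; exists A | right].
  split.
  - split; first by right; exact: linD.1.
    move=> a x y x' y' /rel_bigcup[Dxy|[A FA Axy]] /rel_bigcup[Dxy'|[A' FA' Axy']].
    + by right; apply: linD.2.
    + apply: (bigcup_rel A') => //; have [h _ _] := subF _ FA'.
      by apply: h.2 => //; right.
    + apply: (bigcup_rel A) => //; have [h _ _] := subF _ FA.
      by apply: h.2 => //; right.
    + have [sAA'|sA'A] := totF _ _ FA FA'.
        apply: (bigcup_rel A') => //; have [h _ _] := subF _ FA'; apply: h.2 => //.
        by case: Axy => [/sAA'|]; [left | right].
      apply: (bigcup_rel A) => //; have [h _ _] := subF _ FA; apply: h.2 => //.
      by case: Axy' => [/sA'A|]; [left | right].
  - by move=> y /rel_bigcup[/funD//|[A FA]]; have [_ h _] := subF _ FA; exact: h.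
  - by move=> x y /rel_bigcup[/subD//|[A FA]]; have [_ _ h] := subF _ FA; exact: h.
have uniqA x y y' : rel_of A x y -> rel_of A x y' -> y = y'.
  move=> h h'; apply/eqP; rewrite -subr_eq0; apply/eqP; apply: funA.
  by have := linA.2 (-1) _ _ _ _ h' h; rewrite !scaleN1r addNr addrC.
have totA x : exists y, rel_of A x y.
  apply: contrapT => nx; have [y0 Rxy0] := totR x.
  (* A enlarged by the line through (x, y0) *)
  pose A' : set (U * V) := fun uv => exists a u v,
    rel_of A u v /\ uv = (a *: x + u, a *: y0 + v).
  have relA' u v : rel_of A' u v -> A' (u, v).
    case=> // Duv; exists 0, u, v; split; first by right.
    by rewrite !scale0r !add0r.
  have gA' : good A'.
    split.
    - split; first by right; exact: linD.1.
      move=> a u v u' v' /relA'[b [w [z [wz [-> ->]]]]] /relA'[b' [w' [z' [wz' [-> ->]]]]].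
      left; exists (a * b + b'), (a *: w + w'), (a *: z + z'); split; first exact: linA.2.
      by rewrite !scalerDl !scalerDr !scalerA; congr pair; rewrite addrACA.
    - move=> v /relA'[a [u [w [uw [e ->]]]]].
      have [a0|a0] := eqVneq a 0.
        move: e; rewrite a0 !scale0r !add0r => e; apply: funA; by rewrite e.
      case: nx; exists (- (a^-1 *: w)).
      have -> : x = (- a^-1) *: u + 0.
        rewrite addr0 scaleNr -scalerN.
        have -> : - u = a *: x by apply/eqP; rewrite eq_sym -addr_eq0 -e.
        by rewrite scalerA mulVf // scale1r.
      rewrite -scaleNr -[X in rel_of A _ X]addr0.
      by apply: linA.2 => //; exact: linA.1.
    - move=> u v /relA'[a [w [z [wz [-> ->]]]]].
      by apply: linR.2 => //; exact: subA.
  have sAA' : (A `<=` A')%classic.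
    move=> [u v] Auv; exists 0, u, v; split; first by left.
    by rewrite !scale0r !add0r.
  case: nx; exists y0.
  have : A' (x, y0).
    exists 1, 0, 0; split; first exact: linA.1.
    by rewrite !scale1r !addr0.
  move=> h; left; apply: contrapT => nA; apply: (maxA A') => //.
  by split=> // /(_ _ h).
have [f fP] := choice totA.
exists f.
  move=> a x y; apply: (uniqA (a *: x + y)) => //.
  by apply: linA.2.
split=> [x|x y Dxy]; first exact: subA.
by apply: (uniqA x) => //; right.
Qed.

End LinearExtension.

Lemma linear_section (k : fieldType) (U V : lmodType k) (q : V -> U) :
  linear q -> (forall u, exists v, q v = u) ->
  exists2 s : U -> V, linear s & cancel s q.
Proof.
move=> lq sq.
have [|||||f lf [fP _]] := @linrel_extension k U V (fun u v => q v = u)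
  (fun u v => u = 0 /\ v = 0).
- by split=> [|a x y x' y' <- <-]; [exact: lin0 | exact: lq].
- exact: sq.
- split=> // a x y x' y' [-> ->] [-> ->]; by rewrite !scaler0 !addr0.
- by move=> y [].
- by move=> x y [-> ->]; exact: lin0.
by exists f.
Qed.

Lemma dual_vector (k : fieldType) (U : lmodType k) (u : U) : u != 0 ->
  exists2 f : U -> k^o, linear f & f u = 1.
Proof.
move=> u0.
have [|||||f lf [_ fP]] := @linrel_extension k U k^o (fun _ _ => True)
  (fun x c => x = (c : k) *: u) => //.
- by move=> x; exists 0.
- split=> [|a x c x' c' -> ->]; first by rewrite scale0r.
  by rewrite scalerDl -scalerA.
- move=> c /esym/eqP; rewrite scaler_eq0 (negbTE u0) orbF; exact: eqP.
by exists f => //; apply: fP; rewrite scale1r.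
Qed.

(** * Linear maps between modules *)

Section HomAlgebra.
Variables (k : fieldType) (G : groupType).
Implicit Types (X Y Z W : gmod k G).

HB.instance Definition _ X g :=
  GRing.isLinear.Build k X X *:%R (act g) (act_linear g).
HB.instance Definition _ X Y (f : ghom X Y) :=
  GRing.isLinear.Build k X Y *:%R f (ghom_linear f).

(** Linear maps are handled as elements of the module Hom(X, Y), where equivariance is
    invariance and traces are norms. *)
Definition ap X Y (f : ghomk X Y) : X -> Y := val (f : subspace_type (lin_subspace X Y)).

Lemma ap_linear X Y (f : ghomk X Y) : linear (ap f).
Proof. exact: (@subspace_valP k (X -> Y) (lin_subspace X Y) f). Qed.

HB.instance Definition _ X Y (f : ghomk X Y) :=
  GRing.isLinear.Build k X Y *:%R (ap f) (ap_linear f).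

Definition mkhom X Y (f : X -> Y) (lf : linear f) : ghomk X Y :=
  @to_subspace _ _ (lin_subspace X Y) f lf.

Lemma ap_mk X Y (f : X -> Y) (lf : linear f) x : ap (mkhom lf) x = f x.
Proof. by []. Qed.

Lemma hom_ext X Y (f g : ghomk X Y) : ap f =1 ap g -> f = g.
Proof. by move=> e; apply: val_inj; apply/funext. Qed.

Lemma ap_add X Y (f g : ghomk X Y) x : ap (f + g) x = ap f x + ap g x.
Proof. by []. Qed.
Lemma ap_opp X Y (f : ghomk X Y) x : ap (- f) x = - ap f x.
Proof. by []. Qed.
Lemma ap_sub X Y (f g : ghomk X Y) x : ap (f - g) x = ap f x - ap g x.
Proof. by []. Qed.
Lemma ap_scale X Y a (f : ghomk X Y) x : ap (a *: f) x = a *: ap f x.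
Proof. by []. Qed.
Lemma ap_zero X Y x : ap (0 : ghomk X Y) x = 0.
Proof. by []. Qed.
Lemma ap_sum X Y I (r : seq I) (P : pred I) (F : I -> ghomk X Y) x :
  ap (\sum_(i <- r | P i) F i) x = \sum_(i <- r | P i) ap (F i) x.
Proof. by elim/big_rec2: _ => // i y z _ <-. Qed.
Definition apE := (ap_mk, ap_add, ap_opp, ap_scale, ap_zero, ap_sum).

Lemma ap_act X Y g (f : ghomk X Y) x : ap (act g f) x = act g (ap f (act g^-1%g x)).
Proof. by []. Qed.

Lemma gactVK X g : cancel (act g : X -> X) (act g^-1%g).
Proof. by move=> x; rewrite -act_mul mulVg act_one. Qed.
Lemma gactKV X g : cancel (act g^-1%g : X -> X) (act g).
Proof. by move=> x; rewrite -act_mul mulgV act_one. Qed.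

Lemma gactB X g (x y : X) : act g (x - y) = act g x - act g y.
Proof. exact: linearB. Qed.

Definition idh X : ghomk X X := @mkhom X X id (fun _ _ _ => erefl).

Fact hcomp_linear X Y Z (f : ghomk Y Z) (g : ghomk X Y) : linear (fun x => ap f (ap g x)).
Proof. by move=> a x y; rewrite !linearP. Qed.
Definition hcomp X Y Z (f : ghomk Y Z) (g : ghomk X Y) : ghomk X Z :=
  mkhom (hcomp_linear f g).
Local Infix "**" := hcomp (at level 35, right associativity).

Lemma ap_comp X Y Z (f : ghomk Y Z) (g : ghomk X Y) x : ap (f ** g) x = ap f (ap g x).
Proof. by []. Qed.
Lemma ap_id X x : ap (idh X) x = x.
Proof. by []. Qed.

Lemma hcompA X Y Z W (f : ghomk Z W) (g : ghomk Y Z) (h : ghomk X Y) :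
  f ** g ** h = (f ** g) ** h.
Proof. exact: hom_ext. Qed.
Lemma hcomp1l X Y (f : ghomk X Y) : idh Y ** f = f.
Proof. exact: hom_ext. Qed.
Lemma hcomp1r X Y (f : ghomk X Y) : f ** idh X = f.
Proof. exact: hom_ext. Qed.
Lemma hcompDl X Y Z (f f' : ghomk Y Z) (g : ghomk X Y) : (f + f') ** g = f ** g + f' ** g.
Proof. exact: hom_ext. Qed.
Lemma hcompNl X Y Z (f : ghomk Y Z) (g : ghomk X Y) : (- f) ** g = - (f ** g).
Proof. exact: hom_ext. Qed.
Lemma hcompZl X Y Z a (f : ghomk Y Z) (g : ghomk X Y) : (a *: f) ** g = a *: (f ** g).
Proof. exact: hom_ext. Qed.
Lemma hcomp0l X Y Z (g : ghomk X Y) : (0 : ghomk Y Z) ** g = 0.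
Proof. exact: hom_ext. Qed.
Lemma hcompDr X Y Z (f : ghomk Y Z) (g g' : ghomk X Y) : f ** (g + g') = f ** g + f ** g'.
Proof. by apply: hom_ext => x; rewrite !ap_comp !ap_add linearD. Qed.
Lemma hcompNr X Y Z (f : ghomk Y Z) (g : ghomk X Y) : f ** (- g) = - (f ** g).
Proof. by apply: hom_ext => x; rewrite ap_comp !ap_opp linearN. Qed.
Lemma hcompZr X Y Z a (f : ghomk Y Z) (g : ghomk X Y) : f ** (a *: g) = a *: (f ** g).
Proof. by apply: hom_ext => x; rewrite ap_comp !ap_scale linearZ. Qed.
Lemma hcomp0r X Y Z (f : ghomk Y Z) : f ** (0 : ghomk X Y) = 0.
Proof. by apply: hom_ext => x; rewrite ap_comp !ap_zero linear0. Qed.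
Definition hcompE :=
  (hcompDl, hcompDr, hcompNl, hcompNr, hcomp0l, hcomp0r, hcomp1l, hcomp1r).

Lemma hcomp_act X Y Z g (f : ghomk Y Z) (h : ghomk X Y) :
  act g (f ** h) = act g f ** act g h.
Proof. by apply: hom_ext => x; rewrite !(ap_act, ap_comp) gactVK. Qed.
Lemma idh_act X g : act g (idh X) = idh X.
Proof. by apply: hom_ext => x; rewrite ap_act !ap_id gactKV. Qed.

Lemma hcomp_bilinear X Y Z : bilinear_map (@hcomp X Y Z).
Proof.
by split=> [g|f] a u v; rewrite ?hcompDl ?hcompDr ?hcompZl ?hcompZr.
Qed.

Definition hom_of X Y (f : ghom X Y) : ghomk X Y := mkhom (ghom_linear f).
Lemma ap_hom_of X Y (f : ghom X Y) x : ap (hom_of f) x = f x.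
Proof. by []. Qed.
Lemma hom_of_act X Y (f : ghom X Y) g : act g (hom_of f) = hom_of f.
Proof. by apply: hom_ext => x; rewrite ap_act !ap_hom_of ghom_act gactKV. Qed.

Definition ghom_mk X Y (f : ghomk X Y) (ef : forall g, act g f = f) : ghom X Y.
Proof.
exists (ap f); first exact: ap_linear.
by move=> g x; rewrite -{1}(ef g) ap_act gactVK.
Defined.
Lemma ghom_mkE X Y (f : ghomk X Y) (ef : forall g, act g f = f) x : ghom_mk ef x = ap f x.
Proof. by []. Qed.

Lemma hom_of_mk X Y (f : ghomk X Y) (ef : forall g, act g f = f) : hom_of (ghom_mk ef) = f.
Proof. exact: hom_ext. Qed.

(** The section s and the retraction r are only linear over k. *)
Definition split_ses X Y Z (i : ghomk X Y) (p : ghomk Y Z) (s : ghomk Z Y) (r : ghomk Y X) :=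
  [/\ r ** i = idh X, p ** s = idh Z, p ** i = 0, r ** s = 0 & i ** r + s ** p = idh Y].

Lemma short_exact_split X Y Z (i : ghom X Y) (p : ghom Y Z) : short_exact i p ->
  exists s r, split_ses (hom_of i) (hom_of p) s r.
Proof.
move=> [inj_i sur_p ex].
have [s ls sK] := linear_section (ghom_linear p) sur_p.
have hr y : exists x, i x = y - s (p y).
  by apply/ex; rewrite linearB /= sK subrr.
have [r rP] := choice hr.
have lr : linear r.
  move=> a y y'; apply: inj_i; rewrite [LHS]rP (ghom_linear i) !rP (ghom_linear p) ls.
  by rewrite scalerBr opprD addrACA.
have pi x : p (i x) = 0 by apply/ex; exists x.
exists (mkhom ls), (mkhom lr); split; apply: hom_ext => x; rewrite !(ap_comp, apE).
- by apply: inj_i; rewrite rP pi (lin0 ls) subr0.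
- exact: sK.
- exact: pi.
- by apply: inj_i; rewrite rP sK subrr linear0.
- by rewrite rP subrK.
Qed.

End HomAlgebra.

Infix "**" := hcomp (at level 35, right associativity).

(** * Trace maps over a finite subgroup *)

Section OperatorIdeals.
Variables (k : fieldType) (G : groupType).

(** The two instances of use are the zero maps and the maps of finite rank; they allow
    projectivity and finiteness up to projectives to be treated together. *)
Record op_ideal := OpIdeal {
  op_mem : forall X Y : gmod k G, ghomk X Y -> Prop;
  op_mem0 : forall X Y, op_mem (0 : ghomk X Y);
  op_memD : forall X Y (f g : ghomk X Y), op_mem f -> op_mem g -> op_mem (f + g);
  op_meml : forall X Y Z (f : ghomk X Y) (g : ghomk Y Z), op_mem f -> op_mem (g ** f);
  op_memr : forall X Y Z (f : ghomk X Y) (g : ghomk Z X), op_mem f -> op_mem (f ** g) }.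

Variable JJ : op_ideal.
Local Notation J := (op_mem JJ).

(** Translation by g is composition with linear maps on both sides. *)
Lemma op_mem_act (X Y : gmod k G) g (f : ghomk X Y) : J f -> J (act g f).
Proof.
move=> Jf.
have -> : act g f = mkhom (@act_linear _ _ Y g) ** f ** mkhom (@act_linear _ _ X g^-1%g).
  exact: hom_ext.
exact/op_meml/op_memr.
Qed.

#[local] Obligation Tactic := idtac.
Program Definition zero_ideal : op_ideal := @OpIdeal (fun X Y f => f = 0) _ _ _ _.
Next Obligation. by []. Qed.
Next Obligation. by move=> X Y f g -> ->; rewrite addr0. Qed.
Next Obligation. by move=> X Y Z f g ->; rewrite hcomp0r. Qed.
Next Obligation. by move=> X Y Z f g ->; rewrite hcomp0l. Qed.

Definition rank1s (X Y : gmod k G) (s : seq (ghomk X (gunit k G) * Y)) : ghomk X Y :=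
  tens_eval (@dual_tens_bil k G X Y) s.

Lemma ap_rank1s (X Y : gmod k G) (s : seq (ghomk X (gunit k G) * Y)) x :
  ap (rank1s s) x = \sum_(ly <- s) (ap ly.1 x : k) *: ly.2.
Proof. by rewrite /rank1s /tens_eval ap_sum. Qed.

Definition has_finite_rank (X Y : gmod k G) (f : ghomk X Y) : Prop := exists s, f = rank1s s.

Program Definition finite_rank : op_ideal := @OpIdeal has_finite_rank _ _ _ _.
Next Obligation. by move=> X Y; exists [::]; rewrite /rank1s /tens_eval big_nil. Qed.
Next Obligation.
move=> X Y _ _ [s ->] [s' ->]; exists (s ++ s').
by rewrite /rank1s tens_eval_cat.
Qed.
Next Obligation.
move=> X Y Z _ g [s ->]; exists [seq (ly.1, ap g ly.2) | ly <- s].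
apply: hom_ext => x; rewrite ap_comp !ap_rank1s linear_sum big_map.
by apply: eq_bigr => ly _; rewrite linearZ.
Qed.
Next Obligation.
move=> X Y Z _ g [s ->]; exists [seq (ly.1 ** g, ly.2) | ly <- s].
by apply: hom_ext => x; rewrite ap_comp !ap_rank1s big_map.
Qed.

End OperatorIdeals.

Section Local.
Variables (k : fieldType) (G : groupType) (H : finGroupType).
Variable iota : {multiplicative H -> G}.
Implicit Types (X Y Z : gmod k G).

(** On [ghomk X Y] this is psi |-> sum_h h psi h^-1. *)
Definition nm Z (z : Z) : Z := \sum_(h : H) act (iota h) z.

Fact nm_linear Z : linear (@nm Z).
Proof.
move=> a x y; rewrite /nm scaler_sumr -big_split /=; apply: eq_bigr => h _.
by rewrite linearP.
Qed.
HB.instance Definition _ Z := GRing.isLinear.Build k Z Z *:%R (@nm Z) (@nm_linear Z).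

Definition hfix Z (z : Z) : Prop := forall h : H, act (iota h) z = z.

Lemma hfixD Z (x y : Z) : hfix x -> hfix y -> hfix (x + y).
Proof. by move=> hx hy h; rewrite linearD /= hx hy. Qed.
Lemma hfixN Z (x : Z) : hfix x -> hfix (- x).
Proof. by move=> hx h; rewrite linearN /= hx. Qed.
Lemma hfixB Z (x y : Z) : hfix x -> hfix y -> hfix (x - y).
Proof. by move=> hx hy; apply/hfixD/hfixN. Qed.
Lemma hfixZ Z a (x : Z) : hfix x -> hfix (a *: x).
Proof. by move=> hx h; rewrite linearZ /= hx. Qed.
Lemma hfix0 Z : hfix (0 : Z).
Proof. by move=> h; rewrite linear0. Qed.

Lemma hfix_nm Z (z : Z) : hfix (nm z).
Proof.
move=> h; rewrite /nm linear_sum [RHS](reindex_inj (mulgI h)) /=.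
by apply: eq_bigr => h' _; rewrite -act_mul -gmulfM.
Qed.

Section Bilinear.
Variables (X Y Z : gmod k G) (b : X -> Y -> Z).
Hypotheses (lb : bilinear_map b).
Hypothesis actb : forall g x y, act g (b x y) = b (act g x) (act g y).

Lemma hfix_bil x y : hfix x -> hfix y -> hfix (b x y).
Proof. by move=> hx hy h; rewrite actb hx hy. Qed.
Lemma nm_bill x y : hfix y -> b (nm x) y = nm (b x y).
Proof.
move=> hy; rewrite /nm (lin_sum (lb.1 y)); apply: eq_bigr => h _.
by rewrite actb hy.
Qed.
Lemma nm_bilr x y : hfix x -> b x (nm y) = nm (b x y).
Proof.
move=> hx; rewrite /nm (lin_sum (lb.2 x)); apply: eq_bigr => h _.
by rewrite actb hx.
Qed.
End Bilinear.

Lemma hfix_comp X Y Z (f : ghomk Y Z) (g : ghomk X Y) : hfix f -> hfix g -> hfix (f ** g).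
Proof. apply: hfix_bil; exact: hcomp_act. Qed.
Lemma nm_compl X Y Z (f : ghomk Y Z) (g : ghomk X Y) : hfix g -> nm f ** g = nm (f ** g).
Proof. apply: nm_bill; [exact: hcomp_bilinear | exact: hcomp_act]. Qed.
Lemma nm_compr X Y Z (f : ghomk Y Z) (g : ghomk X Y) : hfix f -> f ** nm g = nm (f ** g).
Proof. apply: nm_bilr; [exact: hcomp_bilinear | exact: hcomp_act]. Qed.

Lemma hfix_ap X Y (f : ghomk X Y) : hfix f -> forall h x, ap f (act (iota h) x) = act (iota h) (ap f x).
Proof. by move=> hf h x; rewrite -{1}(hf h) ap_act gactVK. Qed.
Lemma ap_hfix X Y (f : ghomk X Y) :
  (forall h x, ap f (act (iota h) x) = act (iota h) (ap f x)) -> hfix f.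
Proof. move=> hf h; apply: hom_ext => x; rewrite ap_act -hf. by rewrite gactKV. Qed.

Lemma hfix_id X : hfix (idh X).
Proof. by move=> h; exact: idh_act. Qed.
Lemma hfix_hom_of X Y (f : ghom X Y) : hfix (hom_of f).
Proof. by move=> h; exact: hom_of_act. Qed.

(** By Higman's criterion, an element of [ghomk X Y] is null exactly when it is the class
    zero in the stable category of kH. *)
Definition null Z (z : Z) : Prop := exists w, z = nm w.

Lemma null_nm Z (z : Z) : null (nm z).
Proof. by exists z. Qed.
Lemma null0 Z : null (0 : Z).
Proof. by exists 0; rewrite linear0. Qed.
Lemma nullD Z (x y : Z) : null x -> null y -> null (x + y).
Proof. by move=> [a ->] [b ->]; exists (a + b); rewrite linearD. Qed.
Lemma nullN Z (x : Z) : null x -> null (- x).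
Proof. by move=> [a ->]; exists (- a); rewrite linearN. Qed.
Lemma nullB Z (x y : Z) : null x -> null y -> null (x - y).
Proof. by move=> hx hy; apply/nullD/nullN. Qed.
Lemma null_compl X Y Z (f : ghomk Y Z) (g : ghomk X Y) : hfix g -> null f -> null (f ** g).
Proof. by move=> hg [a ->]; rewrite nm_compl //; exact: null_nm. Qed.
Lemma null_compr X Y Z (f : ghomk Y Z) (g : ghomk X Y) : hfix f -> null g -> null (f ** g).
Proof. by move=> hg [a ->]; rewrite nm_compr //; exact: null_nm. Qed.

Lemma null_sym Z (x y : Z) : null (x - y) -> null (y - x).
Proof. by move=> /nullN; rewrite opprB. Qed.
Lemma null_comp X Y Z (f f' : ghomk Y Z) (g g' : ghomk X Y) :
  hfix f -> hfix g' -> null (f - f') -> null (g - g') -> null (f ** g - f' ** g').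
Proof.
move=> hf hg' nf ng.
have -> : f ** g - f' ** g' = f ** (g - g') + (f - f') ** g'.
  by rewrite !hcompE addrA subrK.
by apply: nullD; [exact: null_compr | exact: null_compl].
Qed.

Section Small.
Variable JJ : op_ideal k G.
Local Notation J := (op_mem JJ).

(** For the zero ideal this says that X is projective over H, and for maps of finite rank
    that X is, in the stable category of kH, a retract of a finite-dimensional module. *)
Definition small X : Prop := exists psi : ghomk X X, J (idh X - nm psi).

Lemma op_mem_nm X Y (f : ghomk X Y) : J f -> J (nm f).
Proof.
move=> Jf; rewrite /nm; elim/big_ind: _ => [|f1 f2|h _].
- exact: op_mem0.
- exact: op_memD.
- exact: op_mem_act.
Qed.

Lemma smallP X (phi : ghomk X X) : J phi -> null (idh X - phi) -> small X.
Proof.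
move=> Jphi [w e]; exists w; suff -> : idh X - nm w = phi by [].
by rewrite -e opprB addrC subrK.
Qed.

Lemma small_retract X Y (i : ghomk X Y) (r : ghomk Y X) :
  hfix i -> hfix r -> null (r ** i - idh X) -> small Y -> small X.
Proof.
move=> hi hr nri [psi Jpsi].
apply: (@smallP X (r ** (idh Y - nm psi) ** i)); first exact/op_meml/op_memr.
rewrite !hcompE opprB addrCA; apply: nullD; last exact: null_sym.
by apply: null_compr => //; apply: null_compl => //; exact: null_nm.
Qed.

Variables (A B C : gmod k G) (i : ghomk A B) (p : ghomk B C).
Variables (s : ghomk C B) (r : ghomk B A).
Hypotheses (hi : hfix i) (hp : hfix p) (ses : split_ses i p s r).

Let ri : r ** i = idh A. Proof. by case: ses. Qed.
Let ps : p ** s = idh C. Proof. by case: ses. Qed.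
Let pi : p ** i = 0. Proof. by case: ses. Qed.
Let dec : i ** r + s ** p = idh B. Proof. by case: ses. Qed.

(** Carry psiA and psiC to maps a and c on B.  Up to the ideal, 1 - nm c has image in A and
    1 - nm a vanishes on A; so (1 - nm a) (1 - nm c), which is 1 modulo null maps, lies in
    the ideal. *)
Lemma small_mid : small A -> small C -> small B.
Proof.
move=> [psiA JA] [psiC JC].
pose a := i ** psiA ** r; pose c := s ** psiC ** p.
have pb : p ** (idh B - nm c) = (idh C - nm psiC) ** p.
  by rewrite !hcompE nm_compr // nm_compl // hcompA ps hcomp1l.
have ai : (idh B - nm a) ** i = i ** (idh A - nm psiA).
  by rewrite !hcompE nm_compr // nm_compl // /a -!hcompA ri hcomp1r.
exists (a + c - a ** nm c).
have -> : idh B - nm (a + c - a ** nm c) = (idh B - nm a) ** (idh B - nm c).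
  rewrite linearB /= !hcompE -nm_compl; last exact: hfix_nm.
  by rewrite [nm (a + c)]linearD /= !opprD !opprK !addrA; congr (_ + _); rewrite addrAC.
have -> : (idh B - nm a) ** (idh B - nm c) =
    ((idh B - nm a) ** i) ** r ** (idh B - nm c) +
    (idh B - nm a) ** s ** p ** (idh B - nm c).
  by rewrite -hcompA -hcompDr (hcompA i r) (hcompA s p) -hcompDl dec hcomp1l.
rewrite ai pb; apply: op_memD; first exact/op_memr/op_meml.
exact/op_meml/op_meml/op_memr.
Qed.

(** Since 1 - nm a vanishes on A up to the ideal, so does x = p psiB (1 - nm a), and
    therefore x factors through p up to the ideal.  As nm x is p up to the ideal, that
    factorisation writes the identity of C as a trace up to the ideal. *)
Lemma small_right : small A -> small B -> small C.
Proof.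
move=> [psiA JA] [psiB JB].
pose a := i ** psiA ** r.
have ai : (idh B - nm a) ** i = i ** (idh A - nm psiA).
  by rewrite !hcompE nm_compr // nm_compl // /a -!hcompA ri hcomp1r.
have pa : p ** (idh B - nm a) = p.
  by rewrite !hcompE nm_compr // /a hcompA pi hcomp0l linear0 subr0.
have ha : hfix (idh B - nm a) by apply: hfixB; [exact: hfix_id | exact: hfix_nm].
move: (idh B - nm a) ai pa ha => {a} a ai pa ha.
have [x xE] : exists x, x = p ** psiB ** a by eexists.
have ex : x = (x ** i) ** r + (x ** s) ** p by rewrite -!hcompA -hcompDr dec hcomp1r.
have Jx : J (x ** i).
  by rewrite xE -!hcompA ai; do ?[apply: op_meml].
have ep : p = p ** (idh B - nm psiB) ** a + nm ((x ** i) ** r) + nm (x ** s) ** p.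
  rewrite -addrA nm_compl // -linearD /= -ex xE -nm_compr // -nm_compl //.
  by rewrite -hcompDr -hcompDl subrK hcomp1l pa.
apply: (@smallP C ((p ** (idh B - nm psiB) ** a + nm ((x ** i) ** r)) ** s)).
  apply: op_memr; apply: op_memD; first exact/op_meml/op_memr.
  exact/op_mem_nm/op_memr.
have -> : idh C - (p ** (idh B - nm psiB) ** a + nm ((x ** i) ** r)) ** s =
          nm (x ** s); last exact: null_nm.
apply/eqP; rewrite subr_eq; apply/eqP.
by rewrite -{1}ps {1}ep hcompDl addrC -[(nm _ ** p) ** s]hcompA ps hcomp1r.
Qed.

(** Dual to the previous argument: x = (1 - nm c) psiB i has image in A up to the ideal. *)
Lemma small_left : small B -> small C -> small A.
Proof.
move=> [psiB JB] [psiC JC].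
pose c := s ** psiC ** p.
have pb : p ** (idh B - nm c) = (idh C - nm psiC) ** p.
  by rewrite !hcompE nm_compr // nm_compl // hcompA ps hcomp1l.
have bi : (idh B - nm c) ** i = i.
  by rewrite !hcompE nm_compl // /c -!hcompA pi !hcomp0r linear0 subr0.
have hb : hfix (idh B - nm c) by apply: hfixB; [exact: hfix_id | exact: hfix_nm].
move: (idh B - nm c) pb bi hb => {c} c pb bi hb.
have [x xE] : exists x, x = c ** psiB ** i by eexists.
have ex : x = i ** r ** x + s ** p ** x by rewrite !hcompA -hcompDl dec hcomp1l.
have Jx : J (p ** x).
  by rewrite xE hcompA pb -!hcompA; apply: op_memr.
have ei : i = c ** (idh B - nm psiB) ** i + nm (s ** p ** x) + i ** nm (r ** x).
  rewrite -addrA [nm _ + _]addrC nm_compr // -linearD /= -ex xE -nm_compr // -nm_compl //.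
  by rewrite -hcompDr -hcompDl subrK hcomp1l bi.
apply: (@smallP A (r ** (c ** (idh B - nm psiB) ** i + nm (s ** p ** x)))).
  apply: op_meml; apply: op_memD; first exact/op_meml/op_memr.
  exact/op_mem_nm/op_meml.
have -> : idh A - r ** (c ** (idh B - nm psiB) ** i + nm (s ** p ** x)) =
          nm (r ** x); last exact: null_nm.
apply/eqP; rewrite subr_eq; apply/eqP.
by rewrite -{1}ri {1}ei hcompDr addrC hcompA ri hcomp1l.
Qed.

End Small.

Definition locproj X : Prop := null (idh X).
Definition locfin X : Prop := small (finite_rank k G) X.

Lemma locproj_small X : locproj X <-> small (zero_ideal k G) X.
Proof.
split=> [[w e]|[w /eqP]]; exists w; first by rewrite -e subrr.
by apply/eqP; rewrite -subr_eq0.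
Qed.

Lemma locproj_locfin X : locproj X -> locfin X.
Proof.
move=> lX; apply: (@smallP _ X 0); first exact: op_mem0.
by rewrite subr0.
Qed.

Lemma locproj_nulll X Y (f : ghomk X Y) : locproj X -> hfix f -> null f.
Proof. by move=> lX hf; rewrite -[f]hcomp1r; exact: null_compr. Qed.
Lemma locproj_nullr X Y (f : ghomk X Y) : locproj Y -> hfix f -> null f.
Proof. by move=> lX hf; rewrite -[f]hcomp1l; exact: null_compl. Qed.

End Local.

(** * Modules over a free product *)

Section LinearAutomorphisms.
Variables (k : fieldType) (V : lmodType k).

Record laut := Laut {
  lfun : V -> V;
  linv : V -> V;
  lfun_linear : linear lfun;
  lfunK : cancel lfun linv;
  linvK : cancel linv lfun }.

Lemma laut_ext (a b : laut) : lfun a =1 lfun b -> a = b.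
Proof.
case: a b => [f f' lf fK f'K] [g g' lg gK g'K] /= e.
have efg : f = g by apply/funext.
have efg' : f' = g' by apply/funext => x; rewrite -{1}[x]g'K -e fK.
case: _ / efg in lf fK f'K lg gK g'K e *.
case: _ / efg' in fK f'K gK g'K *.
by congr Laut; apply: Prop_irrelevance.
Qed.

HB.instance Definition _ := gen_eqMixin laut.
HB.instance Definition _ := gen_choiceMixin laut.

#[local] Obligation Tactic := idtac.
Program Definition laut_one : laut := @Laut id id _ _ _.
Next Obligation. by []. Qed.
Next Obligation. by []. Qed.
Next Obligation. by []. Qed.

Program Definition laut_mul (a b : laut) : laut :=
  @Laut (lfun a \o lfun b) (linv b \o linv a) _ _ _.
Next Obligation. by move=> a b c x y /=; rewrite !lfun_linear. Qed.
Next Obligation. by move=> a b x /=; rewrite !lfunK. Qed.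
Next Obligation. by move=> a b x /=; rewrite !linvK. Qed.

Program Definition laut_inv (a : laut) : laut := @Laut (linv a) (lfun a) _ _ _.
Next Obligation.
by move=> a c x y; rewrite -[RHS](lfunK a) lfun_linear !linvK.
Qed.
Next Obligation. by move=> a; exact: linvK. Qed.
Next Obligation. by move=> a; exact: lfunK. Qed.

Fact laut_mulA : associative laut_mul. Proof. by move=> a b c; exact: laut_ext. Qed.
Fact laut_mul1 : left_id laut_one laut_mul. Proof. by move=> a; exact: laut_ext. Qed.
Fact laut_1mul : right_id laut_one laut_mul. Proof. by move=> a; exact: laut_ext. Qed.
Fact laut_mulV : left_inverse laut_one laut_inv laut_mul.
Proof. by move=> a; apply: laut_ext => x /=; rewrite lfunK. Qed.
Fact laut_Vmul : right_inverse laut_one laut_inv laut_mul.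
Proof. by move=> a; apply: laut_ext => x /=; rewrite linvK. Qed.

HB.instance Definition _ :=
  isGroup.Build laut laut_mulA laut_mul1 laut_1mul laut_mulV laut_Vmul.

End LinearAutomorphisms.

Lemma multiplicative1 (K L : groupType) (f : {multiplicative K -> L}) : f 1%g = 1%g.
Proof. by apply: (mulgI (f 1%g)); rewrite -gmulfM !mulg1. Qed.

Section FreeProduct.
Variables (k : fieldType) (H : nat -> finGroupType) (G : groupType).
Variable iota : forall n : nat, {multiplicative H n -> G}.
Hypothesis hG : is_free_product iota.
Implicit Types (X Y Z M N : gmod k G).

Lemma free_product_exists (K : groupType) (f : forall n, {multiplicative H n -> K}) :
  exists h : {multiplicative G -> K}, forall n x, h (iota n x) = f n x.
Proof. by have [h [hP _]] := hG f; exists h. Qed.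

Lemma free_product_unique (K : groupType) (f g : {multiplicative G -> K}) :
  (forall n x, f (iota n x) = g (iota n x)) -> f =1 g.
Proof.
move=> e.
have [h [_ hU]] := hG (fun n => (g \o iota n : {multiplicative _ -> _})).
by move=> x; rewrite (hU f) // (hU g).
Qed.

(** The identity of H n and the trivial maps on the other factors extend to a map
    G -> H n that is a retraction of iota n. *)
Lemma iota_inj n : injective (iota n).
Proof.
have ex j : exists f : {multiplicative H j -> H n},
    forall (e : n = j) x, f (ecast i (H i) e x) = x.
  have [e|ne] := pselect (n = j); first by case: _ / e; exists idfun => e x; rewrite eq_axiomK.
  pose f (x : H j) : H n := 1%g.
  have fM : {morph f : x y / (x * y)%g} by move=> x y; rewrite /f mulg1.
  pose mf := isMultiplicative.Build (H j) (H n) f fM.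
  pose f' : {multiplicative H j -> H n} := HB.pack f mf.
  by exists f'.
pose f j := sval (cid (ex j)).
have [h hP] := free_product_exists f.
have fn x : f n x = x by have := svalP (cid (ex n)) erefl x.
by move=> x y exy; rewrite -[x]fn -[y]fn -!hP exy.
Qed.

Lemma laut_action (V : lmodType k) (K : groupType) (a : K -> V -> V) :
  (forall h, linear (a h)) -> a 1%g =1 id ->
  (forall h h' v, a (h * h')%g v = a h (a h' v)) ->
  exists f : {multiplicative K -> laut V}, forall h v, lfun (f h) v = a h v.
Proof.
move=> la a1 aM.
have aK h : cancel (a h) (a h^-1%g) by move=> v; rewrite -aM mulVg a1.
have aVK h : cancel (a h^-1%g) (a h) by move=> v; rewrite -aM mulgV a1.
pose f h := Laut (la h) (aK h) (aVK h).
have fM : {morph f : x y / (x * y)%g}.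
  by move=> x y; apply: laut_ext => v /=; rewrite aM.
pose mf := isMultiplicative.Build K (laut V) f fM.
pose f' : {multiplicative K -> laut V} := HB.pack f mf.
by exists f'.
Qed.

(** The universal property of G, applied to the group of linear automorphisms of V. *)
Lemma glue_actions (V : lmodType k) (a : forall n, H n -> V -> V) :
  (forall n h, linear (a n h)) -> (forall n, a n 1%g =1 id) ->
  (forall n h h' v, a n (h * h')%g v = a n h (a n h' v)) ->
  exists b : G -> V -> V,
    [/\ forall g, linear (b g), forall v, b 1%g v = v,
        forall g h v, b (g * h)%g v = b g (b h v) &
        forall n h v, b (iota n h) v = a n h v].
Proof.
move=> la a1 aM.
have ex n : exists f : {multiplicative H n -> laut V}, forall h v, lfun (f h) v = a n h v.
  exact: laut_action.
pose f n := sval (cid (ex n)); have fP n : forall h v, lfun (f n h) v = a n h v.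
  exact: svalP (cid (ex n)).
have [h hP] := free_product_exists f.
exists (fun g => lfun (h g)); split.
- by move=> g; exact: lfun_linear.
- by move=> v; rewrite multiplicative1.
- by move=> g g' v; rewrite gmulfM.
- by move=> n x v; rewrite hP fP.
Qed.

(** Conjugating the action of G on M * N by the unipotent automorphism
    (x, y) |-> (x, y + f x) yields a second action.  The two agree on every H n, hence on
    G, which says that f commutes with G. *)
Lemma equivariant_gen M N (f : M -> N) : linear f ->
  (forall n h x, f (act (iota n h) x) = act (iota n h) (f x)) ->
  forall g x, f (act g x) = act g (f x).
Proof.
move=> lf ef.
pose V : lmodType k := (M * N)%type.
pose a g (v : V) : V := (act g v.1, act g v.2).
pose b g (v : V) : V := (act g v.1, act g v.2 - act g (f v.1) + f (act g v.1)).
have la g : linear (a g) by move=> c u v; rewrite /a /= !linearP.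
have [|g h v|A AE] := @laut_action V G a la.
- by move=> [x y]; rewrite /a !act_one.
- by rewrite /a /= !act_mul.
pose t (v : V) : V := (v.1, v.2 + f v.1); pose t' (v : V) : V := (v.1, v.2 - f v.1).
have lt : linear t.
  move=> c u v.
  rewrite -[LHS]/(c *: u.1 + v.1, c *: u.2 + v.2 + f (c *: u.1 + v.1)) lf.
  rewrite -[RHS]/(c *: u.1 + v.1, c *: (u.2 + f u.1) + (v.2 + f v.1)).
  by rewrite scalerDr addrACA.
have tK : cancel t t' by move=> [x y]; rewrite /t /t' /= addrK.
have t'K : cancel t' t by move=> [x y]; rewrite /t /t' /= subrK.
pose T := Laut lt tK t'K.
have BM : {morph (fun g => T^-1 * A g * T)%g : g h / (g * h)%g}.
  by move=> g h; rewrite gmulfM !mulgA mulgK.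
pose mf := isMultiplicative.Build G (laut V) _ BM.
pose B : {multiplicative G -> laut V} := HB.pack (fun g => T^-1 * A g * T)%g mf.
have AB : A =1 B.
  apply: free_product_unique => n h; apply: laut_ext => -[x y].
  rewrite AE -[RHS]/(t' (lfun (A (iota n h)) (t (x, y)))) AE /t /t' /a /=.
  by rewrite linearD ef addrK.
move=> g x; have := congr1 (fun c => t (lfun c (x, 0))) (AB g).
rewrite -[RHS]/(t (t' (lfun (A g) (t (x, 0))))) t'K !AE /t /a /= => -[].
by rewrite linear0 !add0r.
Qed.

End FreeProduct.

(** * Free and coinduced modules *)

Section FreeModules.
Variables (k : fieldType) (G : groupType).
Implicit Types (M N A B : gmod k G).

Definition fval M (phi : free M) : G -> M := val (phi : subspace_type (fin_supp_subspace M)).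

Lemma fval_lin M x : linear (fun phi : free M => fval phi x).
Proof. by []. Qed.

Lemma fval_ext M (phi psi : free M) : fval phi =1 fval psi -> phi = psi.
Proof. by move=> e; apply: val_inj; apply/funext. Qed.

Lemma fval_act M g (phi : free M) x : fval (act g phi) x = fval phi (g^-1 * x)%g.
Proof. by []. Qed.

Lemma counitE M (phi : free M) (r : seq G) : uniq r ->
  (forall h, h \notin r -> fval phi h = 0) ->
  counit M phi = \sum_(h <- r) act h (fval phi h).
Proof. exact: counit_funE. Qed.

Lemma fval_supp M (phi : free M) :
  exists2 r : seq G, uniq r & forall h, h \notin r -> fval phi h = 0.
Proof.
have [r hr] := fin_suppP phi; exists (undup r); first exact: undup_uniq.
by move=> h; rewrite mem_undup; exact: hr.
Qed.

Fact fdelta_supp M (m : M) : fin_supp (fun x : G => if x == 1%g then m else 0).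
Proof.
apply: (@sub_finite_set _ _ [set 1%g]); last exact: finite_set1.
by move=> x /=; case: eqP.
Qed.
(** The element 1 (x) m of kG (x) M. *)
Definition fdelta M (m : M) : free M :=
  @to_subspace _ _ (fin_supp_subspace M) _ (fdelta_supp m).

Lemma fval_delta M (m : M) x : fval (fdelta m) x = if x == 1%g then m else 0.
Proof. by []. Qed.

Lemma fdelta_linear M : linear (@fdelta M).
Proof.
move=> a m m'; apply: fval_ext => x; rewrite fval_lin !fval_delta.
by case: eqP => // _; rewrite scaler0 addr0.
Qed.

Lemma free_sum M (phi : free M) (r : seq G) : uniq r ->
  (forall h, h \notin r -> fval phi h = 0) ->
  phi = \sum_(h <- r) act h (fdelta (fval phi h)).
Proof.
move=> ur hr; apply: fval_ext => x; rewrite (lin_sum (@fval_lin M x)).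
have e h : fval (act h (fdelta (fval phi h))) x = if h == x then fval phi x else 0.
  by rewrite fval_act fval_delta mulg_eq1 (inj_eq invg_inj); case: eqP => // ->.
rewrite (eq_bigr _ (fun h _ => e h)).
have [xr|xr] := boolP (x \in r); last first.
  rewrite hr // big1_seq // => h /andP[_ hh].
  by case: eqP => // hx; rewrite hx (negbTE xr) in hh.
rewrite (bigD1_seq x) //= eqxx big1 ?addr0 // => h /negbTE -> //.
Qed.

Lemma counit_delta M (m : M) : counit M (fdelta m) = m.
Proof.
rewrite (@counitE _ _ [:: 1%g]) // ?big_seq1 ?fval_delta ?eqxx ?act_one //.
by move=> h; rewrite inE fval_delta => /negbTE ->.
Qed.

Lemma counit_surj M : surj (counit M).
Proof. by move=> m; exists (fdelta m); exact: counit_delta. Qed.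

Fact free_lift_supp M A (l : ghomk M A) (phi : free M) : fin_supp (fun x => ap l (fval phi x)).
Proof.
apply: sub_finite_set (subspace_valP phi) => x /= h e; apply: h.
by rewrite [fval phi x]e linear0.
Qed.

Definition free_lift_fun M A (l : ghomk M A) (phi : free M) : A :=
  counit A (@to_subspace _ _ (fin_supp_subspace A) _ (free_lift_supp l phi)).

Lemma free_lift M A (l : ghomk M A) :
  exists f : ghom (free M) A, forall m, f (fdelta m) = ap l m.
Proof.
have lf : linear (free_lift_fun l).
  move=> a x y; rewrite /free_lift_fun -linearP; congr (counit A _).
  by apply: fval_ext => z; rewrite /fval /= linearP.
have ef g x : free_lift_fun l (act g x) = act g (free_lift_fun l x).
  by rewrite /free_lift_fun -ghom_act; congr (counit A _); apply: fval_ext.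
exists (Ghom lf ef) => m; rewrite /= /free_lift_fun.
rewrite -[RHS]counit_delta; congr (counit A _); apply: fval_ext => x.
rewrite fval_delta -[LHS]/(ap l (fval (fdelta m) x)) fval_delta.
by case: eqP => // _; rewrite linear0.
Qed.

Lemma free_ext M A (f g : ghom (free M) A) :
  (forall m, f (fdelta m) = g (fdelta m)) -> forall x, f x = g x.
Proof.
move=> e x; have [r ur hr] := fval_supp x.
rewrite (free_sum ur hr) (lin_sum (ghom_linear f)) (lin_sum (ghom_linear g)).
apply: eq_bigr => h _.
by rewrite !ghom_act e.
Qed.

(** A lift is determined by a linear lift on the elements 1 (x) m. *)
Lemma free_projective M : projective (free M).
Proof.
move=> A B q f sq.
have [s ls sK] := linear_section (ghom_linear q) sq.
have ll : linear (fun m => s (f (fdelta m))).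
  by move=> a x y; rewrite fdelta_linear linearP ls.
have [g gP] := free_lift (mkhom ll).
exists g; apply: (@free_ext _ _ (ghom_comp q g) f) => m /=.
by rewrite gP ap_mk sK.
Qed.

#[local] Obligation Tactic := idtac.
(** The module coinduced from the vector space M, in the coordinates in which M embeds by
    m |-> (x |-> x^-1 m). *)
Program Definition coind M : gmod k G :=
  @Gmod k G (G -> M : lmodType k) (fun g j x => j (g^-1 * x)%g) _ _ _.
Next Obligation. by []. Qed.
Next Obligation. by move=> M j; apply/funext => y; rewrite invg1 mul1g. Qed.
Next Obligation. by move=> M g h j; apply/funext => y; rewrite invgM mulgA. Qed.

Program Definition coind_unit M : ghom M (coind M) :=
  @Ghom k G M (coind M) (fun m x => act x^-1%g m) _ _.
Next Obligation. by move=> M a m m'; apply/funext => x /=; rewrite linearP. Qed.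
Next Obligation. by move=> M g m; apply/funext => y; rewrite /= invgM invgK act_mul. Qed.

Lemma coind_ev_linear M x : linear (fun j : coind M => j x).
Proof. by []. Qed.

Section Restriction.
Variables (H : finGroupType) (iota : {multiplicative H -> G}).
Hypothesis iota_inj : injective iota.

(** The set T contains one element of each coset H x; injectivity of iota makes the
    translate that meets T unique. *)
Lemma transversal : exists T : G -> bool, forall x, exists h0 : H,
  forall h, T ((iota h)^-1 * x)%g = (h == h0).
Proof.
pose R x : pred G := fun y => `[< exists h : H, y = (iota h * x)%g >].
have exR x : exists y, R x y by exists (iota 1 * x)%g; apply/asboolP; exists 1%g.
pose rep x := xchoose (exR x).
have repE h x : rep (iota h * x)%g = rep x.
  apply: eq_xchoose => y; apply/asboolP/asboolP => -[h' ->].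
    by exists (h' * h)%g; rewrite gmulfM mulgA.
  by exists (h' * h^-1)%g; rewrite mulgA -gmulfM mulgKV.
exists (fun x => x == rep x) => x.
have /asboolP[h0 e0] := xchooseP (exR x); rewrite -/(rep x) in e0.
exists h0^-1%g => h.
have -> : ((iota h)^-1 * x = iota h^-1%g * x)%g.
  congr (_ * _)%g; apply: (mulgI (iota h)).
  by rewrite mulgV -gmulfM mulgV multiplicative1.
rewrite repE e0 (inj_eq (mulIg x)) (inj_eq iota_inj).
by rewrite -(inj_eq invg_inj) invgK.
Qed.

Lemma transversal_sum (T : G -> bool) (V : lmodType k) (v : V) x :
  (forall x, exists h0 : H, forall h, T ((iota h)^-1 * x)%g = (h == h0)) ->
  \sum_(h : H) (if T ((iota h)^-1 * x)%g then v else 0) = v.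
Proof.
move=> /(_ x)[h0 h0P].
rewrite (eq_bigr _ (fun h _ => congr1 (fun b : bool => if b then v else 0) (h0P h))).
by rewrite -big_mkcond big_pred1_eq.
Qed.

(** Here psi restricts functions to a transversal of the cosets of H. *)
Lemma locproj_coind M : locproj iota (coind M).
Proof.
have [T TP] := transversal.
have lpsi : linear (fun (j : coind M) x => if T x then j x else 0).
  move=> a j j'; apply/funext => x.
  rewrite -[RHS]/(a *: (if T x then j x else 0) + (if T x then j' x else 0)).
  by case: (T x); rewrite // scaler0 addr0.
exists (mkhom (X := coind M) (Y := coind M) lpsi); apply: hom_ext => j.
rewrite ap_id /nm ap_sum; apply/funext => x.
rewrite (lin_sum (@coind_ev_linear M x)) -[LHS](transversal_sum (j x) x TP).
apply: eq_bigr => h _; rewrite ap_act ap_mk /=; case: ifP => // _.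
by rewrite invgK mulVKg.
Qed.

Lemma locproj_free M : locproj iota (free M).
Proof.
have [T TP] := transversal.
have spsi (phi : free M) : fin_supp (fun x => if T x then fval phi x else 0).
  by apply: sub_finite_set (subspace_valP phi) => x /= h e; apply: h; rewrite [fval phi x]e; case: ifP.
pose psi phi : free M := @to_subspace _ _ (fin_supp_subspace M) _ (spsi phi).
have fpsi phi x : fval (psi phi) x = if T x then fval phi x else 0 by [].
have lpsi : linear psi.
  move=> a j j'; apply: fval_ext => x; rewrite fval_lin !fpsi fval_lin.
  by case: (T x); rewrite // scaler0 addr0.
exists (mkhom (X := free M) (Y := free M) lpsi); apply: hom_ext => j.
rewrite ap_id /nm ap_sum; apply: fval_ext => x.
rewrite (lin_sum (@fval_lin M x)) -[LHS](transversal_sum (fval j x) x TP).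
apply: eq_bigr => h _; rewrite ap_act ap_mk fval_act fpsi; case: ifP => // _.
by rewrite fval_act invgK mulVKg.
Qed.

(** A projective module is a retract of the free module that covers it. *)
Lemma projective_locproj (P : gmod k G) : projective P -> locproj iota P.
Proof.
move=> /(_ (free P) P (counit P) (ghom_id P) (@counit_surj P))[s sP].
have -> : locproj iota P = null iota (hom_of (counit P) ** hom_of s).
  by congr (null _ _); apply: hom_ext => x; rewrite ap_comp !ap_hom_of sP.
apply: null_compr; first exact: hfix_hom_of.
apply: locproj_nullr; [exact: locproj_free | exact: hfix_hom_of].
Qed.

Lemma stably_eq_null M N (f g : ghom M N) : stably_eq f g -> null iota (hom_of f - hom_of g).
Proof.
move=> [P [a [b [pP ab]]]].
have -> : hom_of f - hom_of g = hom_of b ** hom_of a by apply: hom_ext => x; exact: ab.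
apply: null_compr; first exact: hfix_hom_of.
apply: locproj_nullr; [exact: projective_locproj | exact: hfix_hom_of].
Qed.

End Restriction.
End FreeModules.

(** * Gluing extensions along the free factors *)

Section Syzygy.
Variables (k : fieldType) (G : groupType).
Implicit Types (X Y : gmod k G).

Definition jO X : ghomk (Omega X) (free X) := hom_of (ker_incl (counit X)).
Definition eO X : ghomk (free X) X := hom_of (counit X).

Lemma Omega_split X : exists s r, split_ses (jO X) (eO X) s r.
Proof.
apply: short_exact_split; split; [exact: val_inj | exact: counit_surj |].
move=> b; split=> [e|[a <-]]; last exact: (subspace_valP a).
by exists (@to_subspace _ _ (ker_subspace (counit X)) b e).
Qed.

Lemma jO_act X g : act g (jO X) = jO X. Proof. exact: hom_of_act. Qed.
Lemma eO_act X g : act g (eO X) = eO X. Proof. exact: hom_of_act. Qed.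

Lemma hfix_jO X (H : finGroupType) (iota : {multiplicative H -> G}) : hfix iota (jO X).
Proof. exact: hfix_hom_of. Qed.
Lemma hfix_eO X (H : finGroupType) (iota : {multiplicative H -> G}) : hfix iota (eO X).
Proof. exact: hfix_hom_of. Qed.

Lemma split_injl X Y Z W (i : ghomk X Y) (p : ghomk Y Z) s r (f g : ghomk W X) :
  split_ses i p s r -> i ** f = i ** g -> f = g.
Proof. by case=> ri _ _ _ _ e; rewrite -[f]hcomp1l -ri -hcompA e hcompA ri hcomp1l. Qed.

Lemma split_act_cancel X Y Z W (i : ghomk X Y) (p : ghomk Y Z) s r (f : ghomk W X) g :
  split_ses i p s r -> act g i = i -> act g (i ** f) = i ** f -> act g f = f.
Proof.
by move=> ses gi e; apply: (split_injl ses); rewrite -{1}gi -hcomp_act.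
Qed.

End Syzygy.

Section Gluing.
Variables (k : fieldType) (H : nat -> finGroupType) (G : groupType).
Variable iota : forall n : nat, {multiplicative H n -> G}.
Hypothesis hG : is_free_product iota.
Implicit Types (X Y Z M N A B R : gmod k G).

Lemma hfix_gen X Y (f : ghomk X Y) : (forall n, hfix (iota n) f) -> forall g, act g f = f.
Proof.
move=> hf g; apply: hom_ext => x; rewrite ap_act.
rewrite (equivariant_gen hG (ap_linear f)) ?gactKV // => n h y.
exact: hfix_ap.
Qed.

(** Over H n, the action on A * R is the product action conjugated by
    (a, r) |-> (a + d n r, r).  Nothing relates the actions of distinct factors, so d may be
    any family of linear maps: it prescribes a splitting over each factor separately. *)
Lemma twisted_extension A R (d : nat -> ghomk R A) :
  exists (E : gmod k G) (i : ghom A E) (p : ghom E R) (s : ghomk R E) (r : ghomk E A),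
    split_ses (hom_of i) (hom_of p) s r /\
    forall n, hfix (iota n) (s - hom_of i ** d n).
Proof.
pose V : lmodType k := (A * R)%type.
pose a n (h : H n) (v : V) : V :=
  (act (iota n h) (v.1 + ap (d n) v.2) - ap (d n) (act (iota n h) v.2), act (iota n h) v.2).
have [|||b [lb b1 bM bE]] := @glue_actions k H G iota hG V a.
- move=> n h c u v.
  rewrite -[LHS]/(act (iota n h) (c *: u.1 + v.1 + ap (d n) (c *: u.2 + v.2)) -
    ap (d n) (act (iota n h) (c *: u.2 + v.2)), act (iota n h) (c *: u.2 + v.2)).
  rewrite -[RHS]/(c *: (a n h u).1 + (a n h v).1, c *: (a n h u).2 + (a n h v).2).
  rewrite /a /= ap_linear addrACA -scalerDr !(act_linear (iota n h)) ap_linear.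
  by rewrite opprD addrACA -scalerBr.
- by move=> n [x y]; rewrite /a /= multiplicative1 !act_one addrK.
- by move=> n h h' [x y]; rewrite /a /= gmulfM !act_mul subrK.
pose E := @Gmod k G V b lb b1 bM.
have li : linear (fun x : A => (x, 0) : V).
  move=> c x y; rewrite -[RHS]/(c *: x + y, c *: (0 : R) + 0).
  by rewrite scaler0 addr0.
have lp : linear (fun v : V => v.2) by [].
have ls : linear (fun y : R => (0, y) : V).
  move=> c x y; rewrite -[RHS]/(c *: (0 : A) + 0, c *: x + y).
  by rewrite scaler0 addr0.
have lr : linear (fun v : V => v.1) by [].
have ei : forall g x, (act g x, 0) = b g (x, 0).
  apply: (@equivariant_gen k H G iota hG A E _ li) => n h x /=.
  by rewrite bE /a /= !linear0 ?oppr0 !addr0.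
have ep : forall g (v : E), (b g v).2 = act g v.2.
  apply: (@equivariant_gen k H G iota hG E R _ lp) => n h v /=.
  by rewrite bE.
exists E, (@Ghom k G A E _ li ei), (@Ghom k G E R _ lp ep).
exists (mkhom (X := R) (Y := E) ls), (mkhom (X := E) (Y := A) lr); split.
  split; apply: hom_ext => // -[x y].
  rewrite -[LHS]/(x + 0, 0 + y); by rewrite addr0 add0r.
move=> n; apply: ap_hfix => h x.
have e y : ap (mkhom (X := R) (Y := E) ls - hom_of (@Ghom k G A E _ li ei) ** d n) y =
    (- ap (d n) y, y).
  rewrite -[LHS]/(0 - ap (d n) y, y - 0); by rewrite sub0r subr0.
by rewrite !e /= bE /a /= addNr linear0 sub0r.
Qed.

Section Twist.
Variables (A R E : gmod k G) (i : ghom A E) (p : ghom E R).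
Variables (s : ghomk R E) (r : ghomk E A) (d : nat -> ghomk R A).
Hypotheses (ses : split_ses (hom_of i) (hom_of p) s r).
Hypothesis (hs : forall n, hfix (iota n) (s - hom_of i ** d n)).

Lemma twist_retraction n : hfix (iota n) (r + d n ** hom_of p).
Proof.
move=> h; apply: (split_act_cancel ses (hom_of_act _ _)).
have -> : hom_of i ** (r + d n ** hom_of p) = idh E - (s - hom_of i ** d n) ** hom_of p.
  by case: ses => _ _ _ _ <-; rewrite !hcompE opprB hcompA [_ - s ** _]addrC addrA addrK.
apply: hfixB; [exact: hfix_id | apply: hfix_comp => //; exact: hfix_hom_of].
Qed.
End Twist.

(** Given q : A -> B and f : Omega R -> B, push the extension free R of R by Omega R out
    along f to an extension E' of R by B.  A splitting of free R over H n turns it into the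
    extension twisted by f e_n for some e_n : R -> Omega R.  Lifting f e_n linearly along q
    defines an extension E of R by A that surjects onto E'.  Since free R is projective,
    the map free R -> E' lifts to E, and the restriction of the lift to Omega R is the
    desired map to A. *)
Lemma Omega_projective R : (forall n, locproj (iota n) R) -> projective (Omega R).
Proof.
move=> lR A B q f sq.
have [s0 [r0 ses0]] := Omega_split R; have [r0j es0 ej r0s0 dec0] := ses0.
have [sg0 lsg sgK] := linear_section (ghom_linear q) sq.
pose sg := mkhom lsg.
have qsg : hom_of q ** sg = idh B by apply: hom_ext => x; exact: sgK.
have /choice[psi psiE] : forall n, exists w, idh R = nm (iota n) w by exact: lR.
pose s1 n := nm (iota n) (s0 ** psi n).
have is1 n : hfix (iota n) (s1 n) by exact: hfix_nm.
have es1 n : eO R ** s1 n = idh R.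
  by rewrite nm_compr ?hcompA ?es0 ?hcomp1l // => h; exact: eO_act.
pose e n := - (r0 ** s1 n).
have je n : jO R ** e n = s0 - s1 n.
  rewrite /e hcompNr hcompA.
  have -> : jO R ** r0 = idh _ - s0 ** eO R by rewrite -dec0 addrK.
  by rewrite hcompDl hcompNl hcomp1l -hcompA es1 hcomp1r opprB.
have [E [i [p [s [r [ses hs]]]]]] := twisted_extension (fun n => sg ** hom_of f ** e n).
have [E' [i' [p' [s' [r' [ses' hs']]]]]] := twisted_extension (fun n => hom_of f ** e n).
have hr0 n : hfix (iota n) (r0 + e n ** eO R).
  move=> h; apply: (split_act_cancel ses0 (jO_act _ _)).
  have -> : jO R ** (r0 + e n ** eO R) = idh _ - s1 n ** eO R.
    by rewrite hcompDr hcompA je -dec0 hcompDl hcompNl addrA.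
  apply: hfixB; [exact: hfix_id | apply: hfix_comp => //; exact: hfix_eO].
have hPhi : forall g, act g (hom_of i' ** hom_of f ** r0 + s' ** eO R) =
                      hom_of i' ** hom_of f ** r0 + s' ** eO R.
  apply: hfix_gen => n.
  have -> : hom_of i' ** hom_of f ** r0 + s' ** eO R =
    hom_of i' ** hom_of f ** (r0 + e n ** eO R) +
    (s' - hom_of i' ** hom_of f ** e n) ** eO R.
    by rewrite !hcompE -!hcompA [s' ** _ - _]addrC addrA addrK.
  apply: hfixD; do ?[apply: hfix_comp]; by [exact: hfix_hom_of | exact: hr0 | exact: hs'].
have hQ : forall g, act g (hom_of i' ** hom_of q ** r + s' ** hom_of p) =
                      hom_of i' ** hom_of q ** r + s' ** hom_of p.
  apply: hfix_gen => n.
  have -> : hom_of i' ** hom_of q ** r + s' ** hom_of p =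
    hom_of i' ** hom_of q ** (r + (sg ** hom_of f ** e n) ** hom_of p) +
    (s' - hom_of i' ** hom_of f ** e n) ** hom_of p.
    rewrite !hcompE -!hcompA (hcompA (hom_of q) sg) qsg hcomp1l.
    by rewrite [s' ** _ - _]addrC addrA addrK.
  apply: hfixD; do ?[apply: hfix_comp]; try exact: hfix_hom_of; last exact: hs'.
  exact: (twist_retraction ses hs).
have [rI PS PI RS dec] := ses; have [rI' PS' PI' RS' dec'] := ses'.
have [L LP] : exists L : ghom (free R) E, forall x, ghom_mk hQ (L x) = ghom_mk hPhi x.
  apply: free_projective => y.
  exists (ap (hom_of i ** sg ** r' + s ** hom_of p') y); rewrite ghom_mkE -ap_comp.
  have -> : (hom_of i' ** hom_of q ** r + s' ** hom_of p) **
            (hom_of i ** sg ** r' + s ** hom_of p') = idh E'.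
    rewrite -dec' !hcompE -!hcompA (hcompA r (hom_of i)) rI (hcompA r s) RS.
    rewrite (hcompA (hom_of p) (hom_of i)) PI (hcompA (hom_of p) s) PS.
    by rewrite !hcompE (hcompA (hom_of q)) qsg hcomp1l addr0 add0r.
  by [].
have {LP} QL : (hom_of i' ** hom_of q ** r + s' ** hom_of p) ** hom_of L =
               hom_of i' ** hom_of f ** r0 + s' ** eO R.
  by apply: hom_ext => x; exact: LP.
have pL : hom_of p ** hom_of L = eO R.
  have := congr1 (hcomp (hom_of p')) QL.
  rewrite hcompA !hcompDr !(hcompA (hom_of p')) PI' PS' !hcompE !add0r.
  by [].
have iL : hom_of i ** r ** hom_of L ** jO R = hom_of L ** jO R.
  rewrite !hcompA.
  have -> : hom_of i ** r = idh E - s ** hom_of p by rewrite -dec addrK.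
  by rewrite !hcompE -!hcompA (hcompA (hom_of p)) pL ej !hcompE oppr0 addr0.
have lE : forall g, act g (r ** hom_of L ** jO R) = r ** hom_of L ** jO R.
  move=> g; apply: (split_act_cancel ses (hom_of_act _ _)).
  by rewrite iL hcomp_act hom_of_act jO_act.
exists (ghom_mk lE) => x; rewrite ghom_mkE -[RHS]ap_hom_of.
rewrite -[LHS]/(ap (hom_of q ** r ** hom_of L ** jO R) x).
congr (ap _ x); apply: (split_injl ses').
have := congr1 (fun z => z ** jO R) QL.
rewrite !hcompDl -!hcompA (hcompA (hom_of p)) pL ej r0j !hcompE !addr0.
by [].
Qed.

(** Embed M into the coinduced module J.  Over H n, u extends to an equivariant v_n on J,
    while v = u ev is merely a linear extension.  Twist free N (+) J so that v_n - v,
    lifted to free N, becomes the defect of equivariance: then v together with the counit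
    of free N is equivariant for G.  The twisted module is projective over each H n, as J
    and free N are. *)
Lemma null_factors M N (u : ghom M N) : (forall n, null (iota n) (hom_of u)) ->
  exists (R : gmod k G) (a : ghom M R) (b : ghom R N),
    (forall n, locproj (iota n) R) /\ forall x, b (a x) = u x.
Proof.
move=> nu; have /choice[psi psiE] : forall n, exists w, hom_of u = nm (iota n) w by [].
have [s0 [r0 [_ es0 _ _ _]]] := Omega_split N.
pose J := coind M; pose eta := hom_of (coind_unit M).
pose ev := mkhom (X := J) (Y := M) (@coind_ev_linear k G M 1%g).
have evK : ev ** eta = idh M.
  by apply: hom_ext => x; rewrite -[LHS]/(act 1^-1%g x) invg1 act_one.
pose v := hom_of u ** ev; pose v1 n := nm (iota n) (psi n ** ev).
have veta : v ** eta = hom_of u by rewrite -hcompA evK hcomp1r.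
have v1eta n : v1 n ** eta = hom_of u.
  by rewrite nm_compl -?hcompA ?evK ?hcomp1r ?psiE //; exact: hfix_hom_of.
pose d n := s0 ** (v1 n - v).
have ed n : eO N ** d n = v1 n - v by rewrite hcompA es0 hcomp1l.
have deta n : d n ** eta = 0 by rewrite -hcompA !hcompE v1eta veta subrr.
have [E [i [p [s [r [ses hs]]]]]] := twisted_extension (fun n => - d n).
have [rI PS PI RS dec] := ses.
have hs' n : hfix (iota n) (s + hom_of i ** d n).
  by have := hs n; rewrite hcompNr opprK.
have ha : forall g, act g (s ** eta) = s ** eta.
  apply: hfix_gen => n.
  have -> : s ** eta = (s + hom_of i ** d n) ** eta.
    by rewrite hcompDl -hcompA deta hcomp0r addr0.
  by apply: hfix_comp => //; exact: hfix_hom_of.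
have hr n : hfix (iota n) (r - d n ** hom_of p).
  have : hfix (iota n) (r + (- d n) ** hom_of p) by exact: (twist_retraction ses hs).
  by rewrite hcompNl.
have hb : forall g, act g (eO N ** r + v ** hom_of p) = eO N ** r + v ** hom_of p.
  apply: hfix_gen => n.
  have -> : eO N ** r + v ** hom_of p = eO N ** (r - d n ** hom_of p) + v1 n ** hom_of p.
    by rewrite hcompDr hcompNr hcompA ed !hcompE opprB addrA subrK.
  apply: hfixD; apply: hfix_comp; by [exact: hfix_eO | exact: hr | exact: hfix_nm | exact: hfix_hom_of].
exists E, (ghom_mk ha), (ghom_mk hb); split; last first.
  move=> x; rewrite !ghom_mkE -ap_comp.
  have -> : (eO N ** r + v ** hom_of p) ** s ** eta = hom_of u; last by [].
  by rewrite !hcompE -!hcompA (hcompA r) RS (hcompA (hom_of p)) PS !hcompE add0r hcompA.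
move=> n; rewrite /locproj -dec.
have -> : hom_of i ** r + s ** hom_of p =
  hom_of i ** (r - d n ** hom_of p) + (s + hom_of i ** d n) ** hom_of p.
  by rewrite !hcompE -!hcompA [s ** _ + _]addrC addrA subrK.
have inj : injective (iota n) by exact: (iota_inj hG).
apply: nullD; [apply: null_compl; first exact: hr | apply: null_compl; first exact: hfix_hom_of].
  apply: locproj_nulll; [exact: locproj_free | exact: hfix_hom_of].
apply: locproj_nulll; [exact: locproj_coind | exact: hs'].
Qed.

(** Over H n, f1 represents the value of Omega on f. *)
Definition shiftrel n X Y (f : ghomk X Y) (f1 : ghomk (Omega X) (Omega Y)) : Prop :=
  exists F : ghomk (free X) (free Y),
    [/\ hfix (iota n) F, F ** jO X = jO Y ** f1 & eO Y ** F = f ** eO X].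

(** Let E be the extension of A by free B twisted by the maps s f_n, with s a linear section
    of the counit of B.  The counit of free B extends to a G-map w : E -> B whose kernel is
    an extension of A by Omega B, locally the pullback of free B along f_n.  Its class is a
    map Omega A -> Omega B. *)
Lemma patch_local A B (f : forall n, ghomk A B) : (forall n, hfix (iota n) (f n)) ->
  exists u : ghom (Omega A) (Omega B), forall n, shiftrel n (f n) (hom_of u).
Proof.
move=> hf.
have [sA [rA [_ _ ejA _ _]]] := Omega_split A.
have [sB [rB sesB]] := Omega_split B; have [_ esB _ _ decB] := sesB.
have [E [i [p [s [r [ses hs]]]]]] := twisted_extension (fun n => sB ** f n).
have [rI PS PI RS dec] := ses.
have hr n : hfix (iota n) (r + (sB ** f n) ** hom_of p) by exact: (twist_retraction ses hs).
have hw : forall g, act g (eO B ** r) = eO B ** r.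
  apply: hfix_gen => n.
  have -> : eO B ** r = eO B ** (r + (sB ** f n) ** hom_of p) - f n ** hom_of p.
    by rewrite hcompDr !hcompA esB hcomp1l addrK.
  apply: hfixB; apply: hfix_comp; by [exact: hfix_eO | exact: hr | exact: hf | exact: hfix_hom_of].
pose w := ghom_mk hw.
have [L' L'P] : exists L : ghom (free A) (ker w),
    forall x, ghom_comp p (ker_incl w) (L x) = counit A x.
  apply: free_projective => y.
  have ws : w (ap s y) = 0 by rewrite ghom_mkE -ap_comp -hcompA RS hcomp0r.
  exists (@to_subspace _ _ (ker_subspace w) _ ws).
  by rewrite -[LHS]/(ap (hom_of p ** s) y) PS.
pose L := ghom_comp (ker_incl w) L'.
have pL : hom_of p ** hom_of L = eO A by apply: hom_ext => x; exact: L'P.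
have wL : eO B ** r ** hom_of L = 0.
  by rewrite hcompA; apply: hom_ext => x; exact: (subspace_valP (L' x)).
have iL : hom_of i ** r ** hom_of L ** jO A = hom_of L ** jO A.
  rewrite !hcompA.
  have -> : hom_of i ** r = idh E - s ** hom_of p by rewrite -dec addrK.
  by rewrite !hcompE -!hcompA (hcompA (hom_of p)) pL ejA !hcompE oppr0 addr0.
have jL : jO B ** rB ** r ** hom_of L ** jO A = r ** hom_of L ** jO A.
  rewrite hcompA; have -> : jO B ** rB = idh _ - sB ** eO B by rewrite -decB addrK.
  rewrite !hcompE -!hcompA (hcompA r) (hcompA (eO B)).
  by rewrite wL !hcompE oppr0 addr0 -hcompA.
have hu : forall g, act g (rB ** r ** hom_of L ** jO A) = rB ** r ** hom_of L ** jO A.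
  move=> g; apply: (split_act_cancel sesB (jO_act _ _)); rewrite jL.
  apply: (split_act_cancel ses (hom_of_act _ _)).
  by rewrite iL hcomp_act hom_of_act jO_act.
exists (ghom_mk hu) => n; exists ((r + (sB ** f n) ** hom_of p) ** hom_of L); split.
- by apply: hfix_comp; [exact: hr | exact: hfix_hom_of].
- have -> : hom_of (ghom_mk hu) = rB ** r ** hom_of L ** jO A by exact: hom_ext.
  rewrite jL -hcompA hcompDl -!hcompA (hcompA (hom_of p)) pL ejA !hcompE addr0.
  by [].
rewrite -!hcompA hcompDl hcompDr wL add0r -!hcompA pL.
by rewrite (hcompA (eO B)) esB hcomp1l.
Qed.

End Gluing.

(** * Stable morphisms as families of local maps *)

Section LocalRepresentatives.
Variables (k : fieldType) (H : nat -> finGroupType) (G : groupType).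
Variable iota : forall n : nat, {multiplicative H n -> G}.
Hypothesis hG : is_free_product iota.
Implicit Types (X Y Z W R : gmod k G).

Lemma split_injr X Y Z W (i : ghomk X Y) (p : ghomk Y Z) s r (f g : ghomk Z W) :
  split_ses i p s r -> f ** p = g ** p -> f = g.
Proof. by case=> _ ps _ _ _ e; rewrite -[f]hcomp1r -ps hcompA e -hcompA ps hcomp1r. Qed.

Lemma split_act_cancelr X Y Z W (i : ghomk X Y) (p : ghomk Y Z) s r (f : ghomk Z W) g :
  split_ses i p s r -> act g p = p -> act g (f ** p) = f ** p -> act g f = f.
Proof.
by move=> ses gi e; apply: (split_injr ses); rewrite -{1}gi -hcomp_act.
Qed.

Section OneFactor.
Variable n : nat.
Local Notation hfix := (hfix (iota n)).
Local Notation null := (null (iota n)).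
Local Notation nm := (nm (iota n)).
Local Notation shiftrel := (@shiftrel k H G iota n _ _).

Lemma free_locproj X : locproj (iota n) (free X).
Proof. by apply: locproj_free; exact: (iota_inj hG). Qed.

(** Free modules are projective and injective over H n, so a lift that covers or extends
    the zero map is itself null. *)
Lemma shiftrel_null X Y (f : ghomk X Y) f1 : shiftrel f f1 -> null f <-> null f1.
Proof.
move=> [F [hF Fj eF]].
have [sX [rX sesX]] := Omega_split X; have [rjX esX ejX rsX decX] := sesX.
have [sY [rY sesY]] := Omega_split Y; have [rjY esY ejY rsY decY] := sesY.
split=> -[psi e].
  pose F' := F - nm (sY ** psi ** eO X).
  have hF' : hfix F' by apply: hfixB => //; exact: hfix_nm.
  have eF' : eO Y ** F' = 0.
    rewrite !hcompE eF nm_compr; last exact: hfix_eO.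
    by rewrite hcompA esY hcomp1l -nm_compl -?e ?subrr //; exact: hfix_eO.
  have F'j : F' ** jO X = jO Y ** f1.
    rewrite !hcompE Fj nm_compl; last exact: hfix_jO.
    by rewrite -!hcompA ejX !hcompE linear0 subr0.
  have jr : jO Y ** rY ** F' = F'.
    by rewrite hcompA -[RHS]hcomp1l -decY hcompDl -(hcompA sY) eF' hcomp0r addr0.
  have hk : hfix (rY ** F').
    by move=> h; apply: (split_act_cancel sesY (jO_act _ _)); rewrite jr.
  have -> : f1 = (rY ** F') ** jO X.
    by apply: (split_injl sesY); rewrite !hcompA -(hcompA (jO Y)) jr.
  apply: null_compl; first exact: hfix_jO.
  by apply: locproj_nulll => //; exact: free_locproj.
pose F' := F - nm (jO Y ** psi ** rX).
have hF' : hfix F' by apply: hfixB => //; exact: hfix_nm.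
have F'j : F' ** jO X = 0.
  rewrite !hcompE Fj nm_compl; last exact: hfix_jO.
  by rewrite -!hcompA rjX hcomp1r -nm_compr -?e ?subrr //; exact: hfix_jO.
have eF' : eO Y ** F' = f ** eO X.
  rewrite !hcompE eF nm_compr; last exact: hfix_eO.
  by rewrite hcompA ejY !hcompE linear0 subr0.
have sr : (F' ** sX) ** eO X = F'.
  by rewrite -[RHS]hcomp1r -decX hcompDr (hcompA F') F'j hcomp0l add0r -hcompA.
have hk : hfix (F' ** sX).
  by move=> h; apply: (split_act_cancelr sesX (eO_act _ _)); rewrite sr.
have -> : f = eO Y ** F' ** sX.
  by apply: (split_injr sesX); rewrite -!hcompA (hcompA F') sr.
apply: null_compr; first exact: hfix_eO.
by apply: locproj_nullr => //; exact: free_locproj.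
Qed.

Lemma shiftrel_down X Y (f : ghomk X Y) : hfix f -> exists2 f1, hfix f1 & shiftrel f f1.
Proof.
move=> hf.
have [sX [rX sesX]] := Omega_split X; have [rjX esX ejX rsX decX] := sesX.
have [sY [rY sesY]] := Omega_split Y; have [rjY esY ejY rsY decY] := sesY.
have [th eth] := free_locproj X.
have [F FE] : exists F, F = nm (sY ** f ** eO X ** th) by eexists.
have hF : hfix F by rewrite FE; exact: hfix_nm.
have eF : eO Y ** F = f ** eO X.
  rewrite FE nm_compr; last exact: hfix_eO.
  rewrite hcompA esY hcomp1l hcompA -nm_compr -?eth ?hcomp1r //.
  by apply: hfix_comp => //; exact: hfix_eO.
have jf : jO Y ** rY ** F ** jO X = F ** jO X.
  rewrite hcompA; have -> : jO Y ** rY = idh _ - sY ** eO Y by rewrite -decY addrK.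
  by rewrite !hcompE -hcompA (hcompA (eO Y)) eF -!hcompA ejX !hcompE oppr0 addr0.
exists (rY ** F ** jO X).
  move=> h; apply: (split_act_cancel sesY (jO_act _ _)); rewrite jf.
  by apply: hfix_comp => //; exact: hfix_jO.
by exists F; split.
Qed.

Lemma shiftrel_up X Y (f1 : ghomk (Omega X) (Omega Y)) : hfix f1 ->
  exists2 f, hfix f & shiftrel f f1.
Proof.
move=> hf.
have [sX [rX sesX]] := Omega_split X; have [rjX esX ejX rsX decX] := sesX.
have [sY [rY sesY]] := Omega_split Y; have [rjY esY ejY rsY decY] := sesY.
have [th eth] := free_locproj Y.
have [F FE] : exists F, F = nm (th ** jO Y ** f1 ** rX) by eexists.
have hF : hfix F by rewrite FE; exact: hfix_nm.
have Fj : F ** jO X = jO Y ** f1.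
  rewrite FE nm_compl; last exact: hfix_jO.
  rewrite -!hcompA rjX hcomp1r -nm_compl -?eth ?hcomp1l //.
  by apply: hfix_comp => //; exact: hfix_jO.
have fe : (eO Y ** F ** sX) ** eO X = eO Y ** F.
  rewrite -!hcompA; have -> : sX ** eO X = idh _ - jO X ** rX by rewrite -decX addrC addKr.
  by rewrite !hcompE (hcompA F) Fj !hcompA ejY !hcompE oppr0 addr0.
exists (eO Y ** F ** sX).
  move=> h; apply: (split_act_cancelr sesX (eO_act _ _)); rewrite fe.
  by apply: hfix_comp => //; exact: hfix_eO.
by exists F; split.
Qed.

Lemma shiftrelB X Y (f g : ghomk X Y) f1 g1 :
  shiftrel f f1 -> shiftrel g g1 -> shiftrel (f - g) (f1 - g1).
Proof.
move=> [F [hF Fj eF]] [F' [hF' Fj' eF']]; exists (F - F'); split.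
- exact: hfixB.
- by rewrite !hcompE Fj Fj'.
- by rewrite !hcompE eF eF'.
Qed.

Lemma shiftrel_comp X Y Z (f : ghomk Y Z) (g : ghomk X Y) f1 g1 :
  shiftrel f f1 -> shiftrel g g1 -> shiftrel (f ** g) (f1 ** g1).
Proof.
move=> [F [hF Fj eF]] [F' [hF' Fj' eF']]; exists (F ** F'); split.
- exact: hfix_comp.
- by rewrite -hcompA Fj' !hcompA Fj.
- by rewrite hcompA eF -!hcompA eF'.
Qed.

Lemma shiftrel_hom_of X Y (f : ghom X Y) : shiftrel (hom_of f) (hom_of (Omega_map f)).
Proof.
exists (hom_of (free_map f)); split; first exact: hfix_hom_of.
  exact: hom_ext.
by apply: hom_ext => x; exact: counit_natural.
Qed.

(** [locrel f phi] says that f is the N-th syzygy of phi over H n, up to null maps. *)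
Fixpoint locrel (N : nat) : forall X Y, ghomk (OmegaN N X) (OmegaN N Y) -> ghomk X Y -> Prop :=
  match N with
  | 0 => fun X Y f phi => null (f - phi)
  | N'.+1 => fun X Y f phi => exists phi1 : ghomk (Omega X) (Omega Y),
      [/\ hfix phi1, shiftrel phi phi1 & @locrel N' (Omega X) (Omega Y) f phi1]
  end.

Lemma locrelS N X Y (f : ghomk (OmegaN N.+1 X) (OmegaN N.+1 Y)) (phi : ghomk X Y) :
  locrel f phi <-> exists phi1 : ghomk (Omega X) (Omega Y),
    [/\ hfix phi1, shiftrel phi phi1 & @locrel N (Omega X) (Omega Y) f phi1].
Proof. by []. Qed.

Lemma locrel_ex N X Y (f : ghomk (OmegaN N X) (OmegaN N Y)) : hfix f ->
  exists2 phi, hfix phi & locrel f phi.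
Proof.
elim: N X Y f => [|N IH] X Y f hf.
  by exists f => //=; rewrite subrr; exact: null0.
have [phi1 h1 l1] := IH (Omega X) (Omega Y) f hf.
by have [phi h s] := shiftrel_up h1; exists phi => //; apply/locrelS; exists phi1.
Qed.

Lemma locrelB N X Y (f g : ghomk (OmegaN N X) (OmegaN N Y)) phi gamma :
  locrel f phi -> locrel g gamma -> locrel (f - g) (phi - gamma).
Proof.
elim: N X Y f g phi gamma => [|N IH] X Y f g phi gamma.
  suff h (u v a b : ghomk X Y) : null (u - a) -> null (v - b) -> null (u - v - (a - b)).
    exact: h.
  by move=> h h'; have := nullB h h'; rewrite !opprD !opprK addrACA.
move=> /locrelS[phi1 [h1 s1 l1]] /locrelS[g1 [hg1 sg1 lg1]]; apply/locrelS; exists (phi1 - g1); split.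
- exact: hfixB.
- exact: shiftrelB.
- exact: IH.
Qed.

Lemma locrel_null N X Y (f : ghomk (OmegaN N X) (OmegaN N Y)) phi :
  locrel f phi -> null f <-> null phi.
Proof.
elim: N X Y f phi => [|N IH] X Y f phi.
  suff h (u a : ghomk X Y) : null (u - a) -> null u <-> null a by exact: h.
  move=> h; split=> h'; first by have := nullB h' h; rewrite opprB addrC subrK.
  by have := nullD h h'; rewrite subrK.
by move=> /locrelS[phi1 [h1 s1 l1]]; rewrite (shiftrel_null s1); exact: IH.
Qed.

Lemma locrel_comp N X Y Z (f : ghomk (OmegaN N Y) (OmegaN N Z))
    (g : ghomk (OmegaN N X) (OmegaN N Y)) phi gamma :
  hfix f -> hfix gamma -> locrel f phi -> locrel g gamma -> locrel (f ** g) (phi ** gamma).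
Proof.
elim: N X Y Z f g phi gamma => [|N IH] X Y Z f g phi gamma hf hg.
  exact: null_comp.
move=> /locrelS[phi1 [h1 s1 l1]] /locrelS[g1 [hg1 sg1 lg1]]; apply/locrelS; exists (phi1 ** g1); split.
- exact: hfix_comp.
- exact: shiftrel_comp.
- exact: IH.
Qed.

Lemma locrel_shift N X Y (f : ghom (OmegaN N X) (OmegaN N Y)) phi :
  hfix phi -> locrel (hom_of f) phi -> @locrel N.+1 X Y (hom_of (shift f)) phi.
Proof.
elim: N X Y f phi => [|N IH] X Y f phi hphi.
  move=> l; have [phi1 h1 s1] := shiftrel_down hphi.
  apply/(@locrelS 0); exists phi1; split=> //.
  exact/(shiftrel_null (shiftrelB (shiftrel_hom_of f) s1)).
move=> /locrelS[phi1 [h1 s1 l1]]; apply/locrelS; exists phi1; split=> //; exact: IH.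
Qed.

Lemma locrel_shiftN a N X Y (f : ghom (OmegaN N X) (OmegaN N Y)) phi :
  hfix phi -> locrel (hom_of f) phi -> locrel (hom_of (shiftN a f)) phi.
Proof. by move=> h l; elim: a => //= a IH; exact: locrel_shift. Qed.

Lemma locrel_cast a b (e : a = b) X Y (f : ghom (OmegaN a X) (OmegaN a Y)) phi :
  locrel (hom_of f) phi -> locrel (hom_of (cast_level e f)) phi.
Proof. by case: _ / e. Qed.

Definition rep X Y (f : thom X Y) (phi : ghomk X Y) : Prop :=
  hfix phi /\ locrel (hom_of (projT2 f)) phi.

Lemma rep_ex X Y (f : thom X Y) : exists phi, rep f phi.
Proof.
by have [phi h l] := locrel_ex (hfix_hom_of (iota n) (projT2 f)); exists phi.
Qed.

Lemma rep_of X Y (f : ghom X Y) : rep (thom_of f) (hom_of f).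
Proof. by split; [exact: hfix_hom_of | rewrite /= subrr; exact: null0]. Qed.

Lemma rep_comp X Y Z (f : thom Y Z) (g : thom X Y) phi gamma :
  rep f phi -> rep g gamma -> rep (tcomp f g) (phi ** gamma).
Proof.
move=> [h l] [h' l']; split; first exact: hfix_comp.
have -> : hom_of (projT2 (tcomp f g)) =
    hom_of (cast_level (addnC (projT1 g) (projT1 f)) (shiftN (projT1 g) (projT2 f))) **
    hom_of (shiftN (projT1 f) (projT2 g)) by exact: hom_ext.
apply: locrel_comp => //; first exact: hfix_hom_of.
  by apply: locrel_cast; exact: locrel_shiftN.
exact: locrel_shiftN.
Qed.

Lemma rep_id X : rep (tid X) (idh X).
Proof. by have := rep_of (ghom_id X); congr rep; exact: hom_ext. Qed.

Lemma rep_zero X Y : rep (tzero X Y) 0.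
Proof. by have := rep_of (ghom_zero X Y); congr rep; exact: hom_ext. Qed.

Lemma teq_rep X Y (f g : thom X Y) phi gamma :
  teq f g -> rep f phi -> rep g gamma -> null (phi - gamma).
Proof.
move=> [a [b [e st]]] [h l] [h' l'].
apply/(locrel_null (locrelB (locrel_cast e (locrel_shiftN a h l))
                            (locrel_shiftN b h' l'))).
apply: stably_eq_null st; exact: (iota_inj hG).
Qed.

End OneFactor.

(** A map that is null over every factor passes through a module R projective over every
    factor, and Omega R is projective over kG: one further syzygy suffices. *)
Lemma stably_eq_shift N X Y (f g : ghom (OmegaN N X) (OmegaN N Y)) :
  (forall n, null (iota n) (hom_of f - hom_of g)) -> stably_eq (shift f) (shift g).
Proof.
elim: N X Y f g => [|N IH] X Y f g; last exact: IH.
move=> /= nfg.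
have hu : forall g', act g' (hom_of f - hom_of g) = hom_of f - hom_of g.
  by move=> g'; rewrite gactB !hom_of_act.
have nu n : null (iota n) (hom_of (ghom_mk hu)) by rewrite hom_of_mk.
have [R [a [b [lR ab]]]] := null_factors hG nu.
exists (Omega R), (Omega_map a), (Omega_map b); split.
  exact: (Omega_projective hG).
move=> x; apply: val_inj; apply: fval_ext => y.
rewrite -[LHS]/(f (fval (val x) y) - g (fval (val x) y)).
by rewrite -[RHS]/(b (a (fval (val x) y))) ab ghom_mkE.
Qed.

Lemma cast_shift a b (e : a = b) (e' : a.+1 = b.+1) X Y (f : ghom (OmegaN a X) (OmegaN a Y)) :
  cast_level e' (shift f) = shift (cast_level e f).
Proof. by case: _ / e in e' *; rewrite (eq_irrelevance e' erefl). Qed.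

Lemma rep_teq X Y (f g : thom X Y) :
  (forall n, exists phi gamma,
    [/\ rep n f phi, rep n g gamma & null (iota n) (phi - gamma)]) -> teq f g.
Proof.
move=> hfg; have e0 : (projT1 g + projT1 f = projT1 f + projT1 g)%N by rewrite addnC.
exists (projT1 g).+1, (projT1 f).+1.
have e : ((projT1 g).+1 + projT1 f = (projT1 f).+1 + projT1 g)%N by rewrite !addSn e0.
exists e; rewrite [X in cast_level e X]/= (cast_shift e0).
apply: stably_eq_shift => n; have [phi [gamma [[h l] [h' l'] nn]]] := hfg n.
apply/(locrel_null (locrelB (locrel_cast _ (locrel_shiftN _ h l)) (locrel_shiftN _ h' l'))).
by [].
Qed.

Lemma rep_patch X Y (phi : forall n : nat, ghomk X Y) : (forall n, hfix (iota n) (phi n)) ->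
  exists f : thom X Y, forall n, rep n f (phi n).
Proof.
move=> hphi; have [u hu] := patch_local hG hphi.
exists (existT (fun N => ghom (OmegaN N X) (OmegaN N Y)) 1%N u) => n; split=> //.
exists (hom_of u); split=> //; first exact: hfix_hom_of.
by rewrite /= subrr; exact: null0.
Qed.

End LocalRepresentatives.

(** * Tensor products and duals *)

Lemma lin_sub (k : fieldType) (U V : lmodType k) (f : U -> V) : linear f ->
  {morph f : x y / x - y}.
Proof. by move=> lf x y; rewrite addrC -scaleN1r lf scaleN1r addrC. Qed.

Section TensorDual.
Variables (k : fieldType) (G : groupType).
Implicit Types (X Y Z W : gmod k G).

Lemma gtens_act_pure X Y g (x : X) (y : Y) :
  act g (pure x y : gtens X Y) = pure (act g x) (act g y).
Proof. exact: tens_act_pure. Qed.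

Lemma tens_lift_act X Y Z (b : X -> Y -> Z) : bilinear_map b ->
  (forall g x y, act g (b x y) = b (act g x) (act g y)) ->
  forall g (t : gtens X Y), tens_lift b (act g t) = act g (tens_lift b t).
Proof.
move=> lb eb g; have ll := tens_lift_linear lb.
apply: (@tens_ext _ _ _ _ (fun t => tens_lift b (tens_act g t)) (fun t => act g (tens_lift b t))).
- by move=> a s t; rewrite -ll; congr tens_lift; exact: tens_act_linear.
- by move=> a s t; rewrite ll act_linear.
by move=> x y; rewrite tens_act_pure !tens_lift_pure.
Qed.

Lemma tens_lift_idpure X Y (t : tens X Y) : tens_lift (@pure k X Y) t = t.
Proof.
have lp := pure_bilinear X Y.
apply: (tens_ext (f := tens_lift (@pure k X Y)) (g := id)) => //.
  exact: tens_lift_linear.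
by move=> x y; rewrite tens_lift_pure.
Qed.

Lemma tens_class_eval X Y (s : seq (X * Y)) : tens_class s = tens_eval (@pure k X Y) s.
Proof. by rewrite -[LHS]tens_lift_idpure; exact/tens_repr_eval/pure_bilinear. Qed.

Section TensorOfMaps.
Variables (X Y Z W : gmod k G) (f : ghomk X Z) (g : ghomk Y W).

Definition map_tens_bil (x : X) (y : Y) : tens Z W := pure (ap f x) (ap g y).
Lemma map_tens_bilP : bilinear_map map_tens_bil.
Proof.
split=> [y|x] a u v; rewrite /map_tens_bil ap_linear.
  exact: (pure_bilinear Z W).1.
exact: (pure_bilinear Z W).2.
Qed.

Definition map_tens : ghomk (gtens X Y) (gtens Z W) :=
  mkhom (X := gtens X Y) (Y := gtens Z W) (tens_lift_linear map_tens_bilP).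

Lemma map_tens_pure x y : ap map_tens (pure x y : gtens X Y) = pure (ap f x) (ap g y).
Proof. by rewrite ap_mk; exact/tens_lift_pure/map_tens_bilP. Qed.
End TensorOfMaps.

Lemma hom_tens_ext X Y Z (f g : ghomk (gtens X Y) Z) :
  (forall x y, ap f (pure x y : gtens X Y) = ap g (pure x y : gtens X Y)) -> f = g.
Proof.
move=> e; apply: hom_ext.
exact: (@tens_ext k X Y Z (ap f) (ap g) (ap_linear f) (ap_linear g)).
Qed.

Lemma map_tens_id X Y : map_tens (idh X) (idh Y) = idh (gtens X Y).
Proof. by apply: hom_tens_ext => x y; rewrite map_tens_pure. Qed.

Lemma map_tens_bilinear X Y Z W : bilinear_map (@map_tens X Y Z W).
Proof.
split=> [g|f] a u v; apply: hom_tens_ext => x y; rewrite ap_add ap_scale !map_tens_pure ap_add ap_scale.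
  exact: (pure_bilinear Z W).1.
exact: (pure_bilinear Z W).2.
Qed.

Lemma map_tens_act X Y Z W h (f : ghomk X Z) (g : ghomk Y W) :
  act h (map_tens f g) = map_tens (act h f) (act h g).
Proof.
apply: hom_tens_ext => x y; rewrite ap_act.
have -> : act h^-1%g (pure x y : gtens X Y) = pure (act h^-1%g x) (act h^-1%g y).
  exact: tens_act_pure.
by rewrite !map_tens_pure !ap_act; exact: tens_act_pure.
Qed.

Lemma op_mem_sum (J : op_ideal k G) X Y I (r : seq I) (F : I -> ghomk X Y) :
  (forall i, op_mem J (F i)) -> op_mem J (\sum_(i <- r) F i).
Proof.
move=> JF; elim/big_ind: _ => [|f g|i _]; [exact: op_mem0 | exact: op_memD | exact: JF].
Qed.

Lemma ap_rank1 X Y (l : ghomk X (gunit k G)) (y : Y) x :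
  ap (dual_tens_bil l y) x = (ap l x : k) *: y.
Proof. by []. Qed.

Lemma rank1_finite X Y (l : ghomk X (gunit k G)) (y : Y) :
  op_mem (finite_rank k G) (dual_tens_bil l y).
Proof. by exists [:: (l, y)]; rewrite /rank1s /tens_eval big_seq1. Qed.

Lemma map_tens_finite_rank X Y Z W (f : ghomk X Z) (g : ghomk Y W) :
  op_mem (finite_rank k G) f -> op_mem (finite_rank k G) g ->
  op_mem (finite_rank k G) (map_tens f g).
Proof.
suff single (l : ghomk X (gunit k G)) (z : Z) (m : ghomk Y (gunit k G)) (w : W) :
    op_mem (finite_rank k G) (map_tens (dual_tens_bil l z) (dual_tens_bil m w)).
  move=> [s ->] [s' ->]; rewrite /rank1s /tens_eval.
  rewrite (lin_sum ((map_tens_bilinear X Y Z W).1 _)); apply: op_mem_sum => lz.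
  rewrite (lin_sum ((map_tens_bilinear X Y Z W).2 _)); apply: op_mem_sum => mw.
  exact: single.
pose b (x : X) (y : Y) : k^o := (ap l x : k) * (ap m y : k).
have lb : bilinear_map b.
  split=> [y|x] a u v; rewrite /b ap_linear.
    by rewrite mulrDl -mulrA.
  by rewrite mulrDr mulrCA.
have -> : map_tens (dual_tens_bil l z) (dual_tens_bil m w) =
  @dual_tens_bil k G (gtens X Y) (gtens Z W)
    (mkhom (X := gtens X Y) (Y := gunit k G) (tens_lift_linear lb)) (pure z w).
  apply: hom_tens_ext => x y; rewrite map_tens_pure.
  rewrite -[RHS]/((tens_lift b (pure x y) : k) *: pure z w) tens_lift_pure //.
  rewrite !ap_rank1 /b.
  rewrite (linZ ((pure_bilinear Z W).1 _)) (linZ ((pure_bilinear Z W).2 _)).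
  by rewrite scalerA.
exact: rank1_finite.
Qed.

Fact precomp_linear X Y (f : ghomk X X) : linear (fun g : ghomk X Y => g ** f).
Proof. by move=> a u v; rewrite hcompDl hcompZl. Qed.
Definition precomp X Y (f : ghomk X X) : ghomk (ghomk X Y) (ghomk X Y) :=
  mkhom (X := ghomk X Y) (Y := ghomk X Y) (precomp_linear f).

Lemma precompE X Y (f : ghomk X X) (g : ghomk X Y) : ap (precomp Y f) g = g ** f.
Proof. by []. Qed.

Lemma precomp_lin X Y : linear (@precomp X Y).
Proof.
by move=> a u v; apply: hom_ext => g; rewrite ap_add ap_scale !precompE hcompDr hcompZr.
Qed.

Lemma precompB X Y (f g : ghomk X X) : precomp Y (f - g) = precomp Y f - precomp Y g.
Proof. by apply: hom_ext => h; rewrite ap_sub !precompE hcompDr hcompNr. Qed.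

Lemma precomp_act X Y h (f : ghomk X X) : act h (precomp Y f) = precomp Y (act h f).
Proof. by apply: hom_ext => g; rewrite ap_act !precompE hcomp_act gactKV. Qed.

Lemma precomp_finite_rank X (f : ghomk X X) :
  op_mem (finite_rank k G) f -> op_mem (finite_rank k G) (precomp (gunit k G) f).
Proof.
move=> [s ->]; rewrite /rank1s /tens_eval (lin_sum (@precomp_lin X (gunit k G))).
apply: op_mem_sum => -[l x]; rewrite [X in precomp _ X]/=.
have le : linear (fun m : ghomk X (gunit k G) => ap m x) by [].
have -> : precomp (gunit k G) (dual_tens_bil l x) =
  @dual_tens_bil k G (ghomk X (gunit k G)) (ghomk X (gunit k G))
    (mkhom (X := ghomk X (gunit k G)) (Y := gunit k G) le) l.
  apply: hom_ext => m; apply: hom_ext => y; rewrite precompE.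
  rewrite ap_comp !ap_rank1 ap_mk linearZ ap_scale.
  exact: (mulrC (ap l y : k) (ap m x : k)).
exact: rank1_finite.
Qed.

Lemma dual_tens_map_pure X Y (l : ghomk X (gunit k G)) (y : Y) :
  dual_tens_map X Y (pure l y) = dual_tens_bil l y.
Proof. exact/tens_lift_pure/dual_tens_bilP. Qed.

Lemma dual_tens_map_class X Y s :
  dual_tens_map X Y (tens_class s) = rank1s (X := X) (Y := Y) s.
Proof. exact/tens_repr_eval/dual_tens_bilP. Qed.

(** The usual elimination: if the leading functional l is nonzero at x0, the relation
    evaluated at x0 expresses y through the other vectors, and this shortens the sum. *)
Lemma dual_tens_map_inj X Y : injective (dual_tens_map X Y).
Proof.
suff inj0 (t : gtens (ghomk X (gunit k G)) Y) : dual_tens_map X Y t = 0 -> t = 0.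
  move=> t t' e; apply/eqP; rewrite -subr_eq0; apply/eqP/inj0.
  by rewrite addrC -scaleN1r (ghom_linear (dual_tens_map X Y)) scaleN1r e addNr.
have -> : t = tens_class (tens_repr t) by rewrite tens_reprK.
rewrite dual_tens_map_class tens_class_eval => e.
move: (tens_repr t) e => s; have [n] := ubnP (size s).
elim: n s => // n IH [|[l y] s] sz e; first by rewrite /tens_eval big_nil.
have [l0|l0] := eqVneq l 0.
  have drop (Q : lmodType k) (b : ghomk X (gunit k G) -> Y -> Q) : bilinear_map b ->
      tens_eval b ((l, y) :: s) = tens_eval b s.
    by move=> lb; rewrite /tens_eval big_cons /= l0 (lin0 (lb.1 y)) add0r.
  rewrite drop; last exact: pure_bilinear.
  apply: IH => //; rewrite -e /rank1s drop //; exact: dual_tens_bilP.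
have [x0 lx0] : exists x0, (ap l x0 : k) != 0.
  apply: contrapT => h; move/eqP: l0; apply; apply: hom_ext => x.
  by apply/eqP/negP => lx; apply: h; exists x; apply/negP.
(* y = - sum_i c_i y_i with c_i = l_i(x0) / l(x0) *)
pose c (m : ghomk X (gunit k G)) : k := (ap m x0 : k) / (ap l x0 : k).
have ey : y = - \sum_(my <- s) c my.1 *: my.2.
  have /(congr1 (fun f => ap f x0)) := e; rewrite ap_rank1s big_cons /= => /eqP.
  rewrite addr_eq0 => /eqP ey.
  rewrite -[LHS](scale1r y) -(mulVf lx0) -scalerA ey scalerN scaler_sumr.
  by congr (- _); apply: eq_bigr => my _; rewrite scalerA /c mulrC.
have reduce (Q : lmodType k) (b : ghomk X (gunit k G) -> Y -> Q) : bilinear_map b ->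
    tens_eval b ((l, y) :: s) =
    tens_eval b [seq (my.1 - c my.1 *: l, my.2) | my <- s].
  move=> lb; rewrite /tens_eval big_cons big_map /= {1}ey.
  rewrite -scaleN1r (linZ (lb.2 l)) (lin_sum (lb.2 l)) scaler_sumr -big_split /=.
  apply: eq_bigr => my _; rewrite (linZ (lb.2 l)) addrC -[in RHS]scaleN1r.
  by rewrite (linD (lb.1 _)) !(linZ (lb.1 _)).
rewrite reduce; last exact: pure_bilinear.
apply: IH; first by rewrite size_map.
by rewrite -e /rank1s reduce //; exact: dual_tens_bilP.
Qed.

Section Contraction.
Variables X Y : gmod k G.

Fact contract_fun_linear (l : ghomk X (gunit k G)) (x : X) :
  linear (fun f : ghomk X Y => pure l (ap f x) : gtens (ghomk X (gunit k G)) Y).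
Proof. by move=> a u v; rewrite ap_add ap_scale; exact: (pure_bilinear _ _).2. Qed.

Definition contract_bil (l : ghomk X (gunit k G)) (x : X) :
  ghomk (ghomk X Y) (gtens (ghomk X (gunit k G)) Y) :=
  mkhom (X := ghomk X Y) (Y := gtens (ghomk X (gunit k G)) Y) (contract_fun_linear l x).

Lemma contract_bilE l x (f : ghomk X Y) : ap (contract_bil l x) f = pure l (ap f x).
Proof. by []. Qed.

Lemma contract_bilP : bilinear_map contract_bil.
Proof.
split=> [x|l] a u v; apply: hom_ext => f; rewrite ap_add ap_scale !contract_bilE.
  exact: (pure_bilinear _ _).1.
by rewrite ap_linear; exact: (pure_bilinear _ _).2.
Qed.

Lemma contract_bil_act g l x : act g (contract_bil l x) = contract_bil (act g l) (act g x).
Proof.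
apply: hom_ext => f; rewrite ap_act !contract_bilE.
rewrite -[LHS]/(tens_act g (pure l (ap (act g^-1%g f) x))) tens_act_pure ap_act.
by rewrite gactKV invgK.
Qed.

(** For an element of X^* (x) X of image phi in End X, this is a map Hom(X, Y) -> X^* (x) Y
    that is inverse to the natural one when phi is the identity. *)
Definition contract :
    gtens (ghomk X (gunit k G)) X -> ghomk (ghomk X Y) (gtens (ghomk X (gunit k G)) Y) :=
  tens_lift contract_bil.

Lemma contract_linear : linear contract.
Proof. exact: (tens_lift_linear contract_bilP). Qed.

Lemma contract_pure l x : contract (pure l x) = contract_bil l x.
Proof. exact/tens_lift_pure/contract_bilP. Qed.

Lemma contract_act g t : contract (act g t) = act g (contract t).
Proof. by apply: tens_lift_act; [exact: contract_bilP | exact: contract_bil_act]. Qed.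

Lemma dual_contract t (f : ghomk X Y) :
  dual_tens_map X Y (ap (contract t) f) = f ** dual_tens_map X X t.
Proof.
move: t; apply: (tens_ext (f := fun t => dual_tens_map X Y (ap (contract t) f))
   (g := fun t => f ** dual_tens_map X X t)).
- move=> a s t; rewrite contract_linear ap_add ap_scale.
  exact: (ghom_linear (dual_tens_map X Y)).
- by move=> a s t; rewrite (ghom_linear (dual_tens_map X X)) hcompDr hcompZr.
move=> l x; rewrite contract_pure contract_bilE !dual_tens_map_pure; apply: hom_ext => z.
by rewrite ap_comp !ap_rank1 linearZ.
Qed.

Lemma contract_dual t :
  contract t ** hom_of (dual_tens_map X Y) =
  map_tens (precomp (gunit k G) (dual_tens_map X X t)) (idh Y).
Proof.
apply: (@hom_tens_ext (ghomk X (gunit k G)) Y) => m y.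
rewrite map_tens_pure ap_comp ap_hom_of dual_tens_map_pure precompE ap_id.
move: t; apply: (tens_ext (f := fun t => ap (contract t) (dual_tens_bil m y))
   (g := fun t => pure (m ** dual_tens_map X X t) y)).
- by move=> a s t; rewrite contract_linear ap_add ap_scale.
- move=> a s t; rewrite (ghom_linear (dual_tens_map X X)) hcompDr hcompZr.
  exact: (pure_bilinear _ _).1.
move=> l x; rewrite contract_pure contract_bilE dual_tens_map_pure.
rewrite ap_rank1 (linZ ((pure_bilinear _ _).2 _)).
rewrite -(linZ ((pure_bilinear _ _).1 _)); congr pure; apply: hom_ext => z.
rewrite ap_scale ap_comp ap_rank1 linearZ.
exact: (mulrC (ap m x : k) (ap l z : k)).
Qed.

End Contraction.

Section OneSubgroup.
Variables (H : finGroupType) (iota : {multiplicative H -> G}).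

Lemma nm_map_tensl X Y Z W (f : ghomk X Z) (g : ghomk Y W) :
  hfix iota g -> map_tens (nm iota f) g = nm iota (map_tens f g).
Proof. by apply: nm_bill; [exact: map_tens_bilinear | exact: map_tens_act]. Qed.

Lemma nm_map_tensr X Y Z W (f : ghomk X Z) (g : ghomk Y W) :
  hfix iota f -> map_tens f (nm iota g) = nm iota (map_tens f g).
Proof. by apply: nm_bilr; [exact: map_tens_bilinear | exact: map_tens_act]. Qed.

Lemma nm_precomp X Y (f : ghomk X X) : precomp Y (nm iota f) = nm iota (precomp Y f).
Proof.
rewrite /nm (lin_sum (@precomp_lin X Y)); apply: eq_bigr => h _.
by rewrite precomp_act.
Qed.

Lemma nm_ap X Y (f : ghomk X Y) x : hfix iota x -> ap (nm iota f) x = nm iota (ap f x).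
Proof.
move=> hx; rewrite /nm ap_sum; apply: eq_bigr => h _.
by rewrite -{1}(hx h) ap_act gactVK.
Qed.

Lemma locproj_tensl X Y : locproj iota X -> locproj iota (gtens X Y).
Proof.
move=> [w e]; exists (map_tens w (idh Y)).
by rewrite -nm_map_tensl ?e -?map_tens_id -?e //; exact: hfix_id.
Qed.

Lemma locproj_tensr X Y : locproj iota Y -> locproj iota (gtens X Y).
Proof.
move=> [w e]; exists (map_tens (idh X) w).
by rewrite -nm_map_tensr -?map_tens_id -?e //; exact: hfix_id.
Qed.

Lemma locfin_tens X Y : locfin iota X -> locfin iota Y -> locfin iota (gtens X Y).
Proof.
move=> [w Jw] [v Jv].
apply: (smallP (map_tens_finite_rank Jw Jv)).
have lb := map_tens_bilinear X Y X Y.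
have hw : hfix iota (idh X - nm iota w) by apply: hfixB; [exact: hfix_id | exact: hfix_nm].
have -> : idh (gtens X Y) - map_tens (idh X - nm iota w) (idh Y - nm iota v) =
   map_tens (nm iota w) (idh Y) + map_tens (idh X - nm iota w) (nm iota v).
  have e1 : map_tens (idh X) (idh Y) =
      map_tens (idh X - nm iota w) (idh Y) + map_tens (nm iota w) (idh Y).
    by rewrite -(linD (lb.1 _)) subrK.
  have e2 : map_tens (idh X - nm iota w) (idh Y) =
      map_tens (idh X - nm iota w) (idh Y - nm iota v) + map_tens (idh X - nm iota w) (nm iota v).
    by rewrite -(linD (lb.2 _)) subrK.
  by rewrite -map_tens_id e1 e2 -[X in X - _ = _]addrA addrC addrK addrC.
have n1 : null iota (map_tens (nm iota w) (idh Y)).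
  by rewrite nm_map_tensl; [exact: null_nm | exact: hfix_id].
have n2 : null iota (map_tens (idh X - nm iota w) (nm iota v)).
  by rewrite nm_map_tensr //; exact: null_nm.
exact: (nullD n1 n2).
Qed.

Lemma locfin_dual X : locfin iota X -> locfin iota (ghomk X (gunit k G)).
Proof.
move=> [w Jw]; apply: (smallP (precomp_finite_rank Jw)).
rewrite precompB nm_precomp.
have -> : precomp (gunit k G) (idh X) = idh _ by apply: hom_ext => f; exact: hcomp1r.
by rewrite opprB addrC subrK; exact: null_nm.
Qed.

End OneSubgroup.
End TensorDual.

(** * Local criteria in the stable category *)

Section LocalCriteria.
Variables (k : fieldType) (H : nat -> finGroupType) (G : groupType).
Variable iota : forall n : nat, {multiplicative H n -> G}.
Hypothesis hG : is_free_product iota.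
Implicit Types (X Y Z W : gmod k G).

Lemma retract_local X Y (i : thom X Y) (r : thom Y X) : teq (tcomp r i) (tid X) ->
  forall n phi psi, rep iota n i phi -> rep iota n r psi -> null (iota n) (psi ** phi - idh X).
Proof.
by move=> e n phi psi ri rr; apply: (teq_rep hG e); [exact: (rep_comp hG) | exact: rep_id].
Qed.

Lemma retract_patch X Y (phi : nat -> ghomk X Y) (psi : nat -> ghomk Y X) :
  (forall n, hfix (iota n) (phi n)) -> (forall n, hfix (iota n) (psi n)) ->
  (forall n, null (iota n) (psi n ** phi n - idh X)) ->
  exists (i : thom X Y) (r : thom Y X), teq (tcomp r i) (tid X).
Proof.
move=> hphi hpsi e.
have [i ri] := rep_patch hG hphi; have [r rr] := rep_patch hG hpsi.
exists i, r; apply: (rep_teq hG) => n; exists (psi n ** phi n), (idh X).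
by split=> //; [exact: (rep_comp hG) | exact: rep_id].
Qed.

Lemma tiso_local X Y (f : thom X Y) : tiso f ->
  forall n phi, rep iota n f phi -> exists psi : ghomk Y X,
    [/\ hfix (iota n) psi, null (iota n) (psi ** phi - idh X) & null (iota n) (phi ** psi - idh Y)].
Proof.
move=> [g [gf fg]] n phi rphi; have [psi rpsi] := rep_ex hG n g.
exists psi; split; first exact: rpsi.1.
  exact: (retract_local gf).
exact: (retract_local fg).
Qed.

Lemma local_tiso X Y (f : thom X Y) (phi : nat -> ghomk X Y) (psi : nat -> ghomk Y X) :
  (forall n, rep iota n f (phi n)) -> (forall n, hfix (iota n) (psi n)) ->
  (forall n, null (iota n) (psi n ** phi n - idh X)) ->
  (forall n, null (iota n) (phi n ** psi n - idh Y)) -> tiso f.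
Proof.
move=> rf hpsi e e'; have [g rg] := rep_patch hG hpsi; exists g; split.
  apply: (rep_teq hG) => n; exists (psi n ** phi n), (idh X).
  by split=> //; [exact: (rep_comp hG) | exact: rep_id].
apply: (rep_teq hG) => n; exists (phi n ** psi n), (idh Y).
by split=> //; [exact: (rep_comp hG) | exact: rep_id].
Qed.

Lemma is_zeroP X : is_zero X <-> forall n, locproj (iota n) X.
Proof.
split=> [e n|l].
  by have := teq_rep hG e (rep_id _ n X) (rep_zero _ n X X); rewrite subr0.
apply: (rep_teq hG) => n; exists (idh X), 0.
by split; [exact: rep_id | exact: rep_zero | rewrite subr0; exact: l].
Qed.

Section SmallObjects.
Variables (J : op_ideal k G) (n : nat).
Local Notation small := (small (iota n) J).

Lemma locproj_is_small X : locproj (iota n) X -> small X.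
Proof. by move=> l; apply: (@smallP _ _ _ _ _ X 0); [exact: op_mem0 | rewrite subr0]. Qed.

Lemma small_tretract X Y (i : thom X Y) (r : thom Y X) :
  teq (tcomp r i) (tid X) -> small Y -> small X.
Proof.
move=> e; have [phi rphi] := rep_ex hG n i; have [psi rpsi] := rep_ex hG n r.
apply: small_retract (retract_local e rphi rpsi); [exact: rphi.1 | exact: rpsi.1].
Qed.

Lemma small_tiso X Y (f : thom X Y) : tiso f -> small X <-> small Y.
Proof. by move=> [g [gf fg]]; split; [exact: small_tretract fg | exact: small_tretract gf]. Qed.

Lemma small_Omega X : small (Omega X) <-> small X.
Proof.
have [s [r ses]] := Omega_split X.
have lF : small (free X) by apply/locproj_is_small/(free_locproj hG).
split=> l.
  apply: small_right ses l lF; [exact: hfix_jO | exact: hfix_eO].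
apply: small_left ses lF l; [exact: hfix_jO | exact: hfix_eO].
Qed.

Lemma small_triangle X Y Z : in_triangle X Y Z ->
  [/\ small X -> small Y -> small Z, small Y -> small Z -> small X &
      small X -> small Z -> small Y].
Proof.
move=> [u [v [w [A [B [C [i [p [d [a [b [c [[se _ ia ib ic] _]]]]]]]]]]]]].
rewrite (propext (small_tiso ia)) (propext (small_tiso ib)) (propext (small_tiso ic)).
have [s [r ses]] := short_exact_split se.
have hi : hfix (iota n) (hom_of i) by exact: hfix_hom_of.
have hp : hfix (iota n) (hom_of p) by exact: hfix_hom_of.
split; [exact: small_right ses | exact: small_left ses | exact: small_mid ses].
Qed.

End SmallObjects.

(** If X is dualisable, the inverse over H n of the natural map for Y = X, applied to the
    identity, gives an element of X^* (x) X whose image is the identity up to a null map.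
    Conversely, contraction against such an element inverts the natural map for every Y. *)
Lemma dualisableP X : dualisable X <-> forall n, locfin (iota n) X.
Proof.
split=> [dX n|lX Y].
  have [psi [hpsi _ [w e]]] := tiso_local (dX X) (rep_of _ n (dual_tens_map X X)).
  apply: (@smallP _ _ _ _ _ X (dual_tens_map X X (ap psi (idh X)))).
    by exists (tens_repr (ap psi (idh X))).
  apply: null_sym; exists (ap w (idh X)).
  by rewrite -nm_ap -?e //; exact: hfix_id.
have /choice[psi psiP] : forall n, exists w, exists t : gtens (ghomk X (gunit k G)) X,
    dual_tens_map X X t = idh X - nm (iota n) w.
  move=> n; have [w [s e]] := lX n; exists w, (tens_class s).
  by rewrite dual_tens_map_class.
have /choice[t tP] := psiP.
have ht n : hfix (iota n) (t n).
  move=> h; apply: dual_tens_map_inj; rewrite ghom_act tP.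
  by apply: hfixB; [exact: hfix_id | exact: hfix_nm].
apply: (@local_tiso _ _ _ (fun n => hom_of (dual_tens_map X Y)) (fun n => contract Y (t n))).
- by move=> n; exact: rep_of.
- by move=> n h; rewrite -contract_act ht.
- move=> n; rewrite contract_dual tP precompB nm_precomp; apply: null_sym.
  have -> : precomp (gunit k G) (idh X) = idh _ by apply: hom_ext => f; exact: hcomp1r.
  exists (map_tens (precomp (gunit k G) (psi n)) (idh Y)).
  rewrite -nm_map_tensl; last exact: hfix_id.
  rewrite -map_tens_id (lin_sub ((map_tens_bilinear _ _ _ _).1 _)).
  by rewrite opprB addrC subrK.
move=> n; apply: null_sym; exists (precomp Y (psi n)); rewrite -nm_precomp.
apply: hom_ext => f; rewrite ap_sub ap_comp ap_hom_of dual_contract tP precompE ap_id.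
by rewrite hcompDr hcompNr hcomp1r opprB addrC subrK.
Qed.

Lemma dualisable_tens X Y : dualisable X -> dualisable Y -> dualisable (gtens X Y).
Proof. by move=> /dualisableP dX /dualisableP dY; apply/dualisableP => n; exact: locfin_tens. Qed.

Lemma dualisable_dual X : dualisable X -> dualisable (ghomk X (gunit k G)).
Proof. by move=> /dualisableP dX; apply/dualisableP => n; exact: locfin_dual. Qed.

Lemma dualisable_unit : dualisable (gunit k G).
Proof.
apply/dualisableP => n; apply: (@smallP _ _ _ _ _ _ (idh (gunit k G))); last first.
  by rewrite subrr; exact: null0.
exists [:: (idh (gunit k G), 1 : gunit k G)]; apply: hom_ext => x.
by rewrite ap_rank1s big_seq1 ap_id; exact: esym (mulr1 (x : k)).
Qed.

End LocalCriteria.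

(** * Cyclic groups of order p in characteristic p *)

Section PolynomialCalculus.
Variables (k : fieldType) (G : groupType) (X : gmod k G).
Implicit Types (f g : ghomk X X) (q : {poly k}).

Definition hpow f (n : nat) : ghomk X X := iter n (hcomp f) (idh X).

Lemma hpowS f n : hpow f n.+1 = f ** hpow f n. Proof. by []. Qed.

Lemma hpow1 f : hpow f 1 = f. Proof. exact: hcomp1r. Qed.

Lemma hpowD f m n : hpow f (m + n) = hpow f m ** hpow f n.
Proof. by elim: m => [|m IH]; rewrite ?hcomp1l // addSn !hpowS IH hcompA. Qed.

Lemma hpow_comm f g n : f ** g = g ** f -> hpow f n ** g = g ** hpow f n.
Proof.
move=> e; elim: n => [|n IH]; first by rewrite hcomp1l hcomp1r.
by rewrite hpowS -hcompA IH !hcompA e.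
Qed.

Definition pev f q : ghomk X X := \sum_(i < size q) q`_i *: hpow f i.

Lemma pevE f q n : (size q <= n)%N -> pev f q = \sum_(i < n) q`_i *: hpow f i.
Proof.
move=> le; rewrite /pev (big_ord_widen n (fun i => q`_i *: hpow f i) le) big_mkcond.
apply: eq_bigr => i _; case: ltnP => // ge.
by rewrite nth_default // scale0r.
Qed.

Lemma pev_linear f : linear (pev f).
Proof.
move=> a q r; pose n := maxn (size (a *: q + r)) (maxn (size q) (size r)).
rewrite !(@pevE f _ n); try by rewrite !leq_max leqnn ?orbT.
rewrite scaler_sumr -big_split; apply: eq_bigr => i _ /=.
by rewrite coefD coefZ scalerDl scalerA.
Qed.

Lemma pevXn f n : pev f 'X^n = hpow f n.
Proof.
rewrite /pev size_polyXn big_ord_recr /= coefXn eqxx scale1r big1 ?add0r // => i _.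
by rewrite coefXn ltn_eqF ?scale0r.
Qed.

Lemma pev1 f : pev f 1 = idh X.
Proof. by rewrite -[RHS](pevXn f 0) expr0. Qed.

Lemma pevMX f q : pev f (q * 'X) = f ** pev f q.
Proof.
rewrite (@pevE f (q * 'X) (size q).+1); last first.
  by have [->|q0] := eqVneq q 0; rewrite ?mul0r ?size_poly0 // size_mulX.
rewrite big_ord_recl coefMX eqxx scale0r add0r /pev.
rewrite (lin_sum ((hcomp_bilinear X X X).2 f)); apply: eq_bigr => i _.
by rewrite coefMX /= hcompZr.
Qed.

Lemma pevM f q r : pev f (q * r) = pev f q ** pev f r.
Proof.
elim/poly_ind: q => [|q c IH].
  by rewrite mul0r (lin0 (pev_linear f)) hcomp0l.
rewrite mulrDl mulrAC !(linD (pev_linear f)) !pevMX IH hcompDl hcompA; congr (_ + _).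
rewrite mul_polyC (linZ (pev_linear f)) -[c%:P]mulr1 mul_polyC (linZ (pev_linear f)).
by rewrite pev1 hcompZl hcomp1l.
Qed.

Lemma pevX f q n : pev f (q ^+ n) = hpow (pev f q) n.
Proof.
elim: n => [|n IH]; first by rewrite expr0 pev1.
by rewrite exprS pevM IH.
Qed.

End PolynomialCalculus.

(** Both sides times X - 1 are X^p - 1. *)
Lemma sum_Xn_pchar (k : fieldType) p : p \in [pchar k] ->
  \sum_(i < p) 'X^i = ('X - 1 : {poly k}) ^+ p.-1.
Proof.
move=> cp; have pp : prime p := pcharf_prime cp.
have x0 : ('X - 1 : {poly k}) != 0 by rewrite polyXsubC_eq0.
apply: (mulfI x0); rewrite -subrX1 -exprS prednK ?prime_gt0 //.
have cp' : p \in [pchar {poly k}] by rewrite pchar_poly.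
by rewrite -!(pFrobenius_autE cp') pFrobenius_autB_comm ?rmorph1 //; exact: commr1.
Qed.

Lemma pseudo_inverse (k : fieldType) (U V : lmodType k) (f : U -> V) : linear f ->
  exists2 s : V -> U, linear s & forall x, f (s (f x)) = f x.
Proof.
move=> lf.
have W0 : exists u, f u = 0 by exists 0; exact: lin0.
have WP a x y : (exists u, f u = x) -> (exists u, f u = y) -> exists u, f u = a *: x + y.
  by move=> [u <-] [v <-]; exists (a *: u + v); exact: lf.
pose W := @Subspace k V (fun v => exists u, f u = v) W0 WP.
pose f' (u : U) : subspace_type W := to_subspace (W := W) (ex_intro _ u erefl).
have lf' : linear f' by move=> a x y; apply: val_inj; exact: lf.
have sf' w : exists u, f' u = w.
  by have [u e] := subspace_valP w; exists u; apply: val_inj.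
have [s ls sK] := linear_section lf' sf'.
have [||||| g lg [_ gP]] := @linrel_extension k V U (fun _ _ => True)
  (fun v u => exists2 w : subspace_type W, v = val w & u = s w) => //.
- by move=> x; exists 0.
- split; first by exists 0 => //; rewrite (lin0 ls).
  by move=> a _ _ _ _ [w -> ->] [w' -> ->]; exists (a *: w + w') => //; rewrite ls.
- move=> _ [w e ->]; have -> : w = 0 by apply: val_inj; rewrite -e.
  exact: lin0.
exists g => // x; rewrite (gP _ (s (f' x))); last by exists (f' x).
exact: (congr1 (fun w : subspace_type W => val w) (sK (f' x))).
Qed.

Section CyclicGroup.
Variables (k : fieldType) (G : groupType) (H : finGroupType) (p : nat).
Variable iota : {multiplicative H -> G}.
Hypotheses (charp : p \in [pchar k]) (cycH : cyclic [set: H]) (cardH : #|[set: H]| = p).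
Implicit Types X Y : gmod k G.

Local Notation hfix := (hfix iota).
Local Notation nm := (nm iota).
Local Notation null := (null iota).

Let p_prime : prime p := pcharf_prime charp.

Lemma generator_ex : exists g : H, [set: H] = <[g]>%g.
Proof. by have /cyclicP := cycH. Qed.

Let g : H := sval (cid generator_ex).
Let gE : [set: H] = <[g]>%g := svalP (cid generator_ex).
Let order_g : #[g]%g = p. Proof. by rewrite /order -gE cardH. Qed.

Definition gact X : ghomk X X := mkhom (@act_linear _ _ X (iota g)).
Definition tact X : ghomk X X := gact X - idh X.

Lemma gactX X i x : ap (hpow (gact X) i) x = act (iota (g ^+ i)%g) x.
Proof.
elim: i => [|i IH]; first by rewrite expg0 multiplicative1 act_one.
by rewrite hpowS ap_comp IH expgS gmulfM act_mul.
Qed.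

Lemma power_of_g h : exists2 i, (i < p)%N & h = (g ^+ i)%g.
Proof.
have : h \in <[g]>%g by rewrite -gE inE.
by case/cyclePmin => i; rewrite order_g; exists i.
Qed.

Lemma hfix_gact X (x : X) : ap (tact X) x = 0 -> hfix x.
Proof.
move=> /eqP; rewrite ap_sub subr_eq0 => /eqP e h.
have [i _ ->] := power_of_g h; rewrite -gactX.
by elim: i => // i IH; rewrite hpowS ap_comp IH.
Qed.

Lemma hfix_comm X Y (f : ghomk X Y) : f ** tact X = tact Y ** f -> hfix f.
Proof.
rewrite /tact !hcompE => /addIr e; apply: ap_hfix => h x.
have [i _ ->] := power_of_g h; rewrite -!gactX.
elim: i => // i IH; rewrite !hpowS !ap_comp -IH.
by rewrite -!ap_comp e.
Qed.

Lemma comm_tact X Y (f : ghomk X Y) : hfix f -> f ** tact X = tact Y ** f.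
Proof.
move=> hf; rewrite /tact !hcompE; congr (_ - _).
by apply: hom_ext => x; exact: hfix_ap.
Qed.

Lemma nm_gact X (x : X) : nm x = ap (\sum_(i < p) hpow (gact X) i) x.
Proof.
rewrite ap_sum /nm.
have inj : injective (fun i : 'I_p => (g ^+ i)%g).
  move=> i j /eqP; rewrite eq_expg_mod_order order_g !modn_small // => /eqP e.
  exact: val_inj.
have -> : \sum_h act (iota h) x = \sum_(h in [set: H]) act (iota h) x.
  by apply: eq_bigl => h; rewrite inE.
have -> : [set: H] = ((fun i : 'I_p => (g ^+ i)%g) @: [set: 'I_p])%SET.
  apply/setP => h; rewrite inE; apply/esym/imsetP.
  by have [i ip ->] := power_of_g h; exists (Ordinal ip); rewrite ?inE.
rewrite big_imset /=; last by move=> i j _ _; exact: inj.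
by apply: eq_big => i; rewrite ?inE // gactX.
Qed.

Lemma pev_tact X : pev (gact X) ('X - 1) = tact X.
Proof.
by rewrite (lin_sub (pev_linear _)) pev1 -['X]expr1 pevXn hpowS hcomp1r.
Qed.

(** The norm of a cyclic group of order p is (g - 1)^(p-1), so it is a power of the nilpotent
    operator [tact]. *)
Lemma nm_tact X (x : X) : nm x = ap (hpow (tact X) p.-1) x.
Proof.
rewrite nm_gact -pev_tact -pevX -sum_Xn_pchar // (lin_sum (pev_linear _)).
by congr (ap _ x); apply: eq_bigr => i _; rewrite pevXn.
Qed.

Lemma tact_nilpotent X : hpow (tact X) p = 0.
Proof.
have e : ('X - 1 : {poly k}) ^+ p = 'X^p - 1.
  rewrite -(prednK (prime_gt0 p_prime)) exprS -sum_Xn_pchar // -subrX1.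
  by rewrite prednK // prime_gt0.
rewrite -pev_tact -pevX e (lin_sub (pev_linear _)) pev1 pevXn.
apply/eqP; rewrite subr_eq0; apply/eqP; apply: hom_ext => x.
by rewrite gactX -order_g expg_order multiplicative1 act_one.
Qed.

(** If nu is linear with N nu N = N, then zeta = sum_h h (nu N nu) h^-1 is the identity on
    the image of the norm N, and eta = 1 - zeta. *)
Lemma nm_killer X : exists eta : ghomk X X,
  [/\ hfix eta, null (idh X - eta) & forall x, nm (ap eta x) = 0].
Proof.
have [s ls sP] := pseudo_inverse (@nm_linear _ _ _ iota X).
pose nu := mkhom ls; pose mu := mkhom (@nm_linear _ _ _ iota X).
have hz : hfix (nm (nu ** mu ** nu)) by exact: hfix_nm.
have zN x : ap (nm (nu ** mu ** nu)) (nm x) = nm x.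
  rewrite nm_ap; last exact: hfix_nm.
  rewrite !ap_comp -[RHS]sP; congr (nm (s _)); exact: sP.
exists (idh X - nm (nu ** mu ** nu)); split.
- by apply: hfixB => //; exact: hfix_id.
- by rewrite opprB addrC subrK; exact: null_nm.
move=> x; rewrite ap_sub ap_id linearB /=; apply/eqP; rewrite subr_eq0; apply/eqP.
rewrite -{1}zN /nm [LHS](linear_sum (ap _)); apply: eq_bigr => h _.
exact: hfix_ap.
Qed.

Lemma hpow_null X (eta : ghomk X X) n : hfix eta -> null (idh X - eta) ->
  hfix (hpow eta n) /\ null (idh X - hpow eta n).
Proof.
move=> he ne; elim: n => [|n [hn nn]].
  by split; [exact: hfix_id | rewrite subrr; exact: null0].
split; first exact: hfix_comp.
rewrite hpowS -{1}[idh X]hcomp1l; apply: null_comp => //; exact: hfix_id.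
Qed.

(** The elements killed by t = [tact] are norms, and eta kills norms.  As eta commutes with
    t, it maps the kernel of t^(j+1) to the kernel of t^j, so eta^p = 0.  But eta is the
    identity modulo null maps. *)
Lemma norm_criterion X : (forall x : X, hfix x -> exists y, x = nm y) -> locproj iota X.
Proof.
move=> tate; have [eta [he ne Ne]] := nm_killer X.
have eN y : ap eta (nm y) = 0.
  rewrite -[RHS](Ne y) /nm linear_sum; apply: eq_bigr => h _ /=.
  by rewrite hfix_ap.
have key j : forall x, ap (hpow (tact X) j) x = 0 -> ap (hpow eta j) x = 0.
  elim: j => [|j IH] x //; rewrite hpowS ap_comp => e.
  have [y ey] := tate _ (hfix_gact e).
  rewrite -addn1 hpowD ap_comp hpow1; apply: IH.
  rewrite -ap_comp hpow_comm; last exact/esym/comm_tact.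
  by rewrite ap_comp ey eN.
have [_] := hpow_null p he ne.
have -> : hpow eta p = 0 by apply: hom_ext => x; apply: key; rewrite tact_nilpotent.
by rewrite subr0.
Qed.

(** Let t = [tact], and let d be least such that t^d eta^a = 0 for some a.  Then 0 < d < p:
    no power of eta is zero as X is not projective, and t^(p-1) eta is N eta = 0.
    Choose x and a functional l with l (t^(d-1) eta^(2a) x) = 1.  The endomorphism
    v |-> sum_(j < d) l (t^(d-1-j) eta^a v) t^j eta^a x
    commutes with t because t^d eta^a = 0, and each term contributes 1 to its trace d. *)
Lemma nonzero_trace X : ~ locproj iota X ->
  exists s : seq (ghomk X (gunit k G) * X),
    hfix (rank1s s) /\ \sum_(lx <- s) (ap lx.1 lx.2 : k) != 0.
Proof.
move=> nX; have [eta [he ne Ne]] := nm_killer X.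
pose P d := `[< exists a, hpow (tact X) d ** hpow eta a = 0 >].
have exP : exists d, P d.
  exists p.-1; apply/asboolP; exists 1%N; apply: hom_ext => x.
  by rewrite hpow1 ap_comp -nm_tact Ne.
case: (ex_minnP exP) => -[|e] /asboolP[a ea] minP.
  case: nX; have [_] := hpow_null a he ne.
  by move: ea; rewrite hcomp1l => ->; rewrite subr0.
have lt_ep : (e.+1 < p)%N.
  rewrite -(prednK (prime_gt0 p_prime)) ltnS minP //; apply/asboolP; exists 1%N.
  by apply: hom_ext => x; rewrite hpow1 ap_comp -nm_tact Ne.
have ea2 : hpow (tact X) e ** hpow eta (a + a) <> 0.
  by move=> h; have := minP e; rewrite ltnn => /(_ (introT (asboolP _) (ex_intro _ _ h))).
have [x x0] : exists x, ap (hpow (tact X) e ** hpow eta (a + a)) x != 0.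
  apply: contrapT => h; apply: ea2; apply: hom_ext => x.
  by apply/eqP/negP => hx; apply: h; exists x; apply/negP.
have [l ll lx] := dual_vector x0.
have [ha _] := hpow_null a he ne.
have comm_a i : hpow eta a ** hpow (tact X) i = hpow (tact X) i ** hpow eta a.
  by apply: esym; apply: hpow_comm; apply: esym; exact: comm_tact.
pose lam i := mkhom (X := X) (Y := gunit k G) ll ** hpow (tact X) (e - i) ** hpow eta a.
pose vec i := ap (hpow (tact X) i ** hpow eta a) x.
exists [seq (lam i, vec i) | i <- index_iota 0 e.+1]; split; last first.
  rewrite big_map big_mkord (eq_bigr (fun=> 1)).
    rewrite sumr_const card_ord; apply/negP => /eqP e0.
    have : (p %| e.+1)%N by rewrite (dvdn_pcharf charp) e0.
    by move/dvdn_leq => /(_ isT); rewrite leqNgt lt_ep.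
  move=> i _; rewrite /lam /vec -ap_comp.
  have -> : (mkhom (X := X) (Y := gunit k G) ll ** hpow (tact X) (e - i) ** hpow eta a) **
            hpow (tact X) i ** hpow eta a =
            mkhom (X := X) (Y := gunit k G) ll ** hpow (tact X) e ** hpow eta (a + a).
    rewrite hpowD -!hcompA (hcompA (hpow eta a) (hpow (tact X) i)) comm_a -!hcompA.
    rewrite (hcompA (hpow (tact X) (e - i))) -hpowD subnK //.
    by have := ltn_ord i; rewrite ltnS.
  by rewrite ap_comp.
apply: hfix_comm; apply: hom_ext => v; rewrite !ap_comp !ap_rank1s linear_sum !big_map !big_mkord.
rewrite big_ord_recl [RHS]big_ord_recr /=.
have tv i : hpow (tact X) i ** hpow eta a ** tact X = hpow (tact X) i.+1 ** hpow eta a.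
  by rewrite comm_tact // -[i.+1]addn1 hpowD hpow1 -hcompA.
have -> : ap (lam 0) (ap (tact X) v) = 0.
  by rewrite /lam subn0 -ap_comp -!hcompA tv ea hcomp0r.
have -> : ap (tact X) (ap (lam e) v *: vec e) = 0.
  rewrite linearZ /= /vec -ap_comp hcompA -hpowS ea ap_zero.
  exact: scaler0.
rewrite scale0r add0r addr0; apply: eq_bigr => i _.
rewrite linearZ /= /vec /lam -!ap_comp -!hcompA tv (hcompA (tact X)) -hpowS.
by rewrite /bump /= add1n -!hpowS subnSK //.
Qed.

End CyclicGroup.

(** * Detecting projectivity by tensor products *)

Section Evaluation.
Variables (k : fieldType) (G : groupType) (X Y : gmod k G).
Local Notation dual := (ghomk X (gunit k G)).


Definition coev_fun (l : dual) (x : X) (y : Y) : gtens (gtens X Y) dual := pure (pure x y : gtens X Y) l.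
Fact coev_fun_linear l x : linear (coev_fun l x).
Proof.
move=> a u v; rewrite /coev_fun (pure_bilinear X Y).2.
exact: (pure_bilinear (gtens X Y) dual).1.
Qed.
Definition coev (l : dual) (x : X) : ghomk Y (gtens (gtens X Y) dual) := mkhom (coev_fun_linear l x).
Lemma coevE l x y : ap (coev l x) y = pure (pure x y : gtens X Y) l. Proof. by []. Qed.

Fact coev_bilinear : bilinear_map coev.
Proof.
split=> [x|l] a u v; apply: hom_ext => y; rewrite ap_add ap_scale !coevE.
  exact: (pure_bilinear (gtens X Y) dual).2.
rewrite (pure_bilinear X Y).1; exact: (pure_bilinear (gtens X Y) dual).1.
Qed.

Lemma coev_act g l x : act g (coev l x) = coev (act g l) (act g x).
Proof.
apply: hom_ext => y; rewrite ap_act !coevE.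
by rewrite (@gtens_act_pure _ _ (gtens X Y) dual) gtens_act_pure gactKV.
Qed.

Definition eval_bil (l : dual) (x : X) (y : Y) : Y := (ap l x : k) *: y.
Fact eval_bilP l : bilinear_map (eval_bil l).
Proof.
split=> [y|x] a u v; rewrite /eval_bil.
  by rewrite ap_linear scalerDl -scalerA.
by rewrite scalerDr !scalerA mulrC.
Qed.
Definition eval_at (l : dual) : ghomk (gtens X Y) Y :=
  mkhom (X := gtens X Y) (tens_lift_linear (eval_bilP l)).
Lemma eval_at_pure l x y : ap (eval_at l) (pure x y : gtens X Y) = (ap l x : k) *: y.
Proof. by rewrite ap_mk tens_lift_pure //; exact: eval_bilP. Qed.

Lemma eval_at_linear : linear eval_at.
Proof.
move=> a l m; apply: hom_tens_ext => x y; rewrite ap_add ap_scale !eval_at_pure.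
by rewrite ap_add ap_scale scalerDl -scalerA.
Qed.

Lemma eval_at_act g l : act g (eval_at l) = eval_at (act g l).
Proof.
apply: hom_tens_ext => x y; rewrite ap_act.
rewrite gtens_act_pure !eval_at_pure (linZ (act_linear g)) gactKV.
by [].
Qed.

Fact ev_bilinear : bilinear_map (fun (t : gtens X Y) (l : dual) => ap (eval_at l) t).
Proof.
split=> [l|t] a u v; first exact: ap_linear.
by rewrite eval_at_linear ap_add ap_scale.
Qed.
Definition ev : ghomk (gtens (gtens X Y) dual) Y :=
  mkhom (X := gtens (gtens X Y) dual) (tens_lift_linear ev_bilinear).

Lemma ev_pure t l : ap ev (pure t l : gtens (gtens X Y) dual) = ap (eval_at l) t.
Proof. by rewrite ap_mk tens_lift_pure //; exact: ev_bilinear. Qed.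

Lemma ev_act g : act g ev = ev.
Proof.
apply: (@hom_tens_ext k G (gtens X Y) dual) => t l; rewrite ap_act.
rewrite (@gtens_act_pure _ _ (gtens X Y) dual).
by rewrite !ev_pure -eval_at_act ap_act gactKV invgK gactKV.
Qed.

(** This scalar is the trace of the endomorphism of X that the tensor represents. *)
Lemma ev_coev s : ev ** tens_lift coev (tens_class s) = (\sum_(lx <- s) (ap lx.1 lx.2 : k)) *: idh Y.
Proof.
rewrite /tens_lift (tens_repr_eval _ coev_bilinear) /tens_eval.
rewrite (lin_sum ((hcomp_bilinear _ _ _).2 ev)) scaler_suml; apply: eq_bigr => lx _.
apply: hom_ext => y; rewrite ap_comp coevE ev_pure eval_at_pure.
by [].
Qed.

End Evaluation.

Section CyclicRetract.
Variables (k : fieldType) (G : groupType) (H : finGroupType) (p : nat).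
Variable iota : {multiplicative H -> G}.
Hypotheses (charp : p \in [pchar k]) (cycH : cyclic [set: H]) (cardH : #|[set: H]| = p).
Implicit Types X Y : gmod k G.

(** Coevaluation at an equivariant endomorphism of X of nonzero trace, divided by this trace. *)
Lemma nonprojective_retract X Y : ~ locproj iota X ->
  exists (i : ghomk Y (gtens (gtens X Y) (ghomk X (gunit k G)))) r,
    [/\ hfix iota i, hfix iota r & r ** i = idh Y].
Proof.
move=> nX; have [s [hs tr]] := nonzero_trace charp cycH cardH nX.
have ht : hfix iota (tens_class s : gtens (ghomk X (gunit k G)) X).
  move=> h; apply: dual_tens_map_inj; rewrite ghom_act dual_tens_map_class.
  exact: hs.
pose c := \sum_(lx <- s) (ap lx.1 lx.2 : k).
exists (c^-1 *: tens_lift (@coev k G X Y) (tens_class s)), (ev X Y); split.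
- apply: hfixZ => h; rewrite -(tens_lift_act (coev_bilinear X Y) (@coev_act k G X Y)).
  by rewrite ht.
- by move=> h; exact: ev_act.
by rewrite hcompZr ev_coev scalerA mulVf // scale1r.
Qed.

Lemma locproj_tensP X Y : locproj iota (gtens X Y) -> locproj iota X \/ locproj iota Y.
Proof.
move=> l; have [lX|nX] := pselect (locproj iota X); [by left | right].
have [i [r [hi hr e]]] := nonprojective_retract Y nX.
rewrite /locproj -e; apply: null_compr => //; apply: locproj_nullr => //.
exact: locproj_tensl.
Qed.

Lemma nm_unit (x : gunit k G) : nm iota x = 0.
Proof.
rewrite /nm (eq_bigr (fun=> x)) // sumr_const -cardsT cardH.
by rewrite -(mulr_natr (x : k)) (pcharf0 charp) mulr0.
Qed.

Lemma unit_not_locproj : ~ locproj iota (gunit k G).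
Proof.
move=> [w e]; have := congr1 (fun f : ghomk (gunit k G) (gunit k G) => ap f (1 : k^o)) e.
rewrite ap_id nm_ap; last by move=> h.
by rewrite nm_unit => /eqP; rewrite oner_eq0.
Qed.

End CyclicRetract.

(** * Modules concentrated at one factor *)

Section IdempotentModule.
Variables (k : fieldType) (H : nat -> finGroupType) (G : groupType).
Variable iota : forall n : nat, {multiplicative H n -> G}.
Hypothesis hG : is_free_product iota.

(** The numbers are identified with K * nat through division by the order of K. *)
Lemma nat_free_action (K : finGroupType) : exists (t : K -> nat -> nat) (T : nat -> bool),
  [/\ t 1%g =1 id, forall h h' i, t (h * h')%g i = t h (t h' i) &
      forall i, exists h0, forall h, T (t h^-1%g i) = (h == h0)].
Proof.
have K0 : (0 < #|K|)%N by apply/card_gt0P; exists 1%g.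
pose e i : K * nat := (enum_val (Ordinal (ltn_pmod i K0)), (i %/ #|K|)%N).
pose e' (x : K * nat) : nat := (x.2 * #|K| + enum_rank x.1)%N.
have eK : cancel e e' by move=> i; rewrite /e' /e /= enum_valK /= -divn_eq.
have e'K : cancel e' e.
  move=> [h q]; rewrite /e /e' /= divnMDl // divn_small ?addn0; last exact: ltn_ord.
  congr pair; apply: enum_rank_inj; rewrite enum_valK; apply: val_inj.
  by rewrite /= modnMDl modn_small.
pose t h i := e' ((h * (e i).1)%g, (e i).2).
exists t, (fun i => (e i).1 == 1%g); split.
- by move=> i; rewrite /t mul1g -surjective_pairing eK.
- by move=> h h' i; rewrite /t e'K /= mulgA.
move=> i; exists (e i).1 => h; rewrite /t e'K /=.
by rewrite mulg_eq1 (inj_eq invg_inj).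
Qed.

Lemma permutation_module (t : forall n, H n -> nat -> nat) :
  (forall n, t n 1%g =1 id) ->
  (forall n h h' i, t n (h * h')%g i = t n h (t n h' i)) ->
  exists (b : G -> (nat -> k^o) -> (nat -> k^o)) lb b1 bM,
    let D := @Gmod k G (nat -> k^o : lmodType k) b lb b1 bM in
    forall n h (v : D) i, act (iota n h) v i = v (t n h^-1%g i).
Proof.
move=> t1 tM.
pose V : lmodType k := (nat -> k^o : lmodType k).
pose a n (h : H n) (v : V) : V := fun i => v (t n h^-1%g i).
have [|||b [lb b1 bM bE]] := @glue_actions k H G iota hG V a.
- by [].
- by move=> n v; apply/funext => i; rewrite /a invg1 t1.
- by move=> n h h' v; apply/funext => i; rewrite /a invgM tM.
by exists b, lb, b1, bM => D n h v i; rewrite -[act _ v]/(b _ v) bE.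
Qed.

(** Functions on nat, where H m permutes nat freely for m distinct from n, while H n fixes 0
    and permutes the positive numbers freely.  Such permutations glue to an action of G.
    Here e is the evaluation at 0 and u the indicator function of 0. *)
Lemma idempotent_module n : exists D : gmod k G,
  (forall m, m != n -> locproj (iota m) D) /\
  exists (e : ghomk D (gunit k G)) (u : D),
    [/\ hfix (iota n) e, hfix (iota n) u, ap e u = (1 : k) &
        null (iota n) (idh D - dual_tens_bil e u)].
Proof.
have ex m := nat_free_action (H m).
pose t m := sval (cid (ex m)); pose T m := sval (cid (svalP (cid (ex m)))).
have tP m : [/\ t m 1%g =1 id, forall h h' i, t m (h * h')%g i = t m h (t m h' i) &
      forall i, exists h0, forall h, T m (t m h^-1%g i) = (h == h0)].
  exact: svalP (cid (svalP (cid (ex m)))).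
(* transport of the free action to the positive numbers at the factor n *)
pose t' m h i := if m == n then (if i is j.+1 then (t m h j).+1 else 0%N) else t m h i.
have [||b [lb [b1 [bM actD0]]]] := @permutation_module t'.
- by move=> m i; rewrite /t'; have [t1 _ _] := tP m; case: eqP; case: i => *; rewrite ?t1.
- by move=> m h h' i; rewrite /t'; have [_ tM _] := tP m; case: eqP; case: i => *; rewrite ?tM.
pose D := @Gmod k G (nat -> k^o : lmodType k) b lb b1 bM; exists D.
have actD m h (v : D) i : act (iota m h) v i = v (t' m h^-1%g i) := actD0 m h v i.
have ev_lin i : linear (fun v : D => v i) by [].
have actVK m h (v : D) i : act (iota m h)^-1%g v (t' m h^-1%g i) = v i.
  by rewrite -(actD m h) gactKV.
split=> [m mn|].
  have [_ _ TP] := tP m.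
  have lpsi : linear (fun (v : D) i => if T m i then v i else 0).
    move=> c v w; apply/funext => i.
    rewrite -[RHS]/(c *: (if T m i then v i else 0) + (if T m i then w i else 0)).
    by case: (T m i); rewrite // scaler0 addr0.
  exists (mkhom (X := D) (Y := D) lpsi); apply: hom_ext => v; apply/funext => i.
  rewrite ap_id /nm ap_sum (lin_sum (ev_lin i)).
  have [h0 h0P] := TP i.
  rewrite (bigD1 h0 isT) big1 => [|h /andP[_ hh0]].
    rewrite [RHS]addr0 ap_act actD ap_mk actVK.
    by rewrite {1}/t' (negbTE mn) h0P eqxx.
  rewrite ap_act actD ap_mk {1}/t' (negbTE mn) h0P (negbTE hh0).
  by [].
have [_ _ TP] := tP n.
have le : linear (fun v : D => v 0%N) by [].
pose u : D := fun i => if i is 0%N then 1 else 0.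
have he : hfix (iota n) (mkhom (X := D) (Y := gunit k G) le).
  apply: ap_hfix => h v; rewrite !ap_mk actD /t' eqxx; by [].
have hu : hfix (iota n) u.
  by move=> h; apply/funext => i; rewrite actD /t' eqxx; case: i.
exists (mkhom (X := D) (Y := gunit k G) le), u; split=> //.
have lpsi : linear (fun (v : D) i => if i is j.+1 then (if T n j then v i else 0) else 0).
  move=> c v w; apply/funext => i.
  rewrite -[RHS]/(c *: (if i is j.+1 then (if T n j then v i else 0) else 0) +
     (if i is j.+1 then (if T n j then w i else 0) else 0)).
  case: i => [|j]; first by rewrite scaler0 addr0.
  by case: (T n j); rewrite // scaler0 addr0.
exists (mkhom (X := D) (Y := D) lpsi); apply: hom_ext => v; apply/funext => i.
rewrite -[LHS]/(v i - v 0%N * u i) /nm ap_sum (lin_sum (ev_lin i)).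
case: i => [|i].
  rewrite mulr1 subrr big1 // => h _; rewrite ap_act actD ap_mk {1}/t' eqxx.
  by [].
rewrite mulr0 subr0; have [h0 h0P] := TP i.
rewrite (bigD1 h0 isT) big1 => [|h /andP[_ hh0]].
  rewrite [RHS]addr0 ap_act actD ap_mk actVK.
  by rewrite {1}/t' eqxx h0P eqxx.
rewrite ap_act actD ap_mk {1}/t' eqxx h0P (negbTE hh0).
by [].
Qed.

End IdempotentModule.

(** * Primes attached to ultrafilters *)

Section Spectrum.
Variables (p : nat) (k : fieldType) (H : nat -> finGroupType) (G : groupType).
Variable iota : forall n : nat, {multiplicative H n -> G}.
Hypothesis charp : p \in [pchar k].
Hypothesis hH : forall n : nat, cyclic [set: H n] /\ #|[set: H n]| = p.
Hypothesis hG : is_free_product iota.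
Implicit Types X Y Z : gmod k G.

Let cycH n : cyclic [set: H n]. Proof. by case: (hH n). Qed.
Let cardH n : #|[set: H n]| = p. Proof. by case: (hH n). Qed.

Lemma locproj_Omega n X : locproj (iota n) (Omega X) <-> locproj (iota n) X.
Proof. by rewrite !(propext (locproj_small _ _)) (propext (small_Omega hG _ _ _)). Qed.

Lemma locproj_triangle n X Y Z : in_triangle X Y Z ->
  [/\ locproj (iota n) X -> locproj (iota n) Y -> locproj (iota n) Z,
      locproj (iota n) Y -> locproj (iota n) Z -> locproj (iota n) X &
      locproj (iota n) X -> locproj (iota n) Z -> locproj (iota n) Y].
Proof. by rewrite !(propext (locproj_small _ _)) => t; exact: (small_triangle hG). Qed.

Lemma locproj_tretract n X Y (i : thom X Y) (r : thom Y X) :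
  teq (tcomp r i) (tid X) -> locproj (iota n) Y -> locproj (iota n) X.
Proof. by move=> e; rewrite !(propext (locproj_small _ _)); exact: (small_tretract hG e). Qed.

Lemma dualisable_triangulated : triangulated_sub (@dualisable k G).
Proof.
split.
- move=> X /(is_zeroP hG) lX; apply/(dualisableP hG) => n.
  exact: locproj_locfin.
- move=> X Y [f tf] /(dualisableP hG) dX; apply/(dualisableP hG) => n.
  exact: ((small_tiso hG (finite_rank k G) n tf).1 (dX n)).
- move=> X; split=> /(dualisableP hG) dX; apply/(dualisableP hG) => n.
    exact: ((small_Omega hG (finite_rank k G) n X).1 (dX n)).
  exact: ((small_Omega hG (finite_rank k G) n X).2 (dX n)).
move=> X Y Z t; split=> /(dualisableP hG) d1 /(dualisableP hG) d2; apply/(dualisableP hG) => n.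
- by have [h _ _] := small_triangle hG (finite_rank k G) n t; exact: h (d1 n) (d2 n).
- by have [_ h _] := small_triangle hG (finite_rank k G) n t; exact: h (d1 n) (d2 n).
by have [_ _ h] := small_triangle hG (finite_rank k G) n t; exact: h (d1 n) (d2 n).
Qed.

Definition ultra_prime (U : set_system nat) X : Prop :=
  dualisable X /\ U [set n | locproj (iota n) X]%classic.

(** Projectivity over one H n is a prime condition, and an ultrafilter is closed under
    intersections and decides every set. *)
Lemma ultra_prime_ideal (U : set_system nat) : UltraFilter U -> prime_ideal (ultra_prime U).
Proof.
move=> FU; have [dz diso dOm dtri] := dualisable_triangulated.
split; first split.
- by move=> X [].
- split.
  + move=> X zX; split; first exact: dz.
    by apply: filterS filterT => n _; move/(is_zeroP hG): zX; apply.
  + move=> X Y iXY [dX UX]; split; first exact: diso dX.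
    case: iXY => f [g [gf fg]]; apply: filterS UX => n /=.
    exact: locproj_tretract fg.
  + move=> X.
    have e : [set n | locproj (iota n) (Omega X)]%classic =
             [set n | locproj (iota n) X]%classic.
      by apply/seteqP; split=> n /= /locproj_Omega.
    by rewrite /ultra_prime e (propext (dOm X)).
  move=> X Y Z t; have [t1 t2 t3] := dtri _ _ _ t.
  split=> -[d1 U1] [d2 U2]; (split; first by [exact: t1 | exact: t2 | exact: t3]).
  + by apply: filterS2 U1 U2 => n /= l1 l2; have [h _ _] := locproj_triangle n t; exact: h.
  + by apply: filterS2 U1 U2 => n /= l1 l2; have [_ h _] := locproj_triangle n t; exact: h.
  by apply: filterS2 U1 U2 => n /= l1 l2; have [_ _ h] := locproj_triangle n t; exact: h.
- move=> X Y i r e [/(dualisableP hG) dY UY]; split.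
    by apply/(dualisableP hG) => n; apply: (small_tretract hG e); exact: dY.
  by apply: filterS UY => n /=; exact: locproj_tretract e.
- move=> X Y [dX UX] dY; split; first exact: (dualisable_tens hG).
  by apply: filterS UX => n /=; exact: locproj_tensl.
- exists (gunit k G); first exact: (dualisable_unit hG).
  move=> [_]; have -> : [set n | locproj (iota n) (gunit k G)]%classic = set0.
    by apply/seteqP; split=> n //=; exact: (unit_not_locproj charp (@cardH n)).
  exact: filter_not_empty.
move=> X Y dX dY [_ UXY].
have [UX|UX] := in_ultra_setVsetC [set n | locproj (iota n) X]%classic FU; [by left | right].
split=> //; apply: filterS2 UXY UX => n /= lXY nX.
by have [|] := locproj_tensP charp (@cycH n) (@cardH n) lXY.
Qed.

Definition ultra_point (U : set_system nat) (FU : UltraFilter U) : Spc k G :=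
  exist _ (ultra_prime U) (ultra_prime_ideal FU).

Definition factor_point (n : nat) : Spc k G := ultra_point (principal_filter_ultra n).

Lemma factor_pointP n X : sval (factor_point n) X <-> dualisable X /\ locproj (iota n) X.
Proof.
by rewrite /factor_point /= /ultra_prime (propext (principal_filterP _ _)).
Qed.

Lemma idempotent_object n : exists D : gmod k G,
  [/\ dualisable D, forall m, m != n -> locproj (iota m) D, ~ locproj (iota n) D &
      exists (e : ghomk D (gunit k G)) (u : D),
        [/\ hfix (iota n) e, hfix (iota n) u & ap e u = (1 : k)]].
Proof.
have [D [lD [e [u [he hu eu nD]]]]] := @idempotent_module k H G iota hG n.
exists D; split=> //; last by exists e, u.
  apply/(dualisableP hG) => m; have [->|mn] := eqVneq m n.
    by apply: smallP nD; exact: rank1_finite.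
  exact/locproj_locfin/lD.
move=> lD'; have : null (iota n) e by exact: locproj_nulll.
move=> [w ew]; move: eu; rewrite ew nm_ap // (nm_unit (iota n) charp (@cardH n)) => /esym/eqP.
by rewrite oner_eq0.
Qed.

(** If X is projective over H n, then X (x) D is zero, so X lies in every prime that omits D.
    If X lies in such a prime Q but is not projective over H n, then D, being zero over the
    other factors, is a retract of X (x) D (x) X^*, and so belongs to Q. *)
Lemma idempotent_support n (D : gmod k G) (Q : Spc k G) :
  dualisable D -> (forall m, m != n -> locproj (iota m) D) ->
  supp D Q -> Q = factor_point n.
Proof.
case: Q => Q pQ dD lD; rewrite /supp /= => nQD; apply: eq_exist.
have [[Qdual [Qz Qiso _ _] Qsum Qtens] _ Qprime] := pQ.
apply/funext => X; apply/propext.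
apply: (iff_trans _ (iff_sym (factor_pointP n X))); split.
  move=> QX; have dX := Qdual _ QX; split=> //; apply: contrapT => nX.
  apply: nQD.
  have [i [r [hi hr e]]] := nonprojective_retract charp (@cycH n) (@cardH n) D nX.
  pose E := gtens (gtens X D) (ghomk X (gunit k G)).
  pose i' m : ghomk D E := if m == n then i else 0.
  pose r' m : ghomk E D := if m == n then r else 0.
  have [|||j [s js]] := @retract_patch k H G iota hG D E i' r'.
  - by move=> m; rewrite /i'; case: eqP => [->|_] //; exact: hfix0.
  - by move=> m; rewrite /r'; case: eqP => [->|_] //; exact: hfix0.
  - move=> m; rewrite /i' /r'; case: eqVneq => [->|mn].
      by rewrite e subrr; exact: null0.
    by rewrite hcomp0l sub0r; apply: nullN; exact: lD.
  apply: Qsum js _.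
  exact: Qtens (Qtens _ _ QX dD) (dualisable_dual hG dX).
move=> [dX lX]; suff /(Qprime X D dX dD)[] : Q (gtens X D) by [].
apply: Qz; apply/(is_zeroP hG) => m; have [->|mn] := eqVneq m n.
  exact: locproj_tensl.
by apply: locproj_tensr; exact: lD.
Qed.

(** For coproducts, take the endomorphism h of C that is the identity over H n and zero over
    the other factors.  Its composites with the structure maps vanish, as the summands are
    projective over H n; so h = 0 by uniqueness. *)
Lemma locproj_localising n : localising_submodule (fun X : gmod k G => locproj (iota n) X).
Proof.
split.
- split.
  + by move=> X /(is_zeroP hG).
  + by move=> X Y [f [g [gf fg]]]; exact: locproj_tretract fg.
  + exact: locproj_Omega.
  by move=> X Y Z t; exact: locproj_triangle.
- move=> I X C j cop lX.
  pose phi m : ghomk C C := if m == n then idh C else 0.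
  have hphi m : hfix (iota m) (phi m).
    by rewrite /phi; case: eqP => _; [exact: hfix_id | exact: hfix0].
  have [h rh] := rep_patch hG hphi.
  have [z [_ zU]] := cop C (fun i => tzero (X i) C).
  have h0 : teq h z.
    apply: zU => i; apply: (rep_teq hG) => m; have [psi rpsi] := rep_ex hG m (j i).
    exists (phi m ** psi), 0; split; [exact: (rep_comp hG) | exact: rep_zero |].
    rewrite subr0 /phi; case: eqP => [e|_]; last by rewrite hcomp0l; exact: null0.
    rewrite hcomp1l; move: rpsi; rewrite e => -[hpsi _].
    exact: locproj_nulll.
  have z0 : teq (tzero C C) z.
    apply: zU => i; apply: (rep_teq hG) => m; have [psi rpsi] := rep_ex hG m (j i).
    exists (0 ** psi), 0; split; [|exact: rep_zero|].
      by apply: (rep_comp hG) => //; exact: rep_zero.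
    by rewrite hcomp0l subr0; exact: null0.
  have [zeta rz] := rep_ex hG n z.
  have n1 := teq_rep hG h0 (rh n) rz.
  have n2 := teq_rep hG z0 (rep_zero _ n C C) rz.
  have := nullB n1 n2; rewrite sub0r opprK subrK /phi eqxx.
  by [].
by move=> X Y _; exact: locproj_tensr.
Qed.

(** A vector y of f fixed by H n gives a morphism D -> f that sends u to y.  It vanishes, so
    it is a trace over H n, and evaluation at u makes y a norm. *)
Lemma orthogonal_locproj n (Y : Spc k G -> Prop) (f : gmod k G) :
  Y (factor_point n) -> right_orthogonal (supported_on Y) f -> locproj (iota n) f.
Proof.
move=> Yn orth.
have [D [dD lD nD [e [u [he hu eu]]]]] := idempotent_object n.
apply: (norm_criterion charp (@cycH n) (@cardH n)) => y hy.
pose phi m : ghomk D f := if m == n then dual_tens_bil e y else 0.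
have hphi m : hfix (iota m) (phi m).
  rewrite /phi; case: eqP => [->|_]; last exact: hfix0.
  move=> h; apply: hom_ext => x; rewrite ap_act !ap_rank1 linearZ /= hy.
  by congr (_ *: _); exact: (congr1 (fun c : ghomk D (gunit k G) => ap c x) (he h)).
have [h rh] := rep_patch hG hphi.
have SD : supported_on Y D.
  move=> L _ subL; apply: subL; split=> // Q QD.
  by rewrite (idempotent_support dD lD QD).
have := teq_rep hG (orth _ SD h) (rh n) (rep_zero _ n D f).
rewrite subr0 /phi eqxx => -[w ew]; exists (ap w u).
by rewrite -nm_ap // -ew ap_rank1 eu scale1r.
Qed.

End Spectrum.

(** * Failure of stratification *)

Theorem theorem1p2 (p : nat) (k : fieldType) (hp : p \in [pchar k]%R)
    (H : nat -> finGroupType)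
    (hH : forall n : nat, cyclic [set: H n] /\ #|[set: H n]| = p)
    (G : groupType) (iota : forall n : nat, {multiplicative H n -> G})
    (hG : is_free_product iota) :
  ~ stratified k G.
Proof.
move=> [_ surj].
have [U [FU subU]] := ultraFilterLemma eventually_filter.
pose P := ultra_point hp hH hG FU.
have [L _ LP] := surj (fun Q => Q = P).
have [t _ [g gP nz]] := (LP P).2 erefl.
have [Y1 [Y2 [e1 [f1 [e2 [f2 [[_ _ PE] [[s1 _ _] [_ o2 _] gE]]]]]]]] := gP.
apply: nz; apply/(is_zeroP hG) => n; rewrite gE; apply: locproj_tensl.
(* the object concentrated at n separates the two points *)
have Pn : factor_point hp hH hG n <> P.
  move=> e; have [D [dD lD nD _]] := idempotent_object hp hH hG n.
  have PD : sval P D.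
    split=> //; apply: subU; exists n.+1 => // m /= lt_nm; apply: lD.
    by rewrite gtn_eqF.
  by move: PD; rewrite -e => /factor_pointP[].
have [Y1n|nY1n] := pselect (Y1 (factor_point hp hH hG n)); last first.
  (* P_n is not in Y1: the generators of e1 belong to P_n *)
  apply: locproj_tensl; apply: (s1 _ (locproj_localising k hG n)) => x [dx sx].
  by apply: contrapT => nx; apply: nY1n; apply: sx => /factor_pointP[].
have [Y2n|nY2n] := pselect (Y2 (factor_point hp hH hG n)).
  (* P_n is in Y2: the object concentrated at n is orthogonal to f2 *)
  by apply: locproj_tensr; exact: (orthogonal_locproj Y2n o2).
by case: Pn; apply/PE.
Qed.
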